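(* Let $M$ be a complete finite-dimensional Riemannian manifold, $\Omega\subset M$ a bounded open subset, $T>0$, $h\in C([0,T)\times\overline{\Omega})$, $\psi\in C(\overline{\Omega})$, and $F\in C(\chi,\mathbb{R})$. Consider the Cauchy–Dirichlet problem $$(\ast)\quad\begin{cases}u_t+F(t,x,u,du,d^2u)=0 & \text{in }(0,T)\times\Omega,\\ u(t,x)=h(t,x), & (t,x)\in[0,T)\times\partial\Omega,\\ u(0,x)=\psi(x), & x\in\overline{\Omega}.\end{cases}$$ Suppose comparison holds for $(\ast)$, i.e. if $w$ is a viscosity subsolution of $(\ast)$ and $v$ is a viscosity supersolution of $(\ast)$, then $w\le v$. Suppose also that there exist a viscosity subsolution $\underline{u}$ and a viscosity supersolution $\bar{u}$ of $(\ast)$ satisfying $\underline{u}_*(0,x)=\bar{u}^*(0,x)=\psi(x)$ for $x\in\overline{\Omega}$ and $\underline{u}_*(t,x)=\bar{u}^*(t,x)=h(t,x)$ for $(t,x)\in[0,T)\times\partial\Omega$. Then $$W(t,x)=\sup\{w(t,x): \underline{u}\le w\le\bar{u}\text{ and } w\text{ is a viscosity subsolution of }(\ast)\}$$ is a viscosity solution of $(\ast)$.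
   Context: Notation. $TM_x$, $TM_x^*$ are the tangent and cotangent spaces at $x$; $\mathcal{L}^2_s(TM_x)$ is the space of symmetric bilinear forms on $TM_x$; $d(\cdot,\cdot)$ is the Riemannian distance. $du$, $d^2u$ denote the first derivative and Hessian in the space variable $x$. $$\chi=\{(t,x,r,\zeta,A): t\in[0,T],\ x\in M,\ r\in\mathbb{R},\ \zeta\in TM_x^*,\ A\in\mathcal{L}^2_s(TM_x)\}.$$ Semicontinuous envelopes. For $u:[0,T)\times\overline{\Omega}\to\mathbb{R}$, $$u^*(t,x)=\lim_{r\downarrow0}\sup\{u(s,y):(s,y)\in[0,T)\times\overline{\Omega},\ |s-t|\le r,\ d(y,x)\le r\},$$ $$u_*(t,x)=\lim_{r\downarrow0}\inf\{u(s,y):(s,y)\in[0,T)\times\overline{\Omega},\ |s-t|\le r,\ d(y,x)\le r\},$$ the upper and lower semicontinuous envelopes of $u$. Parabolic jets. For $f$ upper semicontinuous, $\mathcal{P}^{2,+}f(t,x)$ is the set of triples $(\varphi_t(t,x),d\varphi(t,x),d^2\varphi(t,x))$ where $\varphi\in C^{1,2}([0,T]\times M)$ and $f-\varphi$ attains a local maximum equal to $0$ at $(t,x)$. For $f$ lower semicontinuous, $\mathcal{P}^{2,-}f(t,x)$ is defined in the same way with local minimum equal to $0$. Viscosity solutions. An upper (lower) semicontinuous function $u:[0,T)\times\overline{\Omega}\to\mathbb{R}$ is a viscosity subsolution (supersolution) of $(\ast)$ if $u(t,x)\le(\ge)\,h(t,x)$ for $0\le t<T$, $x\in\partial\Omega$;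 $u(0,x)\le(\ge)\,\psi(x)$ for $x\in\overline{\Omega}$; and for all $(t,x)\in(0,T)\times\Omega$ and all $(p,\zeta,A)\in\mathcal{P}^{2,+}u(t,x)$ (resp. $\mathcal{P}^{2,-}u(t,x)$) one has $p+F(t,x,u(t,x),\zeta,A)\le(\ge)\,0$. A viscosity solution is a function that is both a viscosity subsolution and a viscosity supersolution.
   Formalization: F is additionally assumed degenerate elliptic (A ≤ B implies F(t,x,r,ζ,B) ≤ F(t,x,r,ζ,A)), and the lower envelope of the subsolution and the upper envelope of the supersolution are assumed finite on [0,T)×closure of Ω; the claim fails without these. *)

(* Defs.v *)
From HB Require Import structures.
From mathcomp Require Import all_boot all_order all_algebra.
From mathcomp Require Import all_classical all_reals all_analysis.

Set Implicit Arguments.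
Unset Strict Implicit.
Unset Printing Implicit Defensive.

Import Order.TTheory GRing.Theory Num.Theory.
Import numFieldNormedType.Exports.

Local Open Scope classical_set_scope.
Local Open Scope ring_scope.

Section Calculus.
Context {R : realType} {n : nat}.
Implicit Types (V : set 'rV[R]_n) (f : 'rV[R]_n -> R).

Definition partial (i : 'I_n) f : 'rV[R]_n -> R := fun y => 'D_(delta_mx 0 i) f y.

Definition has_partial (i : 'I_n) f (y : 'rV[R]_n) : Prop :=
  derivable f y (delta_mx 0 i).

Fixpoint Ck (k : nat) V f : Prop :=
  {within V, continuous f} /\
  if k is k'.+1 then
    forall i, (forall y, V y -> has_partial i f y) /\ Ck k' V (partial i f)
  else True.

Definition smooth V f : Prop := forall k, Ck k V f.

(* Derivative at t relative to I, i.e. with increments h such that t + h stays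
   in I: one-sided at the end points of a closed interval. *)
Definition dquot {E : normedModType R} (I : set R) (f : R -> E) (t : R) :
    set_system E :=
  (fun h : R => h^-1 *: (f (t + h) - f t)) @ within [set h | I (t + h)] 0^'.

Definition derivable_within {E : normedModType R} (I : set R) (f : R -> E) t : Prop :=
  cvg (dquot I f t).

Definition derive_within {E : normedModType R} (I : set R) (f : R -> E) t : E :=
  lim (dquot I f t).

End Calculus.

Record chart (R : realType) (n : nat) (M : topologicalType) := Chart {
  chart_dom : set M;
  chart_map : M -> 'rV[R]_n;
  chart_inv : 'rV[R]_n -> M
}.

Definition chart_cod {R : realType} {n} {M : topologicalType} (c : chart R n M) :
  set 'rV[R]_n := chart_map c @` chart_dom c.

Definition is_chart {R : realType} {n} {M : topologicalType} (c : chart R n M) : Prop :=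
  [/\ open (chart_dom c),
      open (chart_cod c),
      (forall x, chart_dom c x -> chart_inv c (chart_map c x) = x),
      {within chart_dom c, continuous (chart_map c)} &
      {within chart_cod c, continuous (chart_inv c)}].

Definition transition {R : realType} {n} {M : topologicalType} (c c' : chart R n M) :
  'rV[R]_n -> 'rV[R]_n := chart_map c' \o chart_inv c.

(* The chart [chart_at x] is used to represent the tangent space at x by
   'rV[R]_n: v stands for the vector \sum_i v_i d/dx^i, where the x^i are the
   coordinates of [chart_at x].  The coordinates of the same vector in another
   chart c are v *m 'J (transition (chart_at x) c) (chart_map (chart_at x) x).
   Accordingly, a covector at x is a row vector (its coefficients on the dx^i)
   and a bilinear form on TM_x is a matrix (its coefficients on dx^i (x) dx^j). *)
Record manifold (R : realType) (n : nat) := Manifold {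
  space :> topologicalType;
  atlas : set (chart R n space);
  chart_at : space -> chart R n space;
  space_hausdorff : hausdorff_space space;
  space_second_countable : @second_countable space;
  atlas_chart : forall c, atlas c -> is_chart c;
  atlas_smooth : forall c c', atlas c -> atlas c' -> forall j : 'I_n,
    smooth (chart_map c @` (chart_dom c `&` chart_dom c'))
           (fun y => transition c c' y 0 j);
  atlas_chart_at : forall x, atlas (chart_at x);
  mem_chart_at : forall x, chart_dom (chart_at x) x
}.

(* The matrix at chart_inv c y, in the chart c, of a field g of bilinear forms
   given pointwise in the charts [chart_at]. *)
Definition form_in_chart {R : realType} {n} {M : manifold R n} (g : M -> 'M[R]_n)
    (c : chart R n M) (y : 'rV[R]_n) : 'M[R]_n :=
  let x := chart_inv c y in
  let K := 'J (transition c (chart_at x)) y in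
  K *m g x *m K^T.

Record riemannianManifold (R : realType) (n : nat) := RiemannianManifold {
  rm_manifold :> manifold R n;
  metric : rm_manifold -> 'M[R]_n;
  metric_sym : forall x, (metric x)^T = metric x;
  metric_pos : forall x (v : 'rV[R]_n), v != 0 -> 0 < (v *m metric x *m v^T) 0 0;
  metric_smooth : forall c, atlas c -> forall i j,
    smooth (chart_cod c) (fun y => form_in_chart metric c y i j)
}.

Section RiemannianDistance.
Context {R : realType} {n : nat} (M : riemannianManifold R n).

Definition C1_curve (gam : R -> M) : Prop :=
  {within `[0, 1], continuous gam} /\
  forall c : chart R n M, atlas c ->
    let J : set R := [set s : R | `[0, 1]%classic s /\ chart_dom c (gam s)] in
    (forall s : R, J s -> derivable_within `[0, 1] (chart_map c \o gam) s) /\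
    {within J, continuous (derive_within `[0, 1] (chart_map c \o gam))}.

Definition speed (gam : R -> M) (s : R) : R :=
  let v := derive_within `[0, 1] (chart_map (chart_at (gam s)) \o gam) s in
  Num.sqrt ((v *m metric (gam s) *m v^T) 0 0).

Definition curve_length (gam : R -> M) : \bar R :=
  (\int[lebesgue_measure]_(s in `[0%R, 1%R]) (speed gam s)%:E)%E.

(* +oo when x and y lie in distinct connected components. *)
Definition rdist (x y : M) : \bar R :=
  ereal_inf [set curve_length gam |
              gam in [set gam | [/\ C1_curve gam, gam 0 = x & gam 1 = y]]].

Definition complete_riemannian : Prop :=
  forall u : nat -> M,
    (forall e : R, 0 < e -> exists N, forall p q, (N <= p)%N -> (N <= q)%N ->
       (rdist (u p) (u q) < e%:E)%E) ->
    exists x, forall e : R, 0 < e -> exists N, forall p, (N <= p)%N ->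
       (rdist (u p) x < e%:E)%E.

Definition rbounded (A : set M) : Prop :=
  exists K : R, forall x y, A x -> A y -> (rdist x y <= K%:E)%E.

End RiemannianDistance.

Section Differentials.
Context {R : realType} {n : nat} {M : riemannianManifold R n}.
Implicit Types (f : M -> R) (x : M).

Definition christoffel (c : chart R n M) (y : 'rV[R]_n) (k i j : 'I_n) : R :=
  let G := form_in_chart (@metric R n M) c in
  2^-1 * \sum_l invmx (G y) k l *
    (partial i (fun z => G z j l) y + partial j (fun z => G z i l) y
     - partial l (fun z => G z i j) y).

Definition differential f x : 'rV[R]_n :=
  let c := chart_at x in
  \row_i partial i (f \o chart_inv c) (chart_map c x).

Definition hessian f x : 'M[R]_n :=
  let c := chart_at x in
  let y := chart_map c x in
  let fc := f \o chart_inv c in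
  \matrix_(i, j) (partial i (partial j fc) y
                  - \sum_k christoffel c y k i j * partial k fc y).

Definition time_derivative (T : R) (phi : R * M -> R) (z : R * M) : R :=
  derive_within `[0, T] (fun s => phi (s, z.2)) z.1.

(* C^{1,2}([0,T] x M) *)
Definition C12 (T : R) (phi : R * M -> R) : Prop :=
  let D : set (R * M) := `[0, T]%classic `*` [set: M] in
  [/\ {within D, continuous phi},
      (forall z : R * M, D z -> derivable_within `[0, T] (fun s => phi (s, z.2)) z.1),
      {within D, continuous (time_derivative T phi)} &
      forall c : chart R n M, atlas c ->
        let Dc : set (R * 'rV[R]_n) := `[0, T]%classic `*` chart_cod c in
        let phic := fun (s : R) (y : 'rV[R]_n) => phi (s, chart_inv c y) in
        forall i : 'I_n,
          [/\ forall z : R * 'rV[R]_n, Dc z -> has_partial i (phic z.1) z.2,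
              {within Dc, continuous (fun z : R * 'rV[R]_n => partial i (phic z.1) z.2)} &
              forall j : 'I_n,
                (forall z : R * 'rV[R]_n, Dc z -> has_partial j (partial i (phic z.1)) z.2) /\
                {within Dc, continuous
                   (fun z : R * 'rV[R]_n => partial j (partial i (phic z.1)) z.2)}]].

End Differentials.

(* Real functions on subsets of R x M (resp. M) are represented by total
   functions, of which only the values on the subset matter.  Likewise for the
   nonlinearity F(t, x, r, zeta, A), only used for t in [0,T] and A symmetric;
   zeta and A are given by their coefficients in [chart_at x]. *)
Section Viscosity.
Context {R : realType} {n : nat} {M : riemannianManifold R n}.

Definition nonlinearity := R -> M -> R -> 'rV[R]_n -> 'M[R]_n -> R.

(* F \in C(chi, R): chi is a bundle over [0,T] x M x R, whose local
   trivialisation over a chart c is given by the coordinates in c.  The covector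
   and form at x with coefficients a and B in c have coefficients a *m J^T and
   J *m B *m J^T in [chart_at x]. *)
Definition continuous_on_chi (T : R) (F : nonlinearity) : Prop :=
  forall c : chart R n M, atlas c ->
    {within [set z : R * 'rV[R]_n * R * 'rV[R]_n * 'M[R]_n |
               let: (t, y, r, a, B) := z in
               [/\ `[0, T]%classic t, chart_cod c y & B^T = B]],
     continuous (fun z : R * 'rV[R]_n * R * 'rV[R]_n * 'M[R]_n =>
       let: (t, y, r, a, B) := z in
       let x := chart_inv c y in
       let J := 'J (transition (chart_at x) c) (chart_map (chart_at x) x) in
       F t x r (a *m J^T) (J *m B *m J^T))}.

Definition degenerate_elliptic (T : R) (F : nonlinearity) : Prop :=
  forall (t : R) x r zeta (A B : 'M[R]_n), `[0, T]%classic t -> A^T = A -> B^T = B ->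
    (forall v : 'rV[R]_n, (v *m A *m v^T) 0 0 <= (v *m B *m v^T) 0 0) ->
    F t x r zeta B <= F t x r zeta A.

Definition usc_on (Q : set (R * M)) (u : R * M -> R) : Prop :=
  forall z, Q z -> forall a, u z < a -> \forall w \near within Q (nbhs z), u w < a.

Definition lsc_on (Q : set (R * M)) (u : R * M -> R) : Prop :=
  forall z, Q z -> forall a, a < u z -> \forall w \near within Q (nbhs z), a < u w.

Definition cylinder (T : R) (Omega : set M) : set (R * M) :=
  `[0, T[%classic `*` closure Omega.

Definition near_pts (Q : set (R * M)) (z : R * M) (r : R) : set (R * M) :=
  [set w | [/\ Q w, `|w.1 - z.1| <= r & (rdist w.2 z.2 <= r%:E)%E]].

Definition upper_envelope (Q : set (R * M)) (u : R * M -> R) (z : R * M) : \bar R :=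
  lim ((fun r : R => ereal_sup [set (u w)%:E | w in near_pts Q z r]) @ (0 : R)^'+).

Definition lower_envelope (Q : set (R * M)) (u : R * M -> R) (z : R * M) : \bar R :=
  lim ((fun r : R => ereal_inf [set (u w)%:E | w in near_pts Q z r]) @ (0 : R)^'+).

Definition jet (T : R) (phi : R * M -> R) (z : R * M) : R * 'rV[R]_n * 'M[R]_n :=
  (time_derivative T phi z,
   differential (fun x => phi (z.1, x)) z.2,
   hessian (fun x => phi (z.1, x)) z.2).

Definition superjets (T : R) (Q : set (R * M)) (f : R * M -> R) (z : R * M) :
    set (R * 'rV[R]_n * 'M[R]_n) :=
  [set jet T phi z | phi in [set phi : R * M -> R |
     [/\ C12 T phi, f z - phi z = 0 &
         \forall w \near within Q (nbhs z), f w - phi w <= 0]]].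

Definition subjets (T : R) (Q : set (R * M)) (f : R * M -> R) (z : R * M) :
    set (R * 'rV[R]_n * 'M[R]_n) :=
  [set jet T phi z | phi in [set phi : R * M -> R |
     [/\ C12 T phi, f z - phi z = 0 &
         \forall w \near within Q (nbhs z), 0 <= f w - phi w]]].

Variables (T : R) (Omega : set M) (F : nonlinearity).
Variables (h : R * M -> R) (psi : M -> R).

Let Q := cylinder T Omega.

(* Omega is meant to be open, so that its boundary is closure Omega `\` Omega. *)
Definition lateral_boundary : set (R * M) :=
  `[0, T[%classic `*` (closure Omega `\` Omega).

Definition viscosity_subsolution (u : R * M -> R) : Prop :=
  [/\ usc_on Q u,
      (forall z, lateral_boundary z -> u z <= h z),
      (forall x, closure Omega x -> u (0, x) <= psi x) &
      forall (t : R) x p zeta A, 0 < t < T -> Omega x ->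
        superjets T Q u (t, x) (p, zeta, A) ->
        p + F t x (u (t, x)) zeta A <= 0].

Definition viscosity_supersolution (u : R * M -> R) : Prop :=
  [/\ lsc_on Q u,
      (forall z, lateral_boundary z -> h z <= u z),
      (forall x, closure Omega x -> psi x <= u (0, x)) &
      forall (t : R) x p zeta A, 0 < t < T -> Omega x ->
        subjets T Q u (t, x) (p, zeta, A) ->
        0 <= p + F t x (u (t, x)) zeta A].

Definition viscosity_solution (u : R * M -> R) : Prop :=
  viscosity_subsolution u /\ viscosity_supersolution u.

Definition comparison_holds : Prop :=
  forall w v : R * M -> R,
    viscosity_subsolution w -> viscosity_supersolution v ->
    forall z, Q z -> w z <= v z.

Definition perron (ulow uup : R * M -> R) (z : R * M) : R :=
  sup [set w z | w in [set w : R * M -> R |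
         (forall z', Q z' -> ulow z' <= w z' <= uup z') /\
         viscosity_subsolution w]].

End Viscosity.

Arguments nonlinearity {R n} M.

(* Main.v *)
(* Perron's method.  Let W^* and W_* be the (topological) envelopes of the
   supremum W of the subsolutions between ulow and uup.

   W^* is a subsolution: if phi touches W^* from above at z0 and the equation
   fails there, it fails, by continuity of F, for phi + theta near z0, where theta
   vanishes to second order at z0 and has small compact sublevel sets.  A
   subsolution w close to W^* at a point close to z0 then has a local maximum of
   w - phi - theta near z0, which is a contradiction.  The boundary conditions come
   from W <= uup and the envelope of uup.  By comparison W^* <= uup, so W^* is one
   of the competitors and W = W^*.

   W_* is a supersolution: if phi touches W_* from below at z0 and the inequality
   fails strictly there, max (W, phi - theta + delta) near z0, extended by W, is
   for small delta a subsolution (by ellipticity), larger than W somewhere, and by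
   comparison it lies below uup: a contradiction.  Comparison finally gives
   W <= W_*, so that W = W_* is also a supersolution.

   The jets are given in the charts [chart_at x], which vary arbitrarily with x.
   The continuity of the equation along a test function therefore rests on the
   covariance of the differential and of the Hessian. *)
From HB Require Import structures.
Require Import Defs.
From mathcomp Require Import all_boot all_order all_algebra.
From mathcomp Require Import all_classical all_reals all_analysis.
From mathcomp Require Import ring lra measurable_realfun.
Set Implicit Arguments.
Unset Strict Implicit.
Unset Printing Implicit Defensive.
Import Order.TTheory GRing.Theory Num.Theory.
Import numFieldNormedType.Exports.
Local Open Scope classical_set_scope.
Local Open Scope ring_scope.

(** * Calculus in R^n *)

(** Three obstacles shape the proof. Test functions must be C^{1,2} on all of [0,T] x M, so theta is
    one minus a compactly supported bump built in a single chart, plus a square in time. The bump is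
    flat to order four, which leaves gradient and Hessian alone; the square in time is enough
    because a jet contains only the first time derivative. The envelopes in the hypotheses are
    metric, whereas jets and semicontinuity are topological. The bridge is that metric balls are
    topological neighbourhoods, proved by bounding lengths in a chart. No monotonicity of F in u is
    available. The zeroth-order argument r is therefore kept apart from the test function: at a
    contact point the two functions are compared at the same r, and a test function can be shifted
    by a constant without changing the operator. All smallness constants serve two purposes: to keep
    the point of contact strictly inside a sublevel set of theta, and to keep the relevant r within
    the range where the sign of the operator is known. *)

Lemma cvg_sum_seq {K : numFieldType} {V : normedModType K} {I T : Type} (F : set_system T)
    {FF : Filter F} (r : seq I) (f : I -> T -> V) (a : I -> V) :
  (forall i, f i x @[x --> F] --> a i) ->
  \sum_(i <- r) f i x @[x --> F] --> \sum_(i <- r) a i.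
Proof.
move=> fa; elim: r => [|i r IH].
  by under eq_cvg do rewrite big_nil; rewrite big_nil; exact: cvg_cst.
by under eq_cvg do rewrite big_cons; rewrite big_cons; exact: cvgD.
Qed.

Lemma cvg_mxP {K : numFieldType} {T : Type} (F : set_system T) {FF : Filter F} {m n}
    (f : T -> 'M[K]_(m, n)) (A : 'M[K]_(m, n)) :
  (forall i j, f x i j @[x --> F] --> A i j) -> f x @[x --> F] --> A.
Proof.
move=> fA.
rewrite (_ : f = fun x => \sum_i \sum_j f x i j *: delta_mx i j); last first.
  by apply/funext => x; exact: matrix_sum_delta.
rewrite [X in _ --> X]matrix_sum_delta.
apply: cvg_sum_seq => i; apply: cvg_sum_seq => j.
exact: cvgZr_tmp.
Qed.

(** * Differentiability of C^1 functions *)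

Section differentiability.
Context {R : realType} {n : nat}.
Implicit Types (f g : 'rV[R]_n -> R) (V : set 'rV[R]_n) (y v : 'rV[R]_n).

Lemma differentiable_eps {U W : normedModType R} (f : U -> W) (L : {linear U -> W}) x :
  continuous L ->
  (forall e, 0 < e -> \forall v \near 0, `|f (v + x) - f x - L v| <= e * `|v|) ->
  differentiable f x /\ 'd f x = L :> (U -> W).
Proof.
move=> cL fL.
have fo : f \o shift x = cst (f x) + L +o_ 0 id.
  apply/eqaddoP => e e0; near=> v => /=.
  rewrite -[X in `|X|]/(f (v + x) - (f x + L v)) opprD addrA.
  by near: v; exact: fL.
have E := diff_unique cL fo.
by split=> //; apply/diff_locallyP; rewrite E.
Unshelve. all: by end_near. Qed.

Lemma is_derive_line {W : normedModType R} (f : 'rV[R]_n -> W) y v (s : R) :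
  derivable f (y + s *: v) v ->
  is_derive s 1 (fun s : R => f (y + s *: v)) ('D_v f (y + s *: v)).
Proof.
move=> df.
have E : (fun h : R => h^-1 *: (((fun s : R => f (y + s *: v)) \o shift s) (h *: 1)
             - f (y + s *: v)))
       = (fun h => h^-1 *: ((f \o shift (y + s *: v)) (h *: v) - f (y + s *: v))).
  apply/funext => h /=; congr (_ *: (f _ - _)).
  by rewrite [h *: 1]mulr1 scalerDl addrCA addrA addrC addrA.
by split; rewrite /derivable /derive E.
Qed.

Lemma partial_MVT f y i (a : R) :
  (forall s : R, `|s| <= `|a| -> has_partial i f (y + s *: delta_mx 0 i)) ->
  exists2 s : R, `|s| <= `|a| &
    f (y + a *: delta_mx 0 i) - f y = partial i f (y + s *: delta_mx 0 i) * a.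
Proof.
move=> fi; set v := delta_mx 0 i in fi *.
pose g s := f (y + s *: v).
have dg (s : R) : `|s| <= `|a| -> is_derive s 1 g (partial i f (y + s *: v)).
  by move=> sa; apply: is_derive_line; exact: fi.
have g0 : g 0 = f y by rewrite /g scale0r addr0.
rewrite -g0 -/(g a).
have cg (b c : R) : `|b| <= `|a| -> `|c| <= `|a| -> {within `[b, c], continuous g}.
  move=> ba ca; apply: derivable_within_continuous => s.
  rewrite in_itv/= => /andP[bs sc]; apply: ex_derive; apply: dg.
  move: ba ca; rewrite !ler_norml => /andP[? ?] /andP[? ?].
  by rewrite (le_trans _ bs)//= (le_trans sc).
have [a0|a0] := leP 0 a.
- have [s| |s] := @MVT_segment R g (fun s => partial i f (y + s *: v)) 0 a a0.
  + rewrite in_itv/= => /andP[s0 sa]; apply: dg.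
    by rewrite !ger0_norm// ltW.
  + by apply: cg; rewrite ?normr0.
  rewrite in_itv/= subr0 => /andP[s0 sa] ->; exists s => //.
  by rewrite !ger0_norm.
- have [s| |s] := @MVT_segment R g (fun s => partial i f (y + s *: v)) a 0 (ltW a0).
  + rewrite in_itv/= => /andP[s0 sa]; apply: dg.
    by rewrite !ltr0_norm// lerN2 ltW.
  + by apply: cg; rewrite ?normr0.
  rewrite in_itv/= sub0r => /andP[s0 sa] e; exists s.
    by rewrite ler0_norm// ltr0_norm// lerN2.
  by rewrite -opprB e mulrN opprK.
Qed.

(** For k from 0 to n these points run from 0 to v along the axes, one coordinate at a time; an
    increment of f telescopes along this broken line. *)
Definition trunc_row (k : nat) v : 'rV[R]_n := \row_j (if (j < k)%N then v 0 j else 0).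

Lemma trunc_row0 v : trunc_row 0 v = 0.
Proof. by apply/rowP => j; rewrite !mxE. Qed.

Lemma trunc_row_full v : trunc_row n v = v.
Proof. by apply/rowP => j; rewrite !mxE ltn_ord. Qed.

Lemma trunc_rowS (k : 'I_n) v :
  trunc_row k.+1 v = trunc_row k v + v 0 k *: delta_mx 0 k.
Proof.
apply/rowP => j; rewrite !mxE eqxx/= ltnS leq_eqVlt -val_eqE/=.
by case: ltngtP => [||/val_inj->]; rewrite ?mulr0 ?addr0 ?mulr1 ?add0r.
Qed.

Lemma norm_row_le (v : 'rV[R]_n) (e : R) : 0 <= e ->
  (forall j, `|v 0 j| <= e) -> `|v| <= e.
Proof.
move=> e0 ve; rewrite /Num.Def.normr/= mx_normrE.
by apply: bigmax_le => // -[i j] _ /=; rewrite ord1.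
Qed.

Lemma coord_le_norm (v : 'rV[R]_n) j : `|v 0 j| <= `|v|.
Proof.
rewrite [leRHS]/Num.Def.normr/= mx_normrE.
exact: (le_bigmax _ (fun ij : 'I_1 * 'I_n => `|v ij.1 ij.2|) (0, j)).
Qed.

Lemma C1_differentiable f y :
  (\forall z \near y, forall i, has_partial i f z) ->
  (forall i, {for y, continuous (partial i f)}) ->
  differentiable f y.
Proof.
move=> fi ci.
pose L v := \sum_k v 0 k * partial k f y.
have linL : linear L.
  move=> a u w; rewrite /L scaler_sumr -big_split/=; apply: eq_bigr => k _.
  by rewrite !mxE mulrDl -[a *: _]/(a * _) mulrA.
pose lL := GRing.isLinear.Build _ _ _ _ _ linL.
pose L' : {linear _ -> _} := HB.pack L lL.
have cL : continuous (L' : 'rV[R]_n -> R).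
  move=> u; rewrite /= /L; apply: (cvg_sum_seq (F := nbhs u)) => k.
  by apply: cvgM; [exact: coord_continuous|exact: cvg_cst].
suff : forall e : R, 0 < e -> \forall v \near (0 : 'rV[R]_n), `|f (v + y) - f y - L' v| <= e * `|v|.
  by move=> /(differentiable_eps cL)[].
(* The n edges contribute at most e' |v| each; dividing by n + 1 also covers dimension 0. *)
move=> e e0; pose e' := e / n.+1%:R.
have e'0 : 0 < e' by rewrite divr_gt0.
have : \forall z \near y, (forall i, has_partial i f z) /\
   forall i, `|partial i f y - partial i f z| <= e'.
  near=> z; split; first by near: z.
  near: z; apply: filter_forall => j.
  by move/cvgrPdist_le: (ci j); apply.
move=> /nbhs_ballP[d /= d0 yd].
near=> v.
have vd : `|v| < d by near: v; exact: (@pseudometric_normed_Zmodule.nbhs0_lt R 'rV[R]_n d d0).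
have small (w : 'rV[R]_n) : `|w| <= `|v| -> ball y d (y + w).
  move=> wv; rewrite -ball_normE/= opprD addrA subrr sub0r normrN.
  exact: le_lt_trans vd.
have trunc_small (k : 'I_n) (s : R) : `|s| <= `|v 0 k| ->
    `|trunc_row k v + s *: delta_mx 0 k| <= `|v|.
  move=> sv; apply: norm_row_le => // j; rewrite !mxE eqxx/= -val_eqE.
  case: ltngtP => [jk|jk|jk] /=; rewrite ?mulr0 ?addr0 ?add0r ?mulr1 ?normr0//.
    exact: coord_le_norm.
  by rewrite (le_trans sv)// coord_le_norm.
have -> : f (v + y) - f y - L' v =
   \sum_(k < n) (f (y + trunc_row k.+1 v) - f (y + trunc_row k v)
                  - v 0 k * partial k f y).
  rewrite sumrB -(big_mkord xpredT (fun k => f (y + trunc_row k.+1 v) - f (y + trunc_row k v))).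
  rewrite (telescope_sumr (fun k => f (y + trunc_row k v)))//.
  by rewrite trunc_row0 trunc_row_full addr0 [v + y]addrC.
apply: (@le_trans _ _ (\sum_(k < n) e' * `|v|)).
  apply: (le_trans (ler_norm_sum _ _ _)); apply: ler_sum => k _.
  rewrite trunc_rowS addrA.
  have [s sv|s sv ->] := @partial_MVT f (y + trunc_row k v) k (v 0 k).
    by rewrite -addrA; apply: (yd _ _).1; apply: small; exact: trunc_small.
  rewrite [v 0 k * _]mulrC -mulrBl normrM ler_pM//; last exact: coord_le_norm.
  rewrite distrC -addrA; apply: (yd _ _).2; apply: small; exact: trunc_small.
rewrite sumr_const card_ord -mulrnAl ler_wpM2r// -mulr_natr /e' -mulrA ler_piMr//.
  exact: ltW.
by rewrite mulrC ler_pdivrMr// mul1r ler_nat.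
Unshelve. all: by end_near. Qed.

End differentiability.

Section Ck_calculus.
Context {R : realType}.

Lemma derive_partials n (f : 'rV[R]_n -> R) y v : differentiable f y ->
  'D_v f y = \sum_k v 0 k * partial k f y.
Proof.
move=> df; rewrite deriveE// [in LHS](row_sum_delta v) linear_sum/=.
by apply: eq_bigr => k _; rewrite linearZ/= /partial deriveE.
Qed.

Lemma differentiable_row {U : normedModType R} m (tau : U -> 'rV[R]_m) (y : U) :
  (forall k, differentiable (fun z => tau z 0 k) y) -> differentiable tau y.
Proof.
move=> dt.
rewrite (_ : tau = \sum_k (fun z => tau z 0 k *: delta_mx 0 k)).
  by apply: differentiable_sum => k; apply: differentiableZl.
by apply/funext => z; rewrite fct_sumE; exact: row_sum_delta.
Qed.

Lemma partial_comp n m (f : 'rV[R]_m -> R) (tau : 'rV[R]_n -> 'rV[R]_m) y i :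
  differentiable tau y -> differentiable f (tau y) ->
  has_partial i (f \o tau) y /\
  partial i (f \o tau) y =
    \sum_k partial k f (tau y) * partial i (fun z => tau z 0 k) y.
Proof.
move=> dt df; split; first by apply: diff_derivable; exact: differentiable_comp.
rewrite /partial deriveE; last exact: differentiable_comp.
rewrite diff_comp//= -(deriveE _ dt) -deriveE// derive_partials//.
apply: eq_bigr => k _; rewrite mulrC; congr (_ * _).
by rewrite derive_mx ?mxE//; exact: diff_derivable.
Qed.

Variable n : nat.
Implicit Types (f g : 'rV[R]_n -> R) (U V : set 'rV[R]_n) (y : 'rV[R]_n).

Lemma Ck_within k V f : Ck k V f -> {within V, continuous f}.
Proof. by case: k => [|k] []. Qed.

Lemma Ck_continuous k V f y : open V -> Ck k V f -> V y -> {for y, continuous f}.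
Proof.
move=> oV /Ck_within; rewrite continuous_open_subspace// => fV Vy.
by apply: fV; rewrite inE.
Qed.

Lemma Ck0 V f : open V -> (forall y, V y -> {for y, continuous f}) -> Ck 0 V f.
Proof.
move=> oV cf; split=> //; rewrite continuous_open_subspace// => y.
by rewrite inE; exact: cf.
Qed.

Lemma CkW k V f : Ck k.+1 V f -> Ck k V f.
Proof.
elim: k f => [|k IH] f [cf pf]; first by split.
by split=> // i; have [hp Cp] := pf i; split=> //; exact: IH.
Qed.

Lemma Ck_partial k V f i : Ck k.+1 V f -> Ck k V (partial i f).
Proof. by move=> [_ /(_ i)[]]. Qed.

Lemma Ck_has_partial k V f i y : Ck k.+1 V f -> V y -> has_partial i f y.
Proof. by move=> [_ /(_ i)[+ _]]; exact. Qed.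

Lemma Ck_differentiable k V f y : open V -> Ck k.+1 V f -> V y -> differentiable f y.
Proof.
move=> oV Cf Vy; apply: C1_differentiable.
  have : \forall z \near y, V z by exact: open_nbhs_nbhs.
  by apply: filterS => z Vz i; exact: Ck_has_partial Cf Vz.
by move=> i; apply: (Ck_continuous oV (Ck_partial i Cf)).
Qed.

(** This is what allows a function defined piecewise, such as [manifold_bump], to be treated on one
    open piece at a time. *)
Lemma Ck_local k V f :
  (forall y, V y -> exists U, [/\ open U, U y & Ck k U f]) -> Ck k V f.
Proof.
elim: k f => [|k IH] f loc.
  split=> //; apply: continuous_in_subspaceT => y; rewrite inE => /loc[U [oU Uy Cf]].
  exact: (Ck_continuous oU Cf).
split.
  apply: continuous_in_subspaceT => y; rewrite inE => /loc[U [oU Uy Cf]].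
  exact: (Ck_continuous oU Cf).
move=> i; split; first by move=> y /loc[U [_ Uy Cf]]; exact: Ck_has_partial Cf Uy.
by apply: IH => y /loc[U [oU Uy Cf]]; exists U; split=> //; exact: Ck_partial.
Qed.

Lemma eq_partial V f g i y : open V -> (forall z, V z -> f z = g z) -> V y ->
  partial i f y = partial i g y.
Proof.
move=> oV fg Vy; apply: near_eq_derive.
have : \forall z \near y, V z by exact: open_nbhs_nbhs.
by apply: filterS => z /fg.
Qed.

Lemma eq_has_partial V f g i y : open V -> (forall z, V z -> f z = g z) -> V y ->
  has_partial i f y -> has_partial i g y.
Proof.
move=> oV fg Vy; apply: near_eq_derivable.
have : \forall z \near y, V z by exact: open_nbhs_nbhs.
by apply: filterS => z /fg.
Qed.

Lemma eq_Ck k V f g : open V -> (forall y, V y -> f y = g y) -> Ck k V f -> Ck k V g.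
Proof.
move=> oV; elim: k f g => [|k IH] f g fg.
  by move=> [cf _]; split=> //; apply: subspace_eq_continuous cf => y; rewrite inE => /fg.
move=> [cf pf]; split.
  by apply: subspace_eq_continuous cf => y; rewrite inE => /fg.
move=> i; have [hp Cp] := pf i; split.
  by move=> y Vy; apply: (eq_has_partial oV fg) => //; exact: hp.
by apply: IH Cp => y Vy; exact: eq_partial oV fg Vy.
Qed.

Lemma Ck_cst k V (a : R) : Ck k V (cst a).
Proof.
elim: k a => [|k IH] a; first by split=> //; apply: continuous_subspaceT; exact: cst_continuous.
split; first by apply: continuous_subspaceT; exact: cst_continuous.
move=> i; split; first by move=> y _; exact: derivable_cst.
rewrite (_ : partial i _ = cst 0); first exact: IH.
by apply/funext => y; exact: derive_cst.
Qed.

Lemma partialD f g i y : has_partial i f y -> has_partial i g y ->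
  partial i (f \+ g) y = partial i f y + partial i g y.
Proof. exact: deriveD. Qed.

Lemma CkD k V f g : open V -> Ck k V f -> Ck k V g -> Ck k V (f \+ g).
Proof.
move=> oV; elim: k f g => [|k IH] f g Cf Cg.
  by apply: Ck0 => // y Vy; apply: (cvgD (F := nbhs y));
    [exact: (Ck_continuous oV Cf)|exact: (Ck_continuous oV Cg)].
split.
  by apply: (Ck_within (k := 0)); apply: Ck0 => // y Vy; apply: (cvgD (F := nbhs y));
    [exact: (Ck_continuous oV Cf)|exact: (Ck_continuous oV Cg)].
move=> i; split.
  by move=> y Vy; apply: derivableD; [exact: Ck_has_partial Cf Vy|exact: Ck_has_partial Cg Vy].
apply: (eq_Ck oV) (IH _ _ (Ck_partial i Cf) (Ck_partial i Cg)) => y Vy.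
by rewrite partialD//; [exact: Ck_has_partial Cf Vy|exact: Ck_has_partial Cg Vy].
Qed.

Lemma partialM f g i y : has_partial i f y -> has_partial i g y ->
  partial i (f \* g) y = f y * partial i g y + g y * partial i f y.
Proof. exact: deriveM. Qed.

Lemma CkM k V f g : open V -> Ck k V f -> Ck k V g -> Ck k V (f \* g).
Proof.
move=> oV; elim: k f g => [|k IH] f g Cf Cg.
  by apply: Ck0 => // y Vy; apply: (cvgM (F := nbhs y));
    [exact: (Ck_continuous oV Cf)|exact: (Ck_continuous oV Cg)].
split.
  by apply: (Ck_within (k := 0)); apply: Ck0 => // y Vy; apply: (cvgM (F := nbhs y));
    [exact: (Ck_continuous oV Cf)|exact: (Ck_continuous oV Cg)].
move=> i; split.
  by move=> y Vy; apply: derivableM; [exact: Ck_has_partial Cf Vy|exact: Ck_has_partial Cg Vy].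
apply: (eq_Ck (f := (f \* partial i g) \+ (g \* partial i f)) oV).
  move=> y Vy; rewrite partialM//; [exact: Ck_has_partial Cf Vy|exact: Ck_has_partial Cg Vy].
by apply: CkD => //; apply: IH; try exact: CkW; exact: Ck_partial.
Qed.

Lemma Ck_sum k V (I : Type) (r : seq I) (F : I -> 'rV[R]_n -> R) : open V ->
  (forall i, Ck k V (F i)) -> Ck k V (fun y => \sum_(i <- r) F i y).
Proof.
move=> oV CF; elim: r => [|i r IH].
  by apply: (eq_Ck oV) (Ck_cst k V 0) => y _; rewrite big_nil.
by apply: (eq_Ck oV) (CkD oV (CF i) IH) => y _; rewrite big_cons.
Qed.

End Ck_calculus.

(** Induction on k through the chain rule: a partial of f o tau is a sum of products of (partial j
    f) o tau, covered by the induction hypothesis, with partials of tau. *)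
Lemma Ck_comp {R : realType} n m k (V : set 'rV[R]_n) (W : set 'rV[R]_m)
    (f : 'rV[R]_m -> R) (tau : 'rV[R]_n -> 'rV[R]_m) :
  open V -> open W -> (forall y, V y -> W (tau y)) ->
  (forall j, Ck k V (fun y => tau y 0 j)) -> Ck k W f -> Ck k V (f \o tau).
Proof.
move=> oV oW VW; elim: k f => [|k IH] f Ct Cf.
  apply: Ck0 => // y Vy; apply: continuous_comp.
    by apply: (cvg_mxP (F := nbhs y)) => i j; rewrite ord1; exact: (Ck_continuous oV (Ct j)).
  by apply: (Ck_continuous oW Cf); exact: VW.
have dt y : V y -> differentiable tau y.
  by move=> Vy; apply: differentiable_row => j; exact: (Ck_differentiable oV (Ct j)).
have df y : V y -> differentiable f (tau y).
  by move=> Vy; apply: (Ck_differentiable oW Cf); exact: VW.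
have C0 : Ck 0 V (f \o tau).
  by apply: Ck0 => // y Vy; apply: differentiable_continuous;
    apply: differentiable_comp; [exact: dt|exact: df].
split; first exact: Ck_within C0.
move=> i; split.
  by move=> y Vy; apply: (partial_comp i (dt _ Vy) (df _ Vy)).1.
apply: (eq_Ck (f := fun y => \sum_j partial j f (tau y) * partial i (fun z => tau z 0 j) y) oV).
  by move=> y Vy; rewrite (partial_comp i (dt _ Vy) (df _ Vy)).2.
apply: Ck_sum => // j; apply: (CkM (f := partial j f \o tau)) => //.
  by apply: IH => [l|]; [exact: CkW|exact: Ck_partial].
exact: Ck_partial.
Qed.

(** * Symmetry of second derivatives and necessary conditions at a maximum *)

Section second_order.
Context {R : realType} {n : nat}.
Implicit Types (f : 'rV[R]_n -> R) (V : set 'rV[R]_n) (y : 'rV[R]_n).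

Lemma is_derive_translate f (z c v : 'rV[R]_n) : derivable f (z + c) v ->
  is_derive z v (fun z => f (z + c)) ('D_v f (z + c)).
Proof.
move=> df.
have E : (fun h : R => h^-1 *: (((fun z => f (z + c)) \o shift z) (h *: v) - f (z + c)))
       = (fun h : R => h^-1 *: ((f \o shift (z + c)) (h *: v) - f (z + c))).
  by apply/funext => h /=; rewrite addrA.
by split; rewrite /derivable /derive E.
Qed.

Lemma norm_delta_le (a : R) (i : 'I_n) : `|a *: delta_mx 0 i : 'rV[R]_n| <= `|a|.
Proof.
apply: norm_row_le => // j; rewrite !mxE eqxx/=.
by case: (j == i); rewrite ?mulr1 ?mulr0 ?normr0.
Qed.

(** The mean value theorem is applied twice: along e_i to z -> f (z + s e_j) - f z, then along e_j
    to the i-th partial. *)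
Lemma double_difference V f y i j (d s : R) : Ck 2 V f -> 0 < s ->
  s + s < d -> ball y d `<=` V ->
  exists2 p, ball y d p &
    f (y + s *: delta_mx 0 i + s *: delta_mx 0 j) - f (y + s *: delta_mx 0 i)
      - (f (y + s *: delta_mx 0 j) - f y) = partial j (partial i f) p * s * s.
Proof.
move=> Cf s0 sd dV; set ei := delta_mx 0 i; set ej := delta_mx 0 j.
have dom (a b : R) : `|a| <= `|s| -> `|b| <= `|s| -> ball y d (y + a *: ei + b *: ej).
  rewrite (gtr0_norm s0) => a_s b_s; rewrite -ball_normE/= -addrA opprD addrA subrr sub0r normrN.
  apply: le_lt_trans sd; rewrite (le_trans (ler_normD _ _))// lerD//.
    exact: le_trans (norm_delta_le _ _) a_s.
  exact: le_trans (norm_delta_le _ _) b_s.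
have hf a b : `|a| <= `|s| -> `|b| <= `|s| -> has_partial i f (y + a *: ei + b *: ej).
  by move=> sa sb; apply: (Ck_has_partial Cf (dV _ _)); exact: dom.
pose g z := f (z + s *: ej) - f z.
have dg (a : R) : `|a| <= `|s| -> is_derive (y + a *: ei) ei g
    (partial i f (y + a *: ei + s *: ej) - partial i f (y + a *: ei)).
  move=> sa; apply: is_deriveB; last first.
    apply: derivableP; rewrite -[y + _]addr0 -(scale0r ej); apply: hf => //.
    by rewrite normr0.
  by apply: is_derive_translate; exact: hf.
have [a sa ->] : exists2 a : R, `|a| <= `|s| &
    f (y + s *: ei + s *: ej) - f (y + s *: ei) - (f (y + s *: ej) - f y) =
    (partial i f (y + a *: ei + s *: ej) - partial i f (y + a *: ei)) * s.
  have [|a sa E] := @partial_MVT _ _ g y i s.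
    by move=> a /dg[].
  by exists a => //; rewrite -[LHS]/(g (y + s *: ei) - g y) E /partial; have [_ ->] := dg _ sa.
have [|b sb ->] := @partial_MVT _ _ (partial i f) (y + a *: ei) j s.
  by move=> b sb; apply: (Ck_has_partial (Ck_partial i Cf) (dV _ _)); exact: dom.
by exists (y + a *: ei + b *: ej) => //; exact: dom.
Qed.

Lemma dist_le_half (a b c e : R) : `|a - c| <= e / 2 -> `|b - c| <= e / 2 -> `|a - b| <= e.
Proof.
move=> ac bc; rewrite -(subrKA c) [e]splitr (le_trans (ler_normD _ _))// lerD//.
by rewrite distrC.
Qed.

(** The double difference is symmetric in i and j, so the two mixed partials agree at two points p
    and q near y; continuity brings both to y. *)
Lemma partialC V f y i j : open V -> Ck 2 V f -> V y ->
  partial i (partial j f) y = partial j (partial i f) y.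
Proof.
move=> oV Cf Vy; apply/eqP; rewrite -subr_eq0 -normr_le0.
apply/ler_addgt0Pl => e e0; rewrite addr0.
have : \forall z \near y, [/\ V z,
    `|partial i (partial j f) y - partial i (partial j f) z| <= e / 2 &
    `|partial j (partial i f) y - partial j (partial i f) z| <= e / 2].
  have c2 a b : {for y, continuous (partial a (partial b f))}.
    exact: (Ck_continuous oV (Ck_partial a (Ck_partial b Cf)) Vy).
  have e20 : 0 < e / 2 by rewrite divr_gt0.
  apply: filterS3 (open_nbhs_nbhs (conj oV Vy))
    ((cvgrPdist_le _ _).1 (c2 i j) _ e20) ((cvgrPdist_le _ _).1 (c2 j i) _ e20).
  by move=> z V1 V2 V3; split; [exact: V1|exact: V2|exact: V3].
move=> /nbhs_ballP[d /= d0 yd].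
(* Two steps of length s must stay in the ball of radius d. *)
pose s := d / 3.
have s0 : 0 < s by rewrite divr_gt0.
have sd : s + s < d by rewrite /s; lra.
have dV : ball y d `<=` V by move=> z /yd[].
have [p /yd[_ _ pe] Ep] := double_difference i j Cf s0 sd dV.
have [q /yd[_ qe _] Eq] := double_difference j i Cf s0 sd dV.
have pq : partial j (partial i f) p = partial i (partial j f) q.
  apply: (mulIf (lt0r_neq0 s0)); apply: (mulIf (lt0r_neq0 s0)).
  apply: etrans (esym Ep) _; apply: etrans _ Eq.
  rewrite (addrAC y (s *: delta_mx 0 i) (s *: delta_mx 0 j)) !opprB.
  by rewrite [LHS]addrACA [RHS]addrACA; congr (_ + _); exact: addrC.
by apply: (dist_le_half qe); rewrite -pq; exact: pe.
Qed.

(** Here [psi] is the derivative of [phi]. If L were positive, psi h / h would be positive for small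
    h, and phi would increase just to the right of 0. *)
Lemma second_order_max1 (phi psi : R -> R) (L : R) :
  (\forall s \near (0 : R), is_derive (s : R) (1 : R) phi (psi s)) -> is_derive (0 : R) (1 : R) psi L ->
  (\forall s \near (0 : R), phi s <= phi 0) -> psi 0 = 0 /\ L <= 0.
Proof.
move=> dphi dpsi maxphi.
have [d /= d0 dP] : exists2 d : R, 0 < d & forall s : R, `|s| < d ->
    is_derive (s : R) (1 : R) phi (psi s) /\ phi s <= phi 0.
  have : \forall s \near (0 : R), is_derive (s : R) (1 : R) phi (psi s) /\ phi s <= phi 0.
    by near=> s; split; near: s.
  move=> /nbhs_ballP[d /= d0 dP]; exists d => // s sd; apply: dP.
  by rewrite -ball_normE/= sub0r normrN.
have psi0 : psi 0 = 0.
  have := @derive1_at_max _ phi (- d) d 0.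
  have dP' t : t \in `](- d), d[%R -> `|t| < d by rewrite in_itv/= ltr_norml.
  case=> [||||_].
  - by rewrite ge0_cp// ltW.
  - by move=> t /dP'/dP[[]].
  - by rewrite in_itv/= oppr_lt0 d0.
  - by move=> t /dP'/dP[].
  have [|[_ ->]] // := dP 0; by rewrite normr0.
split=> //; rewrite leNgt; apply/negP => L0.
have [e /= e0 eP] : exists2 e : R, 0 < e & forall h, `|h| < e -> h != 0 -> 0 < h^-1 * psi h.
  have [dpsi0 dpsiL] := dpsi.
  have : h^-1 *: ((psi \o shift 0) (h *: 1) - psi 0) @[h --> (0 : R)^'] --> L.
    by rewrite -dpsiL; exact: dpsi0.
  move=> /cvgr_gt/(_ _ L0)/nbhs_ballP[e /= e0 eP]; exists e => // h he h0.
  have := eP h; rewrite -ball_normE/= sub0r normrN psi0 subr0 addr0 [h *: 1]mulr1.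
  exact.
pose s := Num.min d e / 2.
have m0 : 0 < Num.min d e by rewrite lt_min d0.
have s0 : 0 < s by rewrite divr_gt0.
have [sd se] : s < d /\ s < e by apply/andP; rewrite -lt_min /s; lra.
have [c||c] := @MVT _ phi psi 0 s s0.
- rewrite in_itv/= => /andP[c0 cs]; apply: (dP c _).1.
  by rewrite gtr0_norm// (lt_trans cs).
- apply: derivable_within_continuous => c; rewrite in_itv/= => /andP[c0 cs].
  by have [|[]] // := dP c; rewrite ger0_norm// (le_lt_trans cs).
rewrite in_itv/= subr0 => /andP[c0 cs] E.
have : 0 < c^-1 * psi c by apply: eP; rewrite ?gt_eqF// gtr0_norm// (lt_trans cs).
rewrite pmulr_rgt0 ?invr_gt0// => psic.
have : phi s <= phi 0 by apply: (dP s _).2; rewrite gtr0_norm.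
by apply/negP; rewrite -ltNge -subr_gt0 E mulr_gt0.
Unshelve. all: by end_near. Qed.

Lemma second_order_max V f y (v : 'rV[R]_n) : open V -> Ck 2 V f -> V y ->
  (\forall z \near y, f z <= f y) ->
  \sum_i v 0 i * partial i f y = 0 /\
  \sum_i v 0 i * \sum_j v 0 j * partial j (partial i f) y <= 0.
Proof.
move=> oV Cf Vy maxf.
pose phi (s : R) := f (y + s *: v).
pose psi (s : R) := \sum_i v 0 i * partial i f (y + s *: v).
have line0 : y + (0 : R) *: v = y by rewrite scale0r addr0.
have cline : (fun s : R => y + s *: v) @ (0 : R) --> y.
  rewrite -[X in _ --> X]line0; apply: cvgD; first exact: cvg_cst.
  by apply: cvgZr_tmp; exact: cvg_id.
have nearV : \forall s \near (0 : R), V (y + s *: v).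
  by apply: cline; exact: open_nbhs_nbhs.
have [|||psi0 L0] := @second_order_max1 phi psi
   (\sum_i v 0 i * \sum_j v 0 j * partial j (partial i f) y).
- apply: filterS nearV => s Vs; rewrite /psi -derive_partials.
    apply: is_derive_line; apply: diff_derivable.
    exact: Ck_differentiable oV Cf Vs.
  exact: Ck_differentiable oV Cf Vs.
- have -> : psi = \sum_i (fun s => v 0 i * partial i f (y + s *: v)).
    by apply/funext => s; rewrite fct_sumE.
  apply: is_derive_sum => i.
  have di : differentiable (partial i f) y.
    exact: Ck_differentiable oV (Ck_partial i Cf) Vy.
  rewrite -derive_partials// -[v 0 i * 'D_v _ _]/(v 0 i *: _) -[in 'D_v _ y]line0.
  apply: is_deriveZ; apply: is_derive_line; rewrite line0.
  exact: diff_derivable.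
- by rewrite /phi line0; exact: (cline _ maxf).
by split=> //; move: psi0; rewrite /psi line0.
Qed.

End second_order.

Section positive_power.
Context {R : realType}.

(** Exponent m gives class C^(m-1) ([Ck_pos_pow]); the bump below uses exponent 3 in order to be
    C^2. *)
Definition pos_pow (m : nat) (s : R) : R := Num.max 0 s ^+ m.

Lemma continuous_pos_pow m : continuous (pos_pow m).
Proof.
move=> s; apply: (@continuous_comp _ _ _ (fun s : R => Num.max 0 s) (fun x : R => x ^+ m)).
  by apply: continuous_max; [exact: cvg_cst|exact: cvg_id].
exact: exprn_continuous.
Qed.

Lemma pos_powS m (s : R) : pos_pow m.+2 s = s * pos_pow m.+1 s.
Proof.
rewrite /pos_pow [in LHS]exprS; have [s0|s0] := leP 0 s; first by [].
by rewrite !expr0n/= !mulr0.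
Qed.

(** A quadratic remainder valid on both sides of the kink, so that the derivative at 0 is obtained
    together with the others. *)
Lemma pos_pow2_taylor (s h : R) :
  `|pos_pow 2 (h + s) - pos_pow 2 s - 2 * pos_pow 1 s * h| <= h ^+ 2.
Proof.
rewrite /pos_pow expr1 ler_norml.
by have [?|?] := leP 0 (h + s); have [?|?] := leP 0 s; apply/andP; split; nra.
Qed.

Lemma is_derive_pos_pow m (s : R) :
  is_derive s (1 : R) (pos_pow m.+2) (m.+2%:R * pos_pow m.+1 s).
Proof.
elim: m => [|m IH]; last first.
  have E : pos_pow m.+3 = (id : R -> R) * pos_pow m.+2.
    by apply/funext => x; rewrite pos_powS.
  rewrite E; apply: is_derive_eq.
  rewrite -[_ *: _ + _ *: _]/(s * (m.+2%:R * pos_pow m.+1 s) + pos_pow m.+2 s * 1).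
  by rewrite mulrCA -pos_powS mulr1 -[in RHS]natr1 [in RHS]mulrDl mul1r.
suff H : (fun h : R => h^-1 *: ((pos_pow 2 \o shift s) (h *: 1) - pos_pow 2 s))
    @ 0^' --> 2%:R * pos_pow 1 s.
  by split; [apply/cvg_ex; exists (2%:R * pos_pow 1 s)|apply: cvg_lim].
apply/cvgrPdist_le => e e0; near=> h.
have h0 : h != 0 by near: h; exact: nbhs_dnbhs_neq.
rewrite /= [h *: 1]mulr1 -[_ *: _]/(_ * _) distrC.
have -> : h^-1 * (pos_pow 2 (h + s) - pos_pow 2 s) - 2 * pos_pow 1 s
  = h^-1 * (pos_pow 2 (h + s) - pos_pow 2 s - 2 * pos_pow 1 s * h) by field.
rewrite normrM normfV ler_pdivrMl ?normr_gt0//.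
apply: (le_trans (pos_pow2_taylor _ _)); rewrite -normr_id -[h ^+ 2]ger0_norm ?sqr_ge0//.
rewrite normr_id normrX expr2 ler_wpM2l//; near: h.
by apply: dnbhs0_le.
Unshelve. all: by end_near. Qed.

End positive_power.

(** * Derivatives relative to [0, T] *)

Section derivative_within.
Context {R : realType}.
Implicit Types (T t : R).

Lemma dnbhs_within_proper T t : 0 < T -> `[0, T]%classic t ->
  ProperFilter (within [set h | `[0, T]%classic (t + h)] (0 : R)^').
Proof.
rewrite /= in_itv/= => T0 /andP[t0 tT].
split; last exact: within_filter.
move=> /nbhs_ballP[e /= e0 eP].
have ab h : `|h| < e -> h != 0 -> 0 <= t + h <= T -> False.
  by move=> he h0 hT; apply: (eP h); rewrite -?ball_normE/= ?sub0r ?normrN// in_itv.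
have [tltT|Tt] := ltP t T.
  pose m := Num.min e (T - t).
  have m0 : 0 < m by rewrite lt_min e0 subr_gt0.
  have me : m <= e by rewrite ge_min lexx.
  have mT : m <= T - t by rewrite ge_min lexx orbT.
  apply: (ab (m / 2)); first by rewrite gtr0_norm; lra.
    by rewrite gt_eqF//; lra.
  by apply/andP; split; lra.
pose m := Num.min e T.
have m0 : 0 < m by rewrite lt_min e0.
have me : m <= e by rewrite ge_min lexx.
have mT : m <= T by rewrite ge_min lexx orbT.
apply: (ab (- (m / 2))); first by rewrite normrN gtr0_norm; lra.
  by rewrite lt_eqF//; lra.
by apply/andP; split; lra.
Qed.

Lemma dquot_unique {E : normedModType R} T (f : R -> E) t l : 0 < T -> `[0, T]%classic t ->
  dquot `[0, T]%classic f t --> l ->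
  derivable_within `[0, T]%classic f t /\ derive_within `[0, T]%classic f t = l.
Proof.
move=> T0 tT fl; have PF := dnbhs_within_proper T0 tT.
split; first by apply/cvg_ex; exists l.
exact: cvg_lim.
Qed.

Lemma derive_withinP {E : normedModType R} T (f : R -> E) t l : 0 < T -> `[0, T]%classic t ->
  is_derive t (1 : R) f l ->
  derivable_within `[0, T]%classic f t /\ derive_within `[0, T]%classic f t = l.
Proof.
move=> T0 tT [df <-]; apply: dquot_unique => //.
apply: cvg_within_filter.
rewrite (_ : (fun h => _) = (fun h : R => h^-1 *: ((f \o shift t) (h *: 1) - f t))); first exact: df.
by apply/funext => h; rewrite /= [h *: 1]mulr1 (addrC h t).
Qed.

Lemma derive_within_lin T (f g : R -> R) (k t : R) : 0 < T -> `[0, T]%classic t ->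
  derivable_within `[0, T]%classic f t -> derivable_within `[0, T]%classic g t ->
  derivable_within `[0, T]%classic (fun s => f s + k * g s) t /\
  derive_within `[0, T]%classic (fun s => f s + k * g s) t =
  derive_within `[0, T]%classic f t + k * derive_within `[0, T]%classic g t.
Proof.
move=> T0 tT df dg; apply: dquot_unique => //; have PF := dnbhs_within_proper T0 tT.
rewrite /dquot (_ : (fun h => _) = (fun h : R =>
  h^-1 *: (f (t + h) - f t) + k * (h^-1 *: (g (t + h) - g t)))).
  apply: cvgD; first exact: df.
  by apply: cvgM; [exact: cvg_cst|exact: dg].
apply/funext => h; rewrite -!/(_ * _).
rewrite -[h^-1 *: (f _ - _)]/(h^-1 * (f (t + h) - f t)).
rewrite -[h^-1 *: (g _ - _)]/(h^-1 * (g (t + h) - g t)).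
rewrite -[LHS]/(h^-1 * (f (t + h) + k * g (t + h) - (f t + k * g t))).
ring.
Qed.

End derivative_within.

Lemma nbhs_itvcc {R : realType} (T t : R) : 0 < t < T -> nbhs t (`[0, T]%classic : set R).
Proof.
move=> t0T; have : t \in `]0, T[%R by rewrite in_itv/=.
move=> /near_in_itvoo; apply: filterS => s; rewrite /= !in_itv/=.
by move=> /andP[s0 sT]; rewrite !ltW.
Qed.

(** At an interior time every small increment is admissible, so the restricted filter is the full
    punctured one. *)
Lemma derive_within_interior {R : realType} (T : R) (f : R -> R) (t : R) : 0 < t < T ->
  derivable_within `[0, T]%classic f t ->
  is_derive t (1 : R) f (derive_within `[0, T]%classic f t).
Proof.
move=> t0T df.
have E : (fun h : R => h^-1 *: ((f \o shift t) (h *: 1) - f t))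
       = (fun h : R => h^-1 *: (f (t + h) - f t)).
  by apply/funext => h; rewrite /= [h *: 1]mulr1 (addrC h t).
have W : within [set h | `[0, T]%classic (t + h)] (0 : R)^' = (0 : R)^'.
  have I0 : \forall h \near (0 : R)^', `[0, T]%classic (t + h).
    apply: nbhs_dnbhs.
    have ct : (fun h : R => t + h) @ (0 : R) --> t.
      rewrite -[X in _ --> X]addr0; apply: (cvgD (F := nbhs (0 : R))); first exact: cvg_cst.
      exact: cvg_id.
    exact: (ct _ (nbhs_itvcc t0T)).
  apply/seteqP; split=> P; last exact: cvg_within.
  by rewrite /within/= => HP; apply: filterS2 I0 HP => h Ih; apply.
split; last by rewrite /derive_within /dquot W /derive E.
by move: df; rewrite /derivable_within /dquot W /derivable E.
Qed.

(** * Second-order chain rule and derivatives of a pulled-back metric *)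

Section change_of_variables.
Context {R : realType} {n : nat}.
Implicit Types (f : 'rV[R]_n -> R) (y : 'rV[R]_n) (tau : 'rV[R]_n -> 'rV[R]_n).

Lemma partial_sum i (F : 'I_n -> 'rV[R]_n -> R) y : (forall q, has_partial i (F q) y) ->
  has_partial i (fun z => \sum_q F q z) y /\
  partial i (fun z => \sum_q F q z) y = \sum_q partial i (F q) y.
Proof.
move=> Fi.
have -> : (fun z => \sum_q F q z) = \sum_q F q by apply/funext => z; rewrite fct_sumE.
by split; [exact: derivable_sum|exact: derive_sum].
Qed.

Lemma partial_mul f g i y : has_partial i f y -> has_partial i g y ->
  has_partial i (fun z => f z * g z) y /\
  partial i (fun z => f z * g z) y = partial i f y * g y + f y * partial i g y.
Proof.
move=> fi gi; split; first exact: derivableM.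
apply: etrans (partialM fi gi) _; apply: etrans (addrC _ _) _.
exact (f_equal2 +%R (mulrC _ _) erefl).
Qed.

Definition dmx (i : 'I_n) (A : 'rV[R]_n -> 'M[R]_n) y : 'M[R]_n :=
  \matrix_(j, l) partial i (fun z => A z j l) y.

Lemma dmxE i A y j l : dmx i A y j l = partial i (fun z => A z j l) y.
Proof. exact: mxE. Qed.

Lemma dmx_mul i (A B : 'rV[R]_n -> 'M[R]_n) y :
  (forall j l, has_partial i (fun z => A z j l) y) ->
  (forall j l, has_partial i (fun z => B z j l) y) ->
  (forall j l, has_partial i (fun z => (A z *m B z) j l) y) /\
  dmx i (fun z => A z *m B z) y = dmx i A y *m B y + A y *m dmx i B y.
Proof.
move=> Ai Bi.
have E j l : (fun z => (A z *m B z) j l) = (fun z => \sum_q A z j q * B z q l).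
  by apply/funext => z; rewrite mxE.
have P j l := @partial_sum i (fun q z => A z j q * B z q l) y
  (fun q => (partial_mul (Ai j q) (Bi q l)).1).
split=> [j l|]; first by rewrite E; exact: (P j l).1.
apply/matrixP => j l; rewrite [LHS]mxE E (P j l).2 !mxE -big_split/=.
by apply: eq_bigr => q _; rewrite (partial_mul (Ai j q) (Bi q l)).2 !mxE.
Qed.

Lemma jacobianE tau y i k : differentiable tau y ->
  'J tau y i k = partial i (fun z => tau z 0 k) y.
Proof.
move=> dt; rewrite mxE -deriveE// derive_mx ?mxE//.
exact: diff_derivable.
Qed.

(** For fixed i this is the derivative of the Jacobian of tau in direction i, the form in which it
    enters the product rule for J G J^T. *)
Definition map_hess tau (i : 'I_n) y : 'M[R]_n :=
  \matrix_(j, k) partial i (partial j (fun z => tau z 0 k)) y.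

Variables (V W : set 'rV[R]_n) (tau : 'rV[R]_n -> 'rV[R]_n).
Hypotheses (oV : open V) (oW : open W) (VW : forall y, V y -> W (tau y)).
Hypothesis Ctau : forall j, Ck 2 V (fun z => tau z 0 j).

Let H := map_hess tau.

Let dtau y : V y -> differentiable tau y.
Proof. by move=> Vy; apply: differentiable_row => k; exact: Ck_differentiable oV (Ctau k) Vy. Qed.

Lemma partial_comp_jacobian f y i : Ck 1 W f -> V y ->
  partial i (f \o tau) y = \sum_k partial k f (tau y) * 'J tau y i k.
Proof.
move=> Cf Vy; rewrite (partial_comp i (dtau Vy) (Ck_differentiable oW Cf (VW Vy))).2.
by apply: eq_bigr => k _; rewrite jacobianE//; exact: dtau.
Qed.

Lemma partial2_comp f y i j : Ck 2 W f -> V y ->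
  partial i (partial j (f \o tau)) y =
  \sum_k partial k f (tau y) * H i y j k +
  \sum_p \sum_q 'J tau y i p * 'J tau y j q * partial p (partial q f) (tau y).
Proof.
move=> Cf Vy.
have E z : V z -> partial j (f \o tau) z =
    \sum_q partial q f (tau z) * partial j (fun x => tau x 0 q) z.
  by move=> Vz; rewrite (partial_comp j (dtau Vz) (Ck_differentiable oW Cf (VW Vz))).2.
rewrite (eq_partial i oV E Vy).
have d1 q := partial_comp i (dtau Vy) (Ck_differentiable oW (Ck_partial q Cf) (VW Vy)).
have d2 q : has_partial i (partial j (fun x => tau x 0 q)) y.
  exact: Ck_has_partial (Ck_partial j (Ctau q)) Vy.
have dp q := partial_mul (d1 q).1 (d2 q).
rewrite (partial_sum (fun q => (dp q).1)).2.
rewrite exchange_big/= -big_split/=; apply: eq_bigr => q _.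
apply: etrans (dp q).2 _.
rewrite (d1 q).2 addrC [H i y j q]mxE; congr (_ + _); rewrite mulr_suml.
apply: eq_bigr => p _; rewrite !jacobianE//; last exact: dtau.
  by rewrite -mulrA [LHS]mulrC.
exact: dtau.
Qed.

Lemma dmx_pullback (G : 'rV[R]_n -> 'M[R]_n) y i :
  (forall a b, Ck 1 W (fun z => G z a b)) -> V y ->
  dmx i (fun z => 'J tau z *m G (tau z) *m ('J tau z)^T) y =
  H i y *m G (tau y) *m ('J tau y)^T
  + 'J tau y *m (\sum_m 'J tau y i m *: dmx m G (tau y)) *m ('J tau y)^T
  + 'J tau y *m G (tau y) *m (H i y)^T.
Proof.
move=> CG Vy.
have JE j l z : V z -> partial j (fun z => tau z 0 l) z = 'J tau z j l.
  by move=> Vz; rewrite jacobianE//; exact: dtau.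
have dJ j l : has_partial i (fun z => 'J tau z j l) y.
  apply: (eq_has_partial oV (JE j l) Vy).
  exact: Ck_has_partial (Ck_partial j (Ctau l)) Vy.
have dJH : dmx i (fun z => 'J tau z) y = H i y.
  by apply/matrixP => j l; rewrite !mxE (eq_partial i oV (JE j l) Vy).
have dG a b := partial_comp i (dtau Vy) (Ck_differentiable oW (CG a b) (VW Vy)).
have dGE : dmx i (fun z => G (tau z)) y = \sum_m 'J tau y i m *: dmx m G (tau y).
  apply/matrixP => a b; rewrite mxE summxE; apply: etrans (dG a b).2 _.
  apply: eq_bigr => m _; rewrite !mxE -jacobianE; last exact: dtau.
  by rewrite mxE mulrC.
have dJT : dmx i (fun z => ('J tau z)^T) y = (H i y)^T.
  rewrite -dJH; apply/matrixP => a b; rewrite dmxE [RHS]mxE dmxE; congr partial.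
  by apply/funext => z; exact: mxE.
have dJTp a b : has_partial i (fun z => ('J tau z)^T a b) y.
  rewrite (_ : (fun z => _) = (fun z => 'J tau z b a)); first exact: dJ.
  by apply/funext => z; rewrite mxE.
have [p1 e1] := dmx_mul dJ (fun a b => (dG a b).1).
have [_ ->] := dmx_mul p1 dJTp.
by rewrite e1 dJH dGE dJT mulmxDl.
Qed.

Lemma map_hess_sym y i j k : V y -> map_hess tau i y j k = map_hess tau j y i k.
Proof.
move=> Vy; rewrite [LHS]mxE [RHS]mxE.
exact (@partialC _ _ _ _ y i j oV (Ctau k) Vy).
Qed.

End change_of_variables.

(** * Charts and covariance of the Hessian *)

(* J is the Jacobian of a change of coordinates and H its second derivatives; G, D
   and D' are the metric and its partial derivatives in the two charts.  The
   H-term is the defect of tensoriality of the Christoffel symbols: it cancels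
   against the one in the second derivatives of a function. *)
Lemma christoffel_change {R : realType} n (J G : 'M[R]_n) (D D' H : 'I_n -> 'M[R]_n)
    (a : 'rV[R]_n) i j :
  G^T = G -> (forall i j k, H i j k = H j i k) ->
  G \in unitmx -> J \in unitmx ->
  (forall i, D' i = H i *m G *m J^T + J *m (\sum_m J i m *: D m) *m J^T
                    + J *m G *m (H i)^T) ->
  \sum_k (2^-1 * \sum_l invmx (J *m G *m J^T) k l * (D' i j l + D' j i l - D' l i j))
     * (a *m J^T) 0 k =
  \sum_k a 0 k * H i j k +
  \sum_p \sum_q J i p * J j q *
    \sum_k (2^-1 * \sum_l invmx G k l * (D p q l + D q p l - D l p q)) * a 0 k.
Proof.
move=> Gsym Hsym Gu Ju D'E.
(* The covector with its index raised by the metric: w in the chart of G, u in the chart of J G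
   J^T. *)
pose w := a *m invmx G; pose u := w *m invmx J.
have G'u : J *m G *m J^T \in unitmx by rewrite !unitmx_mul Ju Gu unitmx_tr Ju.
have uE : a *m J^T *m invmx (J *m G *m J^T) = u.
  apply: (can_inj (mulmxK G'u)); rewrite mulmxKV// /u /w.
  by rewrite !mulmxA mulmxKV// mulmxKV.
have uJ : u *m J = w by rewrite /u mulmxKV.
have Gw : G *m w^T = a^T by rewrite -{1}Gsym -trmx_mul /w mulmxKV.
(* Contracting Christoffel symbols with a covector amounts to using the dual vector, so that inverse
   matrices disappear from the rest of the computation. *)
have contract (A : 'M[R]_n) (b : 'rV_n) (F : 'I_n -> R) :
    \sum_k (2^-1 * \sum_l A k l * F l) * b 0 k = 2^-1 * \sum_l (b *m A) 0 l * F l.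
  under eq_bigr do rewrite -mulrA mulr_suml.
  rewrite -mulr_sumr exchange_big/=; congr (_ * _); apply: eq_bigr => l _.
  by rewrite mxE mulr_suml; apply: eq_bigr => k _; lra.
rewrite contract uE.
under [X in _ = _ + X]eq_bigr do under eq_bigr do rewrite contract -/w.
(* The sums [third i j] and [third j i] come from D' i and D' j, and again, through the symmetry of
   H, from D' l with the opposite sign, so they cancel. The H-terms that remain are two equal
   copies, halved by the factor 1/2. *)
pose third i j := \sum_l u 0 l * (J *m G *m (H i)^T) j l.
pose T i := \sum_m J i m *: D m.
have E1 i' j' : \sum_l u 0 l * D' i' j' l =
    \sum_k a 0 k * H i' j' k + (J *m T i' *m w^T) j' 0 + third i' j'.
  transitivity ((D' i' *m u^T) j' 0).
    by rewrite mxE; apply: eq_bigr => l _; rewrite !mxE mulrC.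
  rewrite D'E !mulmxDl -![_ *m J^T *m _]mulmxA -trmx_mul uJ -[_ *m G *m w^T]mulmxA Gw.
  rewrite 2!mxE; congr (_ + _ + _).
    by rewrite mxE; apply: eq_bigr => k _; rewrite !mxE mulrC.
  by rewrite mxE; apply: eq_bigr => l _; rewrite !mxE mulrC.
have E3 : \sum_l u 0 l * D' l i j =
    third i j + (J *m (\sum_m w 0 m *: D m) *m J^T) i j + third j i.
  have -> : \sum_m w 0 m *: D m = \sum_l u 0 l *: T l.
    under [RHS]eq_bigr do rewrite scaler_sumr.
    rewrite exchange_big/=; apply: eq_bigr => m _.
    under eq_bigr do rewrite scalerA.
    by rewrite -scaler_suml -uJ mxE.
  have swap l i' j' : (J *m G *m (H l)^T) j' i' = (J *m G *m (H i')^T) j' l.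
    by rewrite !mxE; apply: eq_bigr => b _; rewrite !mxE Hsym.
  have D'l l : u 0 l * D' l i j = u 0 l * (J *m G *m (H i)^T) j l
      + u 0 l * (J *m T l *m J^T) i j + u 0 l * (J *m G *m (H j)^T) i l.
    have tr : H l *m G *m J^T = (J *m G *m (H l)^T)^T.
      by rewrite !trmx_mul trmxK Gsym mulmxA.
    have add3 (A B C : 'M[R]_n) : (A + B + C) i j = A i j + B i j + C i j.
      by rewrite !mxE.
    rewrite D'E tr add3 -/(T l).
    have -> : (J *m G *m (H l)^T)^T i j = (J *m G *m (H l)^T) j i by rewrite mxE.
    by rewrite (swap l i j) (swap l j i) !mulrDr.
  under eq_bigr do rewrite D'l.
  rewrite !big_split/= /third; congr (_ + _ + _).
  rewrite mulmx_sumr mulmx_suml summxE; apply: eq_bigr => l _.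
  by rewrite -scalemxAr -scalemxAl [in RHS]mxE.
have -> : \sum_l u 0 l * (D' i j l + D' j i l - D' l i j) =
    \sum_l u 0 l * D' i j l + \sum_l u 0 l * D' j i l - \sum_l u 0 l * D' l i j.
  by rewrite -big_split -sumrB/=; apply: eq_bigr => l _; lra.
rewrite !E1 E3.
have -> : \sum_k a 0 k * H j i k = \sum_k a 0 k * H i j k.
  by apply: eq_bigr => k _; rewrite Hsym.
have F1 i' j' : (J *m T i' *m w^T) j' 0 =
    \sum_p \sum_q J i' p * J j' q * \sum_l w 0 l * D p q l.
  rewrite /T mulmx_sumr mulmx_suml summxE; apply: eq_bigr => p _.
  rewrite -scalemxAr -scalemxAl -mulmxA 2!mxE mulr_sumr; apply: eq_bigr => q _.
  rewrite mulrA; congr (_ * _); rewrite mxE.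
  by apply: eq_bigr => l _; rewrite !mxE mulrC.
have F2 : (J *m (\sum_m w 0 m *: D m) *m J^T) i j =
    \sum_p \sum_q J i p * J j q * \sum_l w 0 l * D l p q.
  rewrite -mulmxA mxE; apply: eq_bigr => p _.
  rewrite mxE mulr_sumr; apply: eq_bigr => q _.
  rewrite [in LHS]mulrA [J^T q j]mxE [LHS]mulrAC; congr (_ * _).
  by rewrite summxE; apply: eq_bigr => l _; rewrite mxE.
have F1' : (J *m T j *m w^T) i 0 = \sum_p \sum_q J i p * J j q * \sum_l w 0 l * D q p l.
  rewrite F1 exchange_big/=; apply: eq_bigr => p _; apply: eq_bigr => q _.
  by rewrite [J j q * _]mulrC.
rewrite F1 F1' F2.
have -> : \sum_p \sum_q J i p * J j q *
      (2^-1 * \sum_l w 0 l * (D p q l + D q p l - D l p q)) =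
   2^-1 * (\sum_p \sum_q J i p * J j q * (\sum_l w 0 l * D p q l)
   + \sum_p \sum_q J i p * J j q * (\sum_l w 0 l * D q p l)
   - \sum_p \sum_q J i p * J j q * (\sum_l w 0 l * D l p q)).
  rewrite -big_split -sumrB/= mulr_sumr; apply: eq_bigr => p _.
  rewrite -big_split -sumrB/= mulr_sumr; apply: eq_bigr => q _.
  rewrite -mulrDr -mulrBr mulrCA; congr (_ * (_ * _)).
  by rewrite -big_split -sumrB/=; apply: eq_bigr => l _; lra.
lra.
Qed.

Local Opaque partial jacobian derive.

Section charts.
Context {R : realType} {n : nat} {M : manifold R n}.
Implicit Types (c : chart R n M) (x : M) (y : 'rV[R]_n).

Lemma chart_mapK c x : atlas c -> chart_dom c x -> chart_inv c (chart_map c x) = x.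
Proof. by move=> /atlas_chart[_ _ K _ _]; exact: K. Qed.

Lemma chart_cod_map c x : chart_dom c x -> chart_cod c (chart_map c x).
Proof. by move=> cx; exists x. Qed.

Lemma chart_dom_inv c y : atlas c -> chart_cod c y -> chart_dom c (chart_inv c y).
Proof. by move=> ac [x cx <-]; rewrite chart_mapK. Qed.

Lemma chart_invK c y : atlas c -> chart_cod c y -> chart_map c (chart_inv c y) = y.
Proof. by move=> ac [x cx <-]; rewrite chart_mapK. Qed.

Lemma open_chart_dom c : atlas c -> open (chart_dom c).
Proof. by move=> /atlas_chart[]. Qed.

Lemma open_chart_cod c : atlas c -> open (chart_cod c).
Proof. by move=> /atlas_chart[]. Qed.

Lemma continuous_chart_map c x : atlas c -> chart_dom c x -> {for x, continuous (chart_map c)}.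
Proof.
move=> ac cx; have [od _ _ cc _] := atlas_chart ac.
by move: cc; rewrite continuous_open_subspace//; apply; rewrite inE.
Qed.

Lemma continuous_chart_inv c y : atlas c -> chart_cod c y -> {for y, continuous (chart_inv c)}.
Proof.
move=> ac cy; have [_ od _ _ cc] := atlas_chart ac.
by move: cc; rewrite continuous_open_subspace//; apply; rewrite inE.
Qed.

Definition overlap c c' : set 'rV[R]_n := chart_map c @` (chart_dom c `&` chart_dom c').

Lemma overlapP c c' y : atlas c ->
  overlap c c' y <-> chart_cod c y /\ chart_dom c' (chart_inv c y).
Proof.
move=> ac; split=> [[x [cx c'x] <-]|[cy c'y]].
  by split; [exact: chart_cod_map|rewrite chart_mapK].
by exists (chart_inv c y); rewrite ?chart_invK//; split=> //; exact: chart_dom_inv.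
Qed.

Lemma open_overlap c c' : atlas c -> atlas c' -> open (overlap c c').
Proof.
move=> ac ac'; rewrite openE => y /(overlapP _ _ ac)[cy c'y].
have N1 : \forall z \near y, chart_cod c z.
  by apply: open_nbhs_nbhs; split=> //; exact: open_chart_cod.
have N2 : \forall z \near y, chart_dom c' (chart_inv c z).
  apply: (continuous_chart_inv ac cy); apply: open_nbhs_nbhs; split=> //.
  exact: open_chart_dom.
by apply: filterS2 N1 N2 => z cz c'z; apply/(overlapP _ _ ac).
Qed.

Lemma Ck_transition c c' k j : atlas c -> atlas c' ->
  Ck k (overlap c c') (fun y => transition c c' y 0 j).
Proof. by move=> ac ac'; exact: atlas_smooth. Qed.

Lemma differentiable_transition c c' y : atlas c -> atlas c' -> overlap c c' y ->
  differentiable (transition c c') y.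
Proof.
move=> ac ac' oy; apply: differentiable_row => k.
exact: Ck_differentiable (open_overlap ac ac') (Ck_transition 1 k ac ac') oy.
Qed.

Lemma transition_cod c c' y : atlas c -> atlas c' -> overlap c c' y ->
  chart_cod c' (transition c c' y).
Proof. by move=> ac ac' /(overlapP _ _ ac)[cy c'y]; exact: chart_cod_map. Qed.

Lemma transition_inv c c' y : atlas c -> atlas c' -> overlap c c' y ->
  chart_inv c' (transition c c' y) = chart_inv c y.
Proof. by move=> ac ac' /(overlapP _ _ ac)[cy c'y]; rewrite /transition/= chart_mapK. Qed.

Lemma transition_trans c c' c'' y : atlas c -> atlas c' -> overlap c c' y ->
  transition c' c'' (transition c c' y) = transition c c'' y.
Proof. by move=> ac ac' oy; rewrite {1}/transition/= transition_inv. Qed.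

Lemma overlap_trans c c' c'' y : atlas c -> atlas c' ->
  overlap c c' y -> overlap c c'' y -> overlap c' c'' (transition c c' y).
Proof.
move=> ac ac' oy /(overlapP _ _ ac)[_ c''y]; apply/(overlapP _ _ ac').
by split; [exact: transition_cod|rewrite transition_inv].
Qed.

(** Chain rule; vectors being rows, the Jacobian of the first map is the left factor. The composite
    equals the direct transition only on an overlap, hence the passage through [eq_partial]. *)
Lemma jacobian_trans c c' c'' y : atlas c -> atlas c' -> atlas c'' ->
  overlap c c' y -> overlap c c'' y ->
  'J (transition c c'') y
  = 'J (transition c c') y *m 'J (transition c' c'') (transition c c' y).
Proof.
move=> ac ac' ac'' oy oy'.
have d1 := differentiable_transition ac ac' oy.
have d2 := differentiable_transition ac' ac'' (overlap_trans ac ac' oy oy').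
apply/matrixP => i k; rewrite jacobianE; last exact: differentiable_transition.
rewrite -(eq_partial (f := fun z => transition c' c'' (transition c c' z) 0 k) i
  (open_overlap ac ac') _ oy); last by move=> z oz; rewrite transition_trans.
have dk := differentiable_comp d2 (differentiable_coord (transition c' c'' (transition c c' y)) 0 k).
apply: etrans (partial_comp i d1 dk).2 _.
rewrite [RHS]mxE; apply: eq_bigr => l _.
apply: etrans (mulrC _ _) _.
exact (f_equal2 *%R (esym (@jacobianE _ _ _ _ i l d1)) (esym (@jacobianE _ _ _ _ l k d2))).
Qed.

Lemma jacobian_self c y : atlas c -> chart_cod c y -> 'J (transition c c) y = 1%:M.
Proof.
move=> ac cy; apply/matrixP => i k.
have oc : overlap c c `<=>` chart_cod c.
  split=> z; first by move=> /(overlapP _ _ ac)[].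
  by move=> cz; apply/(overlapP _ _ ac); split=> //; exact: chart_dom_inv.
rewrite jacobianE; last by apply: differentiable_transition => //; exact: oc.2.
rewrite (eq_partial (g := fun z => z 0 k) i (open_chart_cod ac) _ cy); last first.
  by move=> z cz; rewrite /transition/= chart_invK.
have /matrixP/(_ 0 k) := derive_mx (@derivable_id R 'rV[R]_n y (delta_mx 0 i)).
rewrite derive_id [RHS]mxE => E; apply: etrans (esym E) _.
by rewrite !mxE eqxx/= eq_sym.
Qed.

(** The round trip c -> c' -> c is the identity, so the Jacobian is a factor of the identity
    matrix. *)
Lemma jacobian_unit c c' y : atlas c -> atlas c' -> overlap c c' y ->
  'J (transition c c') y \in unitmx.
Proof.
move=> ac ac' oy; have [cy c'y] := (overlapP _ _ ac).1 oy.
have oself : overlap c c y by apply/(overlapP _ _ ac); split=> //; exact: chart_dom_inv.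
have E := etrans (esym (jacobian_trans ac ac' ac oy oself)) (jacobian_self ac cy).
exact (mulmx1_unit E).1.
Qed.

End charts.

Section metric_in_charts.
Context {R : realType} {n : nat} {M : riemannianManifold R n}.
Implicit Types (c : chart R n M) (x : M) (y : 'rV[R]_n).

Lemma metric_unit x : metric x \in unitmx.
Proof.
rewrite -row_free_unit -kermx_eq0; apply/negPn/negP => /rowV0Pn[v].
move=> /sub_kermxP vg v0; have := metric_pos x v0.
by rewrite vg mul0mx mxE ltxx.
Qed.

Local Notation G := (form_in_chart (@metric R n M)).

Lemma form_sym c y : (G c y)^T = G c y.
Proof. by rewrite /form_in_chart !trmx_mul trmxK Defs.metric_sym mulmxA. Qed.

Lemma form_unit c y : atlas c -> chart_cod c y -> G c y \in unitmx.
Proof.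
move=> ac cy; rewrite /form_in_chart.
have Ju : 'J (transition c (chart_at (chart_inv c y))) y \in unitmx.
  apply: (jacobian_unit ac (atlas_chart_at _)); apply/(overlapP _ _ ac).
  by split=> //; exact: mem_chart_at.
by rewrite !unitmx_mul unitmx_tr Ju metric_unit.
Qed.

(** Both sides read the metric at the same point through the same preferred chart; what remains is
    the chain rule for Jacobians. *)
Lemma form_change c c' y : atlas c -> atlas c' -> overlap c' c y ->
  G c' y = 'J (transition c' c) y *m G c (transition c' c y) *m ('J (transition c' c) y)^T.
Proof.
move=> ac ac' oy; have [c'y cy] := (overlapP _ _ ac').1 oy.
rewrite /form_in_chart (transition_inv ac' ac oy).
set x := chart_inv c' y.
have ox : overlap c' (chart_at x) y.
  by apply/(overlapP _ _ ac'); split=> //; exact: mem_chart_at.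
have E := jacobian_trans ac' ac (atlas_chart_at x) oy ox.
by rewrite [X in X *m _ *m X^T = _]E trmx_mul !mulmxA.
Qed.

Lemma form_in_chartE (g : M -> 'M[R]_n) c y : let x := chart_inv c y in
  form_in_chart g c y = 'J (transition c (chart_at x)) y *m g x
    *m ('J (transition c (chart_at x)) y)^T.
Proof. by []. Qed.

End metric_in_charts.

Local Opaque dmx form_in_chart.

Section covariance.
Context {R : realType} {n : nat} {M : riemannianManifold R n}.
Implicit Types (c : chart R n M) (x : M) (y : 'rV[R]_n) (f : M -> R).

Local Notation G := (form_in_chart (@metric R n M)).

(** [differential] and [hessian] are [chart_grad] and [chart_hess] in [chart_at x], which may change
    abruptly with x. The versions with a free chart c make it possible to argue about continuity in
    one fixed chart. *)
Definition chart_grad c f y : 'rV[R]_n := \row_i partial i (f \o chart_inv c) y.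

Definition chart_hess c f y : 'M[R]_n :=
  \matrix_(i, j) (partial i (partial j (f \o chart_inv c)) y
    - \sum_k christoffel c y k i j * partial k (f \o chart_inv c) y).

Lemma chart_inv_transition c c' f y : atlas c -> atlas c' -> overlap c' c y ->
  (f \o chart_inv c') y = ((f \o chart_inv c) \o transition c' c) y.
Proof. by move=> ac ac' oy; rewrite /comp transition_inv. Qed.

Lemma chart_grad_change c c' f y : atlas c -> atlas c' -> overlap c' c y ->
  Ck 1 (chart_cod c) (f \o chart_inv c) ->
  chart_grad c' f y = chart_grad c f (transition c' c y) *m ('J (transition c' c) y)^T.
Proof.
move=> ac ac' oy Cf; apply/rowP => i; rewrite [LHS]mxE [RHS]mxE.
have oV := open_overlap ac' ac.
rewrite (eq_partial i oV (fun z oz => chart_inv_transition f ac ac' oz) oy).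
rewrite (partial_comp_jacobian oV (open_chart_cod ac)
  (fun z => transition_cod ac' ac) (fun k => Ck_transition 2 k ac' ac) i Cf oy).
by apply: eq_bigr => k _; rewrite [X in _ = X * _]mxE [X in _ = _ * X]mxE.
Qed.

Lemma christoffelE c y k i j : christoffel c y k i j =
  2^-1 * \sum_l invmx (G c y) k l *
    (dmx i (G c) y j l + dmx j (G c) y i l - dmx l (G c) y i j).
Proof.
congr (_ * _); apply: eq_bigr => l _; congr (_ * _).
by congr (_ + _ - _); apply: esym; exact: dmxE.
Qed.

(** [partial2_comp] and [christoffel_change] produce the same H-term with opposite signs; what is
    left is the tensorial law. *)
Lemma chart_hess_change c c' f y : atlas c -> atlas c' -> overlap c' c y ->
  Ck 2 (chart_cod c) (f \o chart_inv c) ->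
  chart_hess c' f y =
  'J (transition c' c) y *m chart_hess c f (transition c' c y) *m ('J (transition c' c) y)^T.
Proof.
move=> ac ac' oy Cf; apply/matrixP => i j; rewrite [LHS]mxE.
have oV := open_overlap ac' ac; have oW := open_chart_cod ac.
have VW z := @transition_cod _ _ _ c' c z ac' ac.
have Ct k := Ck_transition 2 k ac' ac.
have Ef z := @chart_inv_transition c c' f z ac ac'.
rewrite (eq_partial i oV (fun z oz => eq_partial j oV Ef oz) oy).
rewrite (partial2_comp oV oW VW Ct i j Cf oy).
set J := 'J (transition c' c) y.
pose H i := map_hess (transition c' c) i y.
set a := chart_grad c f (transition c' c y).
have E k : partial k (f \o chart_inv c') y = (a *m J^T) 0 k.
  have /rowP/(_ k) := chart_grad_change ac ac' oy (CkW Cf).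
  by rewrite [X in X = _ -> _]mxE.
under [X in _ - X]eq_bigr do rewrite E.
pose D m := dmx m (G c) (transition c' c y).
pose D' m := dmx m (G c') y.
have D'E m : D' m = H m *m G c (transition c' c y) *m J^T
   + J *m (\sum_l J m l *: D l) *m J^T + J *m G c (transition c' c y) *m (H m)^T.
  rewrite -(dmx_pullback oV oW VW Ct m _ oy); last first.
    by move=> p q; have := metric_smooth ac p q; apply.
  apply/matrixP => p q; rewrite [LHS]mxE [RHS]mxE.
  by apply: (eq_partial m oV _ oy) => z oz; rewrite (form_change ac ac' oz).
have Hs p q k : H p q k = H q p k by exact: (map_hess_sym oV Ct).
have := christoffel_change a i j (form_sym c _) Hs (form_unit ac (VW _ oy))
  (jacobian_unit ac' ac oy) D'E.
rewrite -(form_change ac ac' oy) => C.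
have -> : \sum_k christoffel c' y k i j * (a *m J^T) 0 k =
  \sum_k 2^-1 * (\sum_l invmx (G c' y) k l * (D' i j l + D' j i l - D' l i j))
     * (a *m J^T) 0 k.
  apply: eq_bigr => k _; by rewrite christoffelE.
rewrite C opprD addrACA.
have -> : \sum_k partial k (f \o chart_inv c) (transition c' c y) * H i j k
    = \sum_k a 0 k * H i j k.
  by apply: eq_bigr => k _; rewrite [a 0 k]mxE.
rewrite subrr add0r -mulmxA [RHS]mxE -sumrB; apply: eq_bigr => p _.
rewrite [X in _ = _ * X]mxE mulr_sumr -sumrB; apply: eq_bigr => q _.
rewrite -mulrBr mulrA [J^T q j]mxE [RHS]mulrAC; congr (_ * _).
rewrite [X in _ = X]mxE; congr (_ - _); apply: eq_bigr => k _.
by rewrite christoffelE [a 0 k]mxE.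
Qed.

Lemma christoffel_sym c y k i j : christoffel c y k i j = christoffel c y k j i.
Proof.
rewrite /christoffel; congr (_ * _); apply: eq_bigr => l _; congr (_ * _).
apply: (f_equal2 (fun a b : R => a - b)); first exact: addrC.
congr partial; apply/funext => z.
have E : (G c z)^T i j = G c z i j by rewrite form_sym.
by apply: etrans (esym E) _; exact: mxE.
Qed.

Lemma chart_hess_sym c f y : atlas c -> chart_cod c y ->
  Ck 2 (chart_cod c) (f \o chart_inv c) -> (chart_hess c f y)^T = chart_hess c f y.
Proof.
move=> ac cy Cf; apply/matrixP => i j; rewrite [LHS]mxE [LHS]mxE [RHS]mxE.
apply: (f_equal2 (fun a b : R => a - b)).
  exact (@partialC _ _ _ _ y j i (open_chart_cod ac) Cf cy).
by apply: eq_bigr => k _; rewrite christoffel_sym.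
Qed.

(** The Jacobian factor is the one that [continuous_on_chi] applies to covectors, so F along a test
    function can be read in a single chart. *)
Lemma differentialE f c x : atlas c -> chart_dom c x ->
  Ck 1 (chart_cod c) (f \o chart_inv c) ->
  differential f x = chart_grad c f (chart_map c x)
    *m ('J (transition (chart_at x) c) (chart_map (chart_at x) x))^T.
Proof.
move=> ac cx Cf; have ax := atlas_chart_at x.
have ox : overlap (chart_at x) c (chart_map (chart_at x) x).
  by exists x => //; split=> //; exact: mem_chart_at.
apply: etrans (chart_grad_change ac ax ox Cf) _.
by rewrite {1}/transition/= chart_mapK//; exact: mem_chart_at.
Qed.

Lemma hessianE f c x : atlas c -> chart_dom c x ->
  Ck 2 (chart_cod c) (f \o chart_inv c) ->
  let J := 'J (transition (chart_at x) c) (chart_map (chart_at x) x) in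
  hessian f x = J *m chart_hess c f (chart_map c x) *m J^T.
Proof.
move=> ac cx Cf J; have ax := atlas_chart_at x.
have ox : overlap (chart_at x) c (chart_map (chart_at x) x).
  by exists x => //; split=> //; exact: mem_chart_at.
apply: etrans (chart_hess_change ac ax ox Cf) _.
by rewrite {2}/transition/= chart_mapK//; exact: mem_chart_at.
Qed.

End covariance.

(** * Test functions *)

Section limits.
Context {R : realType} {T : Type} (F : set_system T) {FF : Filter F}.

Lemma cvg_prod_seq {I : Type} (r : seq I) (f : I -> T -> R) (a : I -> R) :
  (forall i, f i x @[x --> F] --> a i) ->
  \prod_(i <- r) f i x @[x --> F] --> \prod_(i <- r) a i.
Proof.
move=> fa; elim: r => [|i r IH].
  by under eq_cvg do rewrite big_nil; rewrite big_nil; exact: cvg_cst.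
by under eq_cvg do rewrite big_cons; rewrite big_cons; exact: cvgM.
Qed.

Lemma cvg_det n (f : T -> 'M[R]_n) (A : 'M[R]_n) :
  (forall i j, f x i j @[x --> F] --> A i j) -> \det (f x) @[x --> F] --> \det A.
Proof.
move=> fA; apply: cvg_sum_seq => s; apply: cvgM; first exact: cvg_cst.
by apply: cvg_prod_seq => i; exact: fA.
Qed.

(** Cramer's rule, valid at invertible matrices; [invmx] takes a default value elsewhere, hence the
    invertibility along the filter. *)
Lemma cvg_invmx n (f : T -> 'M[R]_n) (A : 'M[R]_n) :
  A \in unitmx -> (\forall x \near F, f x \in unitmx) ->
  (forall i j, f x i j @[x --> F] --> A i j) ->
  forall i j, invmx (f x) i j @[x --> F] --> invmx A i j.
Proof.
move=> Au fu fA i j.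
have E B : B \in unitmx -> invmx B i j = (\det B)^-1 * cofactor B j i.
  by move=> Bu; rewrite /invmx Bu !mxE.
rewrite E//; apply: (@cvg_trans _ (((\det (f x))^-1 * cofactor (f x) j i) @[x --> F])).
  by apply: near_eq_cvg; apply: filterS fu => x fxu; rewrite E.
apply: cvgM.
  apply: cvgV; last exact: cvg_det.
  by rewrite -unitfE -unitmxE.
apply: cvgM; first exact: cvg_cst.
by apply: cvg_det => p q; under eq_cvg do rewrite !mxE; rewrite !mxE; exact: fA.
Qed.

End limits.

Lemma within_continuous_at {S U : topologicalType} (D : set S) (f : S -> U) z :
  {within D, continuous f} -> nbhs z D -> {for z, continuous f}.
Proof.
move=> /subspace_continuousP cf Dz.
have /cf : D z by exact: nbhs_singleton.
by rewrite within_interior.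
Qed.

Lemma nbhs_setX {S U : topologicalType} (a : S) (b : U) A B :
  nbhs a A -> nbhs b B -> nbhs (a, b) (A `*` B).
Proof. by move=> aA bB; exists (A, B). Qed.

Lemma slice_continuous {S U V : topologicalType} (A : set S) (B : set U) (f : S * U -> V) t y :
  open B -> {within A `*` B, continuous f} -> A t -> B y ->
  {for y, continuous (fun z => f (t, z))}.
Proof.
move=> oB /subspace_continuousP cf At By.
move=> X /(cf (t, y) (conj At By)) [[P Q] /= [tP yQ] PQX].
have nB : nbhs y B by exact: open_nbhs_nbhs.
rewrite /= nbhs_simpl /=; apply: filterS2 yQ nB => z Qz Bz.
apply: (PQX (t, z)); split => //=; exact: nbhs_singleton.
Qed.

(** * The operator along a test function and its continuity *)

Section C12_theory.
Context {R : realType} {n : nat} {M : riemannianManifold R n}.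
Implicit Types (c : chart R n M) (phi : R * M -> R) (t : R) (x : M) (y : 'rV[R]_n).
Variable T : R.

Lemma C12_chart_Ck phi c t : C12 T phi -> atlas c -> `[0, T]%classic t ->
  Ck 2 (chart_cod c) ((fun x => phi (t, x)) \o chart_inv c).
Proof.
move=> [cphi _ _ cC] ac tT; have oc := open_chart_cod ac.
have wc (f : R * 'rV[R]_n -> R) : {within `[0, T]%classic `*` chart_cod c, continuous f} ->
    {within chart_cod c, continuous (fun y => f (t, y))}.
  move=> cf; rewrite continuous_open_subspace// => y; rewrite inE => cy.
  exact: slice_continuous cf tT cy.
have c0 : {within chart_cod c, continuous ((fun x => phi (t, x)) \o chart_inv c)}.
  rewrite continuous_open_subspace// => y; rewrite inE => cy.
  apply: continuous_comp; first exact: continuous_chart_inv.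
  exact: slice_continuous openT cphi tT _.
split=> // i; have [hp cp _] := cC c ac i.
split; first by move=> y cy; exact: (hp (t, y)).
split; first exact: wc cp.
move=> j; have [_ _ /(_ j)[hp2 cp2]] := cC c ac i.
split; first by move=> y cy; exact: (hp2 (t, y)).
by split=> //; exact: wc cp2.
Qed.

(** The left side of the equation along phi, with r in the place of u: the value of the competitor
    at a point may differ from that of phi. *)
Definition oper (F : nonlinearity M) phi (z : R * M) (r : R) : R :=
  time_derivative T phi z
  + F z.1 z.2 r (differential (fun x => phi (z.1, x)) z.2)
                (hessian (fun x => phi (z.1, x)) z.2).

Lemma continuous_christoffel c k i j y : atlas c -> chart_cod c y ->
  {for y, continuous (fun y => @christoffel R n M c y k i j)}.
Proof.
move=> ac cy; have oc := open_chart_cod ac.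
have sm p q := metric_smooth ac p q.
have cG p q : form_in_chart (@metric R n M) c z p q @[z --> y]
    --> form_in_chart (@metric R n M) c y p q.
  exact: (Ck_continuous oc (sm p q 0) cy).
have cdG m p q : partial m (fun z => form_in_chart (@metric R n M) c z p q) z @[z --> y]
    --> partial m (fun z => form_in_chart (@metric R n M) c z p q) y.
  exact: (Ck_continuous oc (Ck_partial m (sm p q 1%N)) cy).
apply: (cvgM (F := nbhs y)); first exact: cvg_cst.
apply: (cvg_sum_seq (F := nbhs y)) => l; apply: (cvgM (F := nbhs y)).
  apply: (cvg_invmx (F := nbhs y)) => //; first exact: form_unit.
  have : \forall z \near y, chart_cod c z by exact: open_nbhs_nbhs.
  by apply: filterS => z cz; exact: form_unit.
apply: (cvgB (F := nbhs y)); last exact: cdG.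
by apply: (cvgD (F := nbhs y)); exact: cdG.
Qed.

Lemma continuous_oper F phi (z : R * M) r : continuous_on_chi T F -> C12 T phi ->
  0 < z.1 < T -> {for (z, r), continuous (fun q : R * M * R => oper F phi q.1 q.2)}.
Proof.
case: z => t0 x0 /= cF Cphi t0T; pose c := chart_at x0.
have ac : atlas c by exact: atlas_chart_at.
have cx0 : chart_dom c x0 by exact: mem_chart_at.
have cy0 := chart_cod_map cx0.
have [cphi _ ct cC] := Cphi.
set q0 : R * M * R := (t0, x0, r).
have nD : nbhs (t0, x0) (`[0, T]%classic `*` [set: M]).
  by apply: nbhs_setX; [exact: nbhs_itvcc|exact: filterT].
have q1 : (q : R * M * R).1 @[q --> q0] --> (t0, x0) by exact: cvg_fst.
have q11 : (q : R * M * R).1.1 @[q --> q0] --> t0 by apply: (cvg_comp _ _ q1); exact: cvg_fst.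
have q12 : (q : R * M * R).1.2 @[q --> q0] --> x0 by apply: (cvg_comp _ _ q1); exact: cvg_snd.
have ky : chart_map c (q : R * M * R).1.2 @[q --> q0] --> chart_map c x0.
  by apply: (cvg_comp _ _ q12); exact: continuous_chart_map.
have ty : ((q : R * M * R).1.1, chart_map c q.1.2) @[q --> q0] --> (t0, chart_map c x0).
  exact: (cvg_pair q11 ky).
apply: (cvgD (F := nbhs q0)).
  apply: (cvg_comp _ _ q1).
  exact: (within_continuous_at ct nD).
have nDc : nbhs (t0, chart_map c x0) (`[0, T]%classic `*` chart_cod c).
  apply: nbhs_setX; first exact: nbhs_itvcc.
  by apply: open_nbhs_nbhs; split=> //; exact: open_chart_cod.
pose phic t := (fun x => phi (t, x)).
(* [m] gives the coordinates of the jet in the fixed chart c, and [Fc] is the function whose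
   continuity is the hypothesis on F; near the base point, F along phi is Fc o m. *)
pose m (q : R * M * R) : R * 'rV[R]_n * R * 'rV[R]_n * 'M[R]_n :=
  (q.1.1, chart_map c q.1.2, q.2, chart_grad c (phic q.1.1) (chart_map c q.1.2),
   chart_hess c (phic q.1.1) (chart_map c q.1.2)).
set Fc := fun z : R * 'rV[R]_n * R * 'rV[R]_n * 'M[R]_n =>
       let: (t, y, r, a, B) := z in
       let x := chart_inv c y in
       let J := 'J (transition (chart_at x) c) (chart_map (chart_at x) x) in
       F t x r (a *m J^T) (J *m B *m J^T).
have near_dom : \forall q \near q0, `[0, T]%classic q.1.1 /\ chart_dom c q.1.2.
  have N1 : \forall q \near q0, `[0, T]%classic (q : R * M * R).1.1.
    by apply: q11; exact: nbhs_itvcc.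
  have N2 : \forall q \near q0, chart_dom c (q : R * M * R).1.2.
    by apply: q12; apply: open_nbhs_nbhs; split=> //; exact: open_chart_dom.
  exact: filterI N1 N2.
have FE q : `[0, T]%classic q.1.1 -> chart_dom c q.1.2 ->
    F q.1.1 q.1.2 q.2 (differential (phic q.1.1) q.1.2) (hessian (phic q.1.1) q.1.2)
    = Fc (m q).
  move=> tT cx; have C2 := C12_chart_Ck Cphi ac tT.
  by rewrite /Fc/= chart_mapK// (differentialE ac cx (CkW C2)) (hessianE ac cx C2).
have q0T : `[0, T]%classic q0.1.1 by apply: nbhs_singleton; exact: nbhs_itvcc.
rewrite /continuous_at [X in _ --> X](FE q0 q0T cx0).
apply: (@cvg_trans _ (Fc (m q) @[q --> q0])).
  by apply: near_eq_cvg; apply: filterS near_dom => q [tT cx]; rewrite -FE.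
have cd1 i : partial i (phic q.1.1 \o chart_inv c) (chart_map c q.1.2) @[q --> q0] -->
    partial i (phic t0 \o chart_inv c) (chart_map c x0).
  have [_ ci _] := cC c ac i.
  exact: (cvg_comp _ _ ty (within_continuous_at ci nDc)).
have cd2 i j : partial j (partial i (phic q.1.1 \o chart_inv c)) (chart_map c q.1.2)
    @[q --> q0] --> partial j (partial i (phic t0 \o chart_inv c)) (chart_map c x0).
  have [_ _ /(_ j)[_ cij]] := cC c ac i.
  exact: (cvg_comp _ _ ty (within_continuous_at cij nDc)).
have cr : (q : R * M * R).2 @[q --> q0] --> r by exact: cvg_snd.
have cg : chart_grad c (phic (q : R * M * R).1.1) (chart_map c q.1.2) @[q --> q0]
    --> chart_grad c (phic t0) (chart_map c x0).
  apply: (cvg_mxP (F := nbhs q0)) => i j; rewrite ord1 [X in _ --> X]mxE.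
  by under eq_cvg do rewrite mxE; exact: cd1.
have ch : chart_hess c (phic (q : R * M * R).1.1) (chart_map c q.1.2) @[q --> q0]
    --> chart_hess c (phic t0) (chart_map c x0).
  apply: (cvg_mxP (F := nbhs q0)) => i j; rewrite [X in _ --> X]mxE.
  under eq_cvg do rewrite mxE; apply: (cvgB (F := nbhs q0)); first exact: cd2.
  apply: (cvg_sum_seq (F := nbhs q0)) => k; apply: (cvgM (F := nbhs q0)); last exact: cd1.
  exact: (cvg_comp _ _ ky (@continuous_christoffel c k i j _ ac cy0)).
have mc : m q @[q --> q0] --> m q0.
  exact: (cvg_pair (cvg_pair (cvg_pair ty cr) cg) ch).
(* F is continuous within the symmetric matrices, so symmetry of the Hessian is what keeps m inside
   the relevant set. *)
have mS : \forall q \near q0, let: (t, y, r, a, B) := m q in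
    [/\ `[0, T]%classic t, chart_cod c y & B^T = B].
  apply: filterS near_dom => q [tT cx]; split=> //; first exact: chart_cod_map.
  by apply: chart_hess_sym => //; [exact: chart_cod_map|exact: C12_chart_Ck].
have /subspace_continuousP/(_ (m q0) (nbhs_singleton mS)) cFc := cF c ac.
move=> X /cFc SX; have := mc _ SX.
by apply: filterS2 mS => q Sq; apply.
Qed.

End C12_theory.

Section positive_power_Ck.
Context {R : realType} {n : nat}.
Implicit Types (V : set 'rV[R]_n) (u : 'rV[R]_n -> R).

Lemma partial_pos_pow m u y i : differentiable u y ->
  has_partial i (pos_pow m.+2 \o u) y /\
  partial i (pos_pow m.+2 \o u) y = m.+2%:R * pos_pow m.+1 (u y) * partial i u y.
Proof.
move=> du; have [dp dpE] := is_derive_pos_pow m (u y).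
have dP : differentiable (pos_pow m.+2) (u y) by exact/derivable1_diffP.
have dPu := differentiable_comp du dP.
split; first exact: diff_derivable.
apply: etrans (deriveE _ dPu) _.
rewrite diff_comp//= deriv1E// derive1E dpE -[_ *: _]/(_ * _) mulrC; congr (_ * _).
by apply: esym; exact: deriveE.
Qed.

Lemma Ck_pos_pow k m V u : open V -> Ck k V u -> (k < m)%N -> Ck k V (pos_pow m \o u).
Proof.
move=> oV; elim: k m => [|k IH] m Cu km.
  apply: Ck0 => // y Vy; apply: continuous_comp; first exact: Ck_continuous oV Cu Vy.
  exact: continuous_pos_pow.
case: m km => [//|[//|m]] km.
have du y : V y -> differentiable u y by move=> Vy; exact: Ck_differentiable oV Cu Vy.
split.
  apply: (Ck_within (k := 0)); apply: Ck0 => // y Vy.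
  by apply: continuous_comp; [exact: Ck_continuous oV Cu Vy|exact: continuous_pos_pow].
move=> i; split; first by move=> y Vy; exact: (partial_pos_pow m i (du y Vy)).1.
apply: (eq_Ck (f := (cst m.+2%:R \* (pos_pow m.+1 \o u)) \* partial i u) oV).
  by move=> y Vy; rewrite (partial_pos_pow m i (du y Vy)).2.
apply: CkM => //; last exact: Ck_partial.
by apply: CkM => //; [exact: Ck_cst|apply: IH => //; exact: CkW].
Qed.

End positive_power_Ck.

Lemma within_continuous_eq {S U : topologicalType} (D : set S) (f g : S -> U) :
  (forall z, D z -> f z = g z) -> {within D, continuous f} -> {within D, continuous g}.
Proof.
move=> fg; apply: subspace_eq_continuous => z; rewrite inE; exact: fg.
Qed.

Lemma within_continuous_lin {R : realType} {S : topologicalType} (D : set S) (f g : S -> R) (k : R) :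
  {within D, continuous f} -> {within D, continuous g} ->
  {within D, continuous (fun z => f z + k * g z)}.
Proof.
move=> /subspace_continuousP cf /subspace_continuousP cg.
apply/subspace_continuousP => z Dz.
have cfz := cf z Dz; have cgz := cg z Dz.
apply: (cvgD (F := within D (nbhs z))) => //.
by apply: (cvgM (F := within D (nbhs z))) => //; exact: cvg_cst.
Qed.

Lemma partial_lin {R : realType} {n} (f g : 'rV[R]_n -> R) (k : R) i y :
  has_partial i f y -> has_partial i g y ->
  has_partial i (fun z => f z + k * g z) y /\
  partial i (fun z => f z + k * g z) y = partial i f y + k * partial i g y.
Proof.
move=> fi gi; have ki : has_partial i (fun z => k *: g z) y by exact: derivableZ.
split; first exact: (derivableD fi ki).
apply: etrans (partialD fi ki) _; congr (_ + _).
exact: deriveZ.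
Qed.

Section C12_closure.
Context {R : realType} {n : nat} {M : riemannianManifold R n}.
Implicit Types (c : chart R n M) (f g : R * M -> R) (k t : R) (x : M).
Variable T : R.
Hypothesis T0 : 0 < T.

Lemma partial_lin_on (V : set 'rV[R]_n) (f g : 'rV[R]_n -> R) k i j y : open V -> V y ->
  (forall z, V z -> has_partial j f z) -> (forall z, V z -> has_partial j g z) ->
  has_partial i (partial j f) y -> has_partial i (partial j g) y ->
  has_partial i (partial j (fun z => f z + k * g z)) y /\
  partial i (partial j (fun z => f z + k * g z)) y
    = partial i (partial j f) y + k * partial i (partial j g) y.
Proof.
move=> oV Vy hf hg hf2 hg2.
have E z : V z -> partial j f z + k * partial j g z = partial j (fun z => f z + k * g z) z.
  by move=> Vz; rewrite (partial_lin k (hf z Vz) (hg z Vz)).2.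
have [p1 p2] := partial_lin k hf2 hg2; split.
  exact: (eq_has_partial oV E Vy p1).
by rewrite -(eq_partial i oV E Vy).
Qed.

(** The form f + k g covers at once the differences of test functions and the perturbations phi +
    theta and phi - theta. *)
Lemma C12_lin f g k : C12 T f -> C12 T g -> C12 T (fun z => f z + k * g z).
Proof.
move=> [cf df tf Cf] [cg dg tg Cg].
have lin z (Dz : (`[0, T]%classic `*` [set: M]) z) :=
  derive_within_lin k T0 Dz.1 (df z Dz) (dg z Dz).
split.
- exact: within_continuous_lin.
- by move=> z /lin[].
- apply: within_continuous_eq _ (within_continuous_lin (k := k) tf tg) => z Dz.
  by apply: esym; exact: (lin z Dz).2.
move=> c ac; have oc := open_chart_cod ac => Dc phic i.
have [hf pf sf] := Cf c ac i; have [hg pg sg] := Cg c ac i.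
have lin1 z (Dz : Dc z) := partial_lin k (hf z Dz) (hg z Dz).
split.
- by move=> z Dz; exact: (lin1 z Dz).1.
- apply: within_continuous_eq _ (within_continuous_lin (k := k) pf pg) => z Dz.
  by apply: esym; exact: (lin1 z Dz).2.
move=> j; have [hf2 pf2] := sf j; have [hg2 pg2] := sg j.
have lin2 z (Dz : Dc z) := partial_lin_on k oc Dz.2
  (fun y cy => hf (z.1, y) (conj Dz.1 cy)) (fun y cy => hg (z.1, y) (conj Dz.1 cy))
  (hf2 z Dz) (hg2 z Dz).
split; first by move=> z Dz; exact: (lin2 z Dz).1.
apply: within_continuous_eq _ (within_continuous_lin (k := k) pf2 pg2) => z Dz.
by apply: esym; exact: (lin2 z Dz).2.
Qed.

Lemma time_derivative_lin f g k z : C12 T f -> C12 T g -> `[0, T]%classic z.1 ->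
  time_derivative T (fun z => f z + k * g z) z =
  time_derivative T f z + k * time_derivative T g z.
Proof.
move=> [_ df _ _] [_ dg _ _] zT; have Dz : (`[0, T]%classic `*` [set: M]) z by split.
exact: (derive_within_lin k T0 zT (df z Dz) (dg z Dz)).2.
Qed.

Lemma differential_lin f g k t x : C12 T f -> C12 T g -> `[0, T]%classic t ->
  differential (fun x => f (t, x) + k * g (t, x)) x =
  differential (fun x => f (t, x)) x + k *: differential (fun x => g (t, x)) x.
Proof.
move=> Cf Cg tT; have ac := atlas_chart_at x.
have cy := chart_cod_map (mem_chart_at x).
have Kf := C12_chart_Ck Cf ac tT; have Kg := C12_chart_Ck Cg ac tT.
apply/rowP => i; rewrite [LHS]mxE [RHS]mxE [X in _ = X + _]mxE [X in _ = _ + X]mxE.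
rewrite [X in _ = _ + _ * X]mxE.
exact: (partial_lin k (Ck_has_partial Kf cy) (Ck_has_partial Kg cy)).2.
Qed.

Lemma hessian_lin f g k t x : C12 T f -> C12 T g -> `[0, T]%classic t ->
  hessian (fun x => f (t, x) + k * g (t, x)) x =
  hessian (fun x => f (t, x)) x + k *: hessian (fun x => g (t, x)) x.
Proof.
move=> Cf Cg tT; have ac := atlas_chart_at x.
have cy := chart_cod_map (mem_chart_at x).
have Kf := C12_chart_Ck Cf ac tT; have Kg := C12_chart_Ck Cg ac tT.
apply/matrixP => i j; rewrite [LHS]mxE [RHS]mxE [X in _ = X + _]mxE [X in _ = _ + X]mxE.
rewrite [X in _ = _ + _ * X]mxE.
have E1 l := (partial_lin (i := l) k (Ck_has_partial Kf cy) (Ck_has_partial Kg cy)).2.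
have E2 := (partial_lin_on k (open_chart_cod ac) cy
  (fun z cz => Ck_has_partial (i := j) Kf cz) (fun z cz => Ck_has_partial (i := j) Kg cz)
  (Ck_has_partial (i := i) (Ck_partial j Kf) cy)
  (Ck_has_partial (i := i) (Ck_partial j Kg) cy)).2.
apply: etrans (f_equal2 (fun a b : R => a - b) E2 _) _; last first.
  rewrite mulrBr addrACA -opprD; reflexivity.
rewrite mulr_sumr -big_split/=; apply: eq_bigr => l _.
apply: etrans (f_equal2 *%R erefl (E1 l)) _.
by rewrite mulrDr mulrCA.
Qed.

Lemma C12_space (B : M -> R) :
  (forall c, atlas c -> Ck 2 (chart_cod c) (B \o chart_inv c)) ->
  C12 T (fun z : R * M => B z.2) /\
  forall z, `[0, T]%classic z.1 -> time_derivative T (fun z : R * M => B z.2) z = 0.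
Proof.
move=> CB.
have cB : continuous B.
  move=> x; have ac := atlas_chart_at x; have cx := mem_chart_at x.
  have cy := chart_cod_map cx.
  have H := continuous_comp (continuous_chart_map ac cx)
    (Ck_continuous (open_chart_cod ac) (CB _ ac) cy).
  have K : (B \o chart_inv (chart_at x)) (chart_map (chart_at x) x) = B x.
    by rewrite /comp chart_mapK.
  rewrite /continuous_at -[X in _ --> X]K; apply: cvg_trans H; apply: near_eq_cvg.
  have : \forall z \near x, chart_dom (chart_at x) z.
    by apply: open_nbhs_nbhs; split=> //; exact: open_chart_dom.
  by apply: filterS => z cz; rewrite /comp chart_mapK.
have tB z : `[0, T]%classic z.1 ->
    derivable_within `[0, T]%classic (fun s => B (s, (z : R * M).2).2) z.1 /\
    time_derivative T (fun z : R * M => B z.2) z = 0.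
  by move=> zT; apply: derive_withinP => //; exact: (@is_derive_cst R R R (B z.2) z.1 1).
split; last by move=> z /tB[].
have wc (V : set 'rV[R]_n) (u : 'rV[R]_n -> R) : open V -> {within V, continuous u} ->
    {within `[0, T]%classic `*` V, continuous (fun z : R * 'rV[R]_n => u z.2)}.
  move=> oV; rewrite continuous_open_subspace// => cu.
  apply: continuous_in_subspaceT => z; rewrite inE => -[_ Vz].
  apply: (continuous_comp (cvg_snd)); apply: cu; rewrite inE; exact: Vz.
split.
- apply: continuous_subspaceT => z; apply: (continuous_comp (cvg_snd)); exact: cB.
- by move=> z [zT _]; have [] := tB z zT.
- apply: (within_continuous_eq (f := cst 0)).
    by move=> z [zT _]; rewrite (tB z zT).2.
  by apply: continuous_subspaceT; exact: cst_continuous.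
move=> c ac Dc phic i; have oc := open_chart_cod ac; have Cc := CB c ac.
split.
- by move=> z [_ cz]; exact: Ck_has_partial Cc cz.
- exact: (wc _ _ oc (Ck_within (Ck_partial i Cc))).
move=> j; split; first by move=> z [_ cz]; exact: Ck_has_partial (Ck_partial i Cc) cz.
exact: (wc _ _ oc (Ck_within (Ck_partial j (Ck_partial i Cc)))).
Qed.

Lemma has_partial_cst (a : R) i (y : 'rV[R]_n) : has_partial i (fun=> a) y.
Proof. exact: derivable_cst. Qed.

Lemma partial_cst (a : R) i (y : 'rV[R]_n) : partial i (fun=> a) y = 0.
Proof. exact: derive_cst. Qed.

Lemma C12_time (p p' : R -> R) : (forall t, is_derive t (1 : R) p (p' t)) -> continuous p' ->
  C12 T (fun z : R * M => p z.1) /\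
  forall z : R * M, `[0, T]%classic z.1 -> time_derivative T (fun z : R * M => p z.1) z = p' z.1.
Proof.
move=> dp cp'.
have cp : continuous p.
  by move=> t; apply: differentiable_continuous; apply/derivable1_diffP; have [] := dp t.
have tB (z : R * M) : `[0, T]%classic z.1 ->
    derivable_within `[0, T]%classic (fun s => p (s, z.2).1) z.1 /\
    time_derivative T (fun z : R * M => p z.1) z = p' z.1.
  by move=> zT; apply: derive_withinP => //; exact: dp.
split; last by move=> z /tB[].
split.
- apply: continuous_subspaceT => z; apply: (continuous_comp (cvg_fst)); exact: cp.
- by move=> z [zT _]; have [] := tB z zT.
- apply: (within_continuous_eq (f := fun z : R * M => p' z.1)).
    by move=> z [zT _]; rewrite (tB z zT).2.
  by apply: continuous_subspaceT => z; apply: (continuous_comp (cvg_fst)); exact: cp'.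
have E0 s i : partial i (fun _ : 'rV[R]_n => p s) = fun=> 0.
  by apply/funext => y; exact: partial_cst.
move=> c ac Dc phic i; split.
- move=> z _; exact (@has_partial_cst (p z.1) i z.2).
- apply: (within_continuous_eq (f := cst 0)).
    by move=> z _; apply: esym; exact (@partial_cst (p z.1) i z.2).
  by apply: continuous_subspaceT; exact: cst_continuous.
move=> j; split.
  move=> z _; rewrite -[phic z.1]/(fun=> p z.1) E0; exact (@has_partial_cst 0 j z.2).
apply: (within_continuous_eq (f := cst 0)).
  move=> z _; rewrite -[phic z.1]/(fun=> p z.1) E0; apply: esym.
  exact (@partial_cst 0 j z.2).
by apply: continuous_subspaceT; exact: cst_continuous.
Qed.

Lemma C12_cst (a : R) : C12 T (fun _ : R * M => a).
Proof. by have [] := @C12_space (cst a) (fun c _ => Ck_cst _ _ a). Qed.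

Lemma differential_cst (a : R) (x : M) : differential (fun=> a) x = 0.
Proof. by apply/rowP => i; rewrite [LHS]mxE [RHS]mxE; exact: partial_cst. Qed.

Lemma hessian_cst (a : R) (x : M) : hessian (fun=> a) x = 0.
Proof.
have E i : partial i (fun _ : 'rV[R]_n => a) = fun=> 0.
  by apply/funext => y; exact: partial_cst.
apply/matrixP => i j; rewrite [LHS]mxE [RHS]mxE.
rewrite (_ : (fun=> a) \o _ = fun=> a)// E.
rewrite partial_cst big1 ?subr0// => k _.
by rewrite partial_cst mulr0.
Qed.

End C12_closure.

(** * A bump function with a flat strict maximum *)

Section flat_bump.
Context {R : realType} {n : nat}.
Variables (rho : R) (y0 : 'rV[R]_n).
Hypothesis rho0 : 0 < rho.
Implicit Types y : 'rV[R]_n.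

Lemma Ck_coord k i : Ck k setT (fun y => y 0 i : R).
Proof.
have C0 : Ck 0 setT (fun y => y 0 i : R).
  by apply: Ck0; [exact: openT|move=> y _; exact: coord_continuous].
case: k => [//|k]; split; first exact: Ck_within C0.
move=> j; split; first by move=> y _; apply: diff_derivable; exact: differentiable_coord.
apply: (eq_Ck (f := cst ((j == i)%:R))); [exact: openT| |exact: Ck_cst].
move=> y _.
have /matrixP/(_ 0 i) := derive_mx (@derivable_id R 'rV[R]_n y (delta_mx 0 j)).
rewrite derive_id [RHS]mxE => E; apply: etrans E.
by rewrite !mxE eqxx/= eq_sym.
Qed.

Let l i y : R := y 0 i - y0 0 i.

Definition sqdist y : R := \sum_i l i y * l i y.

Let Ck_l k i : Ck k setT (l i).
Proof. exact: (CkD openT (Ck_coord k i) (Ck_cst k setT (- y0 0 i))). Qed.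

Lemma Ck_sqdist k : Ck k setT sqdist.
Proof.
apply: Ck_sum => [|i]; first exact: openT.
exact: (CkM openT (Ck_l k i) (Ck_l k i)).
Qed.

Lemma sqdist_center : sqdist y0 = 0.
Proof. by rewrite /sqdist big1// => i _; rewrite /l subrr mul0r. Qed.

Lemma partial_sqdist_center j : partial j sqdist y0 = 0.
Proof.
have hl i : has_partial j (l i) y0 by exact: Ck_has_partial (Ck_l 1 i) _.
rewrite (partial_sum (fun i => (partial_mul (hl i) (hl i)).1)).2 big1// => i _.
apply: etrans (partial_mul (hl i) (hl i)).2 _.
have -> : l i y0 = 0 by exact: subrr.
by rewrite mulr0 mul0r addr0.
Qed.

Lemma sqdist_ge0 y : 0 <= sqdist y.
Proof. by apply: sumr_ge0 => i _; rewrite -expr2 sqr_ge0. Qed.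

Lemma sqdist_coord y i : (y 0 i - y0 0 i) ^+ 2 <= sqdist y.
Proof.
rewrite /sqdist (bigD1 i)//= -expr2 lerDl.
by apply: sumr_ge0 => j _; rewrite -expr2 sqr_ge0.
Qed.

(* The inner square makes 1 - flat_bump vanish to order 4 at y0. *)
Definition flat_bump y : R := pos_pow 3 (1 - (rho ^- 2 * sqdist y) ^+ 2).

Let u y : R := 1 - (rho ^- 2 * sqdist y) ^+ 2.

Let Ck_u k : Ck k setT u.
Proof.
apply: (eq_Ck (f := cst 1 \+ (cst (- (rho ^- 2) ^+ 2) \* (sqdist \* sqdist)))).
- exact: openT.
- by move=> y _; rewrite /u /= exprMn mulNr; congr (_ - _ * _); rewrite expr2.
apply: CkD; [exact: openT|exact: Ck_cst|apply: CkM; [exact: openT|exact: Ck_cst|]].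
by apply: CkM; [exact: openT|exact: Ck_sqdist|exact: Ck_sqdist].
Qed.

Lemma Ck_flat_bump : Ck 2 setT flat_bump.
Proof. by apply: (Ck_pos_pow openT (Ck_u 2)). Qed.

Lemma flat_bump_center : flat_bump y0 = 1.
Proof.
by rewrite /flat_bump sqdist_center mulr0 expr0n subr0 /pos_pow max_r// expr1n.
Qed.

Lemma flat_bump_ge0 y : 0 <= flat_bump y.
Proof. by rewrite /flat_bump /pos_pow exprn_ge0// le_max lexx. Qed.

Let max_le1 y : Num.max 0 (u y) <= 1.
Proof. by rewrite ge_max ler01 /u gerBl sqr_ge0. Qed.

Lemma flat_bump_le1 y : flat_bump y <= 1.
Proof.
by rewrite /flat_bump /pos_pow exprn_ile1//; [rewrite le_max lexx|exact: max_le1].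
Qed.

Lemma flat_bump_eq1 y : flat_bump y = 1 -> y = y0.
Proof.
move=> /eqP; rewrite /flat_bump /pos_pow -/(u y) pexpr_eq1//; last by rewrite le_max lexx.
move=> /eqP m1.
have q0 : sqdist y = 0.
  have [u0|u0] := leP (u y) 0.
    by move: m1; rewrite max_l// => /eqP; rewrite eq_sym oner_eq0.
  move: m1; rewrite max_r; last exact: ltW.
  rewrite /u => /eqP; rewrite subr_eq addrC -subr_eq subrr eq_sym sqrf_eq0 mulf_eq0.
  by rewrite invr_eq0 expf_eq0/= gt_eqF//= => /eqP.
apply/rowP => i; apply/eqP; rewrite -subr_eq0 -sqrf_eq0; apply/eqP/le_anti.
by rewrite sqr_ge0 -[X in _ <= X]q0 sqdist_coord.
Qed.

Lemma flat_bump_support y i : flat_bump y != 0 -> `|y 0 i - y0 0 i| <= rho.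
Proof.
rewrite /flat_bump /pos_pow -/(u y) expf_eq0/=.
have [u0|u0] := leP (u y) 0; first by rewrite eqxx.
move=> _; move: u0; rewrite /u subr_gt0 expr_lt1//; last first.
  by rewrite mulr_ge0 ?sqdist_ge0// invr_ge0 sqr_ge0.
rewrite mulrC ltr_pdivrMr ?exprn_gt0// mul1r => q1.
have d1 := le_lt_trans (sqdist_coord y i) q1.
have r0 := rho0; move: d1; set d := y 0 i - y0 0 i => d1.
by rewrite ler_norml; apply/andP; split; nra.
Qed.

Lemma flat_bump_jet : (forall i, partial i flat_bump y0 = 0) /\
  (forall i j, partial j (partial i flat_bump) y0 = 0).
Proof.
(* The gradient of the bump factors as [w i * sqdist], and [sqdist] vanishes at y0 together with its
   gradient; so the first and second derivatives vanish there. *)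
pose w i y := 3%:R * pos_pow 2 (u y) * (- 2 * (rho ^- 2) ^+ 2 * partial i sqdist y).
have du y : differentiable u y by exact: Ck_differentiable openT (Ck_u 1) _.
have hq i y : has_partial i sqdist y by exact: Ck_has_partial (Ck_sqdist 1) _.
have E i y : partial i flat_bump y = w i y * sqdist y.
  have -> : flat_bump = pos_pow 3 \o u by [].
  rewrite (partial_pos_pow 1 i (du y)).2 /w -[RHS]mulrA; congr (_ * _).
  have Eu : u = fun z => 1 + (- (rho ^- 2) ^+ 2) * (sqdist z * sqdist z).
    by apply/funext => z; rewrite /u exprMn mulNr; congr (_ - _ * _); rewrite expr2.
  have [p1 p2] := partial_mul (hq i y) (hq i y).
  have pl := @partial_lin R n (fun=> 1) _ (- (rho ^- 2) ^+ 2) i y (@has_partial_cst R n 1 i y) p1.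
  rewrite Eu; apply: etrans pl.2 _.
  by rewrite p2 (@partial_cst R n 1 i y); ring.
have dw i : has_partial i sqdist y0 by exact: hq.
split=> [i|i j]; first by rewrite E sqdist_center mulr0.
have -> : partial i flat_bump = fun y => w i y * sqdist y by apply/funext => y; exact: E.
have hw : has_partial j (w i) y0.
  have Cw : Ck 1 setT (w i).
    apply: (eq_Ck (f := (cst 3%:R \* (pos_pow 2 \o u))
       \* (cst (- 2 * (rho ^- 2) ^+ 2) \* partial i sqdist))) => //; first exact: openT.
    apply: CkM; [exact: openT| |].
      by apply: CkM; [exact: openT|exact: Ck_cst|exact: (Ck_pos_pow openT (Ck_u 1))].
    by apply: CkM; [exact: openT|exact: Ck_cst|exact: Ck_partial (Ck_sqdist 2)].
  exact: Ck_has_partial Cw _.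
apply: etrans (partial_mul hw (hq j y0)).2 _.
by rewrite sqdist_center partial_sqdist_center !mulr0 addr0.
Qed.

End flat_bump.

Section peak.
Context {R : realType} {n : nat} {M : riemannianManifold R n}.
Variables (x0 : M) (rho : R).
Let c : chart R n M := chart_at x0.
Let y0 : 'rV[R]_n := chart_map c x0.
Hypothesis rho0 : 0 < rho.
Hypothesis ball_cod : forall y : 'rV[R]_n, (forall i, `|y 0 i - y0 0 i| <= rho) -> chart_cod c y.

Let ac : atlas c. Proof. exact: atlas_chart_at. Qed.
Let cx0 : chart_dom c x0. Proof. exact: mem_chart_at. Qed.

Definition manifold_bump (x : M) : R :=
  if `[< chart_dom c x >] then flat_bump rho y0 (chart_map c x) else 0.

(** A coordinate cube rather than a round ball: being the image of a product of segments, it is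
    compact. *)
Definition bump_ball : set M :=
  chart_inv c @` [set y : 'rV[R]_n | forall i, `|y 0 i - y0 0 i| <= rho].

Lemma compact_bump_ball : compact bump_ball.
Proof.
apply: continuous_compact.
  apply: continuous_in_subspaceT => y; rewrite inE => /ball_cod cy.
  exact: continuous_chart_inv.
have Ai i : compact (`[y0 0 i - rho, y0 0 i + rho]%classic : set R) by exact: segment_compact.
rewrite (_ : [set y | _] =
    [set y : 'rV[R]_n | forall i, `[y0 0 i - rho, y0 0 i + rho]%classic (y ord0 i)]).
  exact: (@rV_compact R n _ Ai).
by apply/seteqP; split=> y /= H i; move: (H i); rewrite in_itv/= ler_distl.
Qed.

Lemma bump_ball_closed : closed bump_ball.
Proof. apply: compact_closed; [exact: space_hausdorff|exact: compact_bump_ball]. Qed.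

Lemma manifold_bump_support x : manifold_bump x != 0 -> bump_ball x.
Proof.
rewrite /manifold_bump; case: asboolP => [cx|]; last by rewrite eqxx.
move=> bx; exists (chart_map c x); last exact: chart_mapK.
by move=> i; exact: flat_bump_support.
Qed.

Lemma manifold_bump_inv y : chart_cod c y -> manifold_bump (chart_inv c y) = flat_bump rho y0 y.
Proof.
move=> cy; rewrite /manifold_bump asboolT; last exact: chart_dom_inv.
by rewrite chart_invK.
Qed.

(** On the domain of c the function is the flat bump composed with a transition map. At other points
    it vanishes on a neighbourhood, the complement of [bump_ball], which is open because a compact
    set is closed in a Hausdorff space. *)
Lemma Ck_manifold_bump c' : atlas c' -> Ck 2 (chart_cod c') (manifold_bump \o chart_inv c').
Proof.
move=> ac'; apply: Ck_local => y cy.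
have [cx|cx] := pselect (chart_dom c (chart_inv c' y)).
  exists (overlap c' c); split; [exact: open_overlap|exact/(overlapP _ _ ac')|].
  apply: (eq_Ck (f := flat_bump rho y0 \o transition c' c) (open_overlap ac' ac)).
    move=> z /(overlapP _ _ ac')[_ cz].
    by rewrite /= /manifold_bump asboolT.
  apply: (Ck_comp (open_overlap ac' ac) openT (fun _ _ => I)).
    by move=> j; exact: Ck_transition.
  exact: Ck_flat_bump.
pose U : set 'rV[R]_n := [set z | chart_cod c' z /\ ~ bump_ball (chart_inv c' z)].
have oU : open U.
  rewrite openE => z [cz bz].
  have N1 : \forall w \near z, chart_cod c' w.
    by apply: open_nbhs_nbhs; split=> //; exact: open_chart_cod.
  have N2 : \forall w \near z, (~` bump_ball) (chart_inv c' w).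
    apply: (continuous_chart_inv ac' cz); apply: open_nbhs_nbhs; split=> //.
    by rewrite openC; exact: bump_ball_closed.
  exact: filterI N1 N2.
exists U; split=> //.
  by split=> // -[z /ball_cod cz zE]; apply: cx; rewrite -zE; exact: chart_dom_inv.
apply: (eq_Ck oU _ (Ck_cst 2 U 0)) => z [cz bz].
apply/esym/eqP; apply: contrapT => bn; apply: bz.
by apply: manifold_bump_support; apply/negP.
Qed.

Lemma continuous_manifold_bump : continuous manifold_bump.
Proof.
move=> x; have ax := atlas_chart_at x; have cx := mem_chart_at x.
have H := continuous_comp (continuous_chart_map ax cx)
  (Ck_continuous (open_chart_cod ax) (Ck_manifold_bump ax) (chart_cod_map cx)).
have K : (manifold_bump \o chart_inv (chart_at x)) (chart_map (chart_at x) x) = manifold_bump x.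
  by rewrite /comp chart_mapK.
rewrite /continuous_at -[X in _ --> X]K; apply: cvg_trans H; apply: near_eq_cvg.
have : \forall z \near x, chart_dom (chart_at x) z.
  by apply: open_nbhs_nbhs; split=> //; exact: open_chart_dom.
by apply: filterS => z cz; rewrite /comp chart_mapK.
Qed.

Lemma manifold_bump_le1 x : manifold_bump x <= 1.
Proof. by rewrite /manifold_bump; case: asboolP => // _; exact: flat_bump_le1. Qed.

Lemma manifold_bump_center : manifold_bump x0 = 1.
Proof. by rewrite /manifold_bump asboolT//; exact: flat_bump_center. Qed.

Lemma manifold_bump_eq1 x : manifold_bump x = 1 -> x = x0.
Proof.
rewrite /manifold_bump; case: asboolP => [cx|_ /eqP]; last by rewrite eq_sym oner_eq0.
move=> /(flat_bump_eq1 rho0) E.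
by rewrite -(chart_mapK ac cx) E chart_mapK.
Qed.

Lemma manifold_bump_jet : differential manifold_bump x0 = 0 /\ hessian manifold_bump x0 = 0.
Proof.
have [j1 j2] := flat_bump_jet rho y0.
have cy0 : chart_cod c y0 := chart_cod_map cx0.
have oc := open_chart_cod ac.
have E1 i y : chart_cod c y ->
    partial i (manifold_bump \o chart_inv c) y = partial i (flat_bump rho y0) y.
  by move=> cy; apply: (eq_partial i oc manifold_bump_inv cy).
split.
  by apply/rowP => i; rewrite [LHS]mxE [RHS]mxE (E1 i y0 cy0).
apply/matrixP => i j; rewrite [LHS]mxE [RHS]mxE.
rewrite (eq_partial i oc (E1 j) cy0) j2 big1 ?subr0// => k _.
by rewrite (E1 k y0 cy0) j1 mulr0.
Qed.

End peak.

Section peak_function.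
Local Opaque differential hessian time_derivative.
Context {R : realType} {n : nat} {M : riemannianManifold R n}.
Variables (T : R) (z0 : R * M).
Hypotheses (T0 : 0 < T) (z0T : `[0, T]%classic z0.1).

(* Adding or subtracting theta makes a contact point at z0 strict without changing
   the jet. *)
Lemma peak_function : exists theta : R * M -> R,
  [/\ C12 T theta, continuous theta, theta z0 = 0, forall z, 0 <= theta z &
      [/\ time_derivative T theta z0 = 0,
          differential (fun x => theta (z0.1, x)) z0.2 = 0 &
          hessian (fun x => theta (z0.1, x)) z0.2 = 0]] /\
  (forall U, nbhs z0 U -> exists2 m, 0 < m &
     [set z | theta z <= m] `<=` U /\ compact [set z | theta z <= m]).
Proof.
have ac := atlas_chart_at z0.2; have cx := mem_chart_at z0.2.
have [d /= d0 dcod] : exists2 d : R, 0 < d &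
    ball (chart_map (chart_at z0.2) z0.2) d `<=` chart_cod (chart_at z0.2).
  apply/nbhs_ballP; apply: open_nbhs_nbhs; split; first exact: open_chart_cod.
  exact: chart_cod_map.
(* Half the radius, so that the closed cube lies in the open ball contained in the chart. *)
pose rho := d / 2.
have rho0 : 0 < rho by rewrite divr_gt0.
have rcod (y : 'rV[R]_n) : (forall i, `|y 0 i - chart_map (chart_at z0.2) z0.2 0 i| <= rho) ->
    chart_cod (chart_at z0.2) y.
  move=> H; apply: dcod; rewrite -ball_normE/= distrC.
  apply: (@le_lt_trans _ _ rho); last by rewrite /rho; lra.
  by apply: norm_row_le => [|i]; [exact: ltW|rewrite !mxE; exact: H].
pose b := @manifold_bump R n M z0.2 rho.
have [Cb tb] := C12_space T0 (Ck_manifold_bump rho0 rcod).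
have dp t : is_derive t (1 : R) (fun t => (t - z0.1) ^+ 2) (2 * (t - z0.1)).
  rewrite (_ : (fun t => _) = (id - cst z0.1 : R -> R) ^+ 2); last first.
    by apply/funext => s; rewrite exprfctE.
  apply: is_derive_eq.
  by rewrite subr0 expr1 -[_ *: _]/(_ * _) mulr1.
have cp' : continuous (fun t : R => 2 * (t - z0.1)).
  move=> t; apply: cvgM; first exact: cvg_cst.
  by apply: cvgB; [exact: cvg_id|exact: cvg_cst].
have [Cp tp] := C12_time (M := M) T0 dp cp'.
have Cone : C12 T (fun _ : R * M => (1 : R)) := C12_cst T0 _.
pose th1 (z : R * M) : R := 1 + (-1) * b z.2.
have C1 : C12 T th1 := C12_lin T0 (-1) Cone Cb.
pose theta (z : R * M) : R := th1 z + 1 * (z.1 - z0.1) ^+ 2.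
have Ct : C12 T theta := C12_lin T0 (1) C1 Cp.
have cb := continuous_manifold_bump rho0 rcod.
have ctheta : continuous theta.
  move=> z; apply: cvgD.
    apply: cvgD; first exact: cvg_cst.
    by apply: cvgM; [exact: cvg_cst|apply: (continuous_comp cvg_snd); exact: cb].
  apply: cvgM; first exact: cvg_cst.
  apply: (@continuous_comp _ _ _ (fun z : R * M => z.1 - z0.1) (fun t : R => t ^+ 2)).
    by apply: cvgB; [exact: cvg_fst|exact: cvg_cst].
  exact: exprn_continuous.
have th1_ge0 z : 0 <= th1 z.
  by rewrite /th1 mulN1r subr_ge0; exact: manifold_bump_le1.
have theta_ge0 z : 0 <= theta z.
  by rewrite /theta mul1r addr_ge0// sqr_ge0.
have theta0 : theta z0 = 0.
  by rewrite /theta /th1 /b manifold_bump_center mulN1r !subrr expr0n mulr0 addr0.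
have theta_eq0 z : theta z = 0 -> z = z0.
  move=> /eqP; rewrite /theta mul1r paddr_eq0//; last exact: sqr_ge0.
  rewrite sqrf_eq0 subr_eq0 /th1 mulN1r subr_eq0 => /andP[/eqP b1 /eqP z1].
  rewrite [z]surjective_pairing [z0]surjective_pairing z1; congr (_, _).
  by apply: (manifold_bump_eq1 rho0); rewrite b1.
exists theta; split.
  split=> //; split.
  - rewrite (time_derivative_lin T0 (1) C1 Cp z0T).
    rewrite (time_derivative_lin T0 (-1) Cone Cb z0T).
    rewrite (tb _ z0T) (tp _ z0T) subrr !mulr0 !addr0.
    have [_ t1] := @C12_space R n M T T0 (cst 1) (fun c _ => Ck_cst 2 _ 1).
    exact: (t1 z0 z0T).
  - apply: etrans (differential_lin (1) z0.2 C1 Cp z0T) _.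
    have -> : differential (fun x : M => ((z0.1, x).1 - z0.1) ^+ 2) z0.2 = 0 
      := differential_cst ((z0.1 - z0.1) ^+ 2) z0.2.
    rewrite scaler0 addr0; apply: etrans (differential_lin (-1) z0.2 Cone Cb z0T) _.
    have [-> _] := manifold_bump_jet z0.2 rho.
    by rewrite differential_cst scaler0 addr0.
  - apply: etrans (hessian_lin (1) z0.2 C1 Cp z0T) _.
    have -> : hessian (fun x : M => ((z0.1, x).1 - z0.1) ^+ 2) z0.2 = 0 
      := hessian_cst ((z0.1 - z0.1) ^+ 2) z0.2.
    rewrite scaler0 addr0; apply: etrans (hessian_lin (-1) z0.2 Cone Cb z0T) _.
    have [_ ->] := manifold_bump_jet z0.2 rho.
    by rewrite hessian_cst scaler0 addr0.
move=> U zU.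
have closed_sub m : closed [set z | theta z <= m].
  rewrite (_ : [set z | _] = theta @^-1` [set r | r <= m])//.
  by apply: preimage_closed; [move=> ? ? |exact: closed_le].
(* Where the bump vanishes theta is at least 1, and theta dominates the squared time difference
   everywhere; a level below 1 therefore confines z to a compact product. *)
have compact_sub m : m < 1 -> compact [set z | theta z <= m].
  move=> m1; pose K := `[z0.1 - 1, z0.1 + 1]%classic `*` bump_ball z0.2 rho.
  apply: (@subclosed_compact _ _ K) => //.
    by apply: compact_setX; [exact: segment_compact|exact: compact_bump_ball].
  move=> z /= zm; have zm1 : theta z < 1 := le_lt_trans zm m1; split.
    have : (z.1 - z0.1) ^+ 2 < 1.
      by apply: le_lt_trans zm1; rewrite /theta mul1r lerDr.
    by rewrite /= in_itv/= => ?; apply/andP; split; nra.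
  apply: manifold_bump_support => //; apply/eqP => bz; move: zm1.
  by rewrite /theta /th1 /b bz mulr0 addr0 mul1r gtrDl ltNge sqr_ge0.
(* On the part of a compact sublevel set outside the interior of U, theta has a positive minimum,
   since it vanishes only at z0; points of the sublevel set below that minimum lie in U. *)
have cK : compact ([set z | theta z <= 2^-1] `&` ~` interior U).
  apply: compact_closedI; first by apply: compact_sub; lra.
  by apply: open_closedC; exact: open_interior.
have [m m0 mP] : exists2 m : R, 0 < m & forall z, theta z <= 2^-1 -> theta z < m -> U z.
  have [ne|e] := pselect (([set z | theta z <= 2^-1] `&` ~` interior U) !=set0).
    have [w /set_mem[wl wU] wmin] := compact_EVT_min ne cK (continuous_subspaceT ctheta).
    exists (theta w).
      rewrite lt_neqAle theta_ge0 andbT eq_sym; apply/eqP => /theta_eq0 wz.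
      by apply: wU; rewrite wz.
    move=> z zl zw; apply: contrapT => Uz.
    have : theta w <= theta z.
      by apply: wmin; rewrite inE; split=> // /interior_subset.
    by rewrite leNgt zw.
  exists 1 => // z zl _; apply: contrapT => Uz; apply: e; exists z.
  by split=> // /interior_subset.
exists (Num.min m 2^-1 / 2).
  by rewrite divr_gt0// lt_min m0 invr_gt0 ltr0n.
have m2 : Num.min m 2^-1 / 2 < m.
  have : Num.min m 2^-1 <= m by rewrite ge_min lexx.
  lra.
have h2 : Num.min m 2^-1 / 2 <= 2^-1.
  have : Num.min m 2^-1 <= 2^-1 by rewrite ge_min lexx orbT.
  lra.
split; last by apply: compact_sub; lra.
move=> z /= zl; apply: mP; first exact: le_trans h2.
exact: le_lt_trans m2.
Qed.

End peak_function.

(** * Riemannian distance and envelopes *)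

Section segment_curve.
Context {R : realType} {n : nat} {M : riemannianManifold R n}.
Variables (c : chart R n M) (y v : 'rV[R]_n).
Hypothesis ac : atlas c.
Hypothesis line_cod : forall s : R, `[0, 1]%classic s -> chart_cod c (y + s *: v).

Let line (s : R) := y + s *: v.
Let gam (s : R) : M := chart_inv c (line s).

Let cline s : {for s, continuous line}.
Proof.
by apply: cvgD; [exact: cvg_cst|apply: cvgZr_tmp; exact: cvg_id].
Qed.

Lemma chart_segment_derivative c' s : atlas c' -> `[0, 1]%classic s -> chart_dom c' (gam s) ->
  derivable_within `[0, 1]%classic (chart_map c' \o gam) s /\
  derive_within `[0, 1]%classic (chart_map c' \o gam) s = v *m 'J (transition c c') (line s).
Proof.
move=> ac' s01 c's.
have oy : overlap c c' (line s) by apply/(overlapP _ _ ac); split=> //; exact: line_cod.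
have dt := differentiable_transition ac ac' oy.
rewrite -(deriveEjacobian v dt); apply: (derive_withinP ltr01 s01).
apply: (is_derive_line (f := transition c c')).
exact: diff_derivable.
Qed.

Lemma chart_segment_C1 : C1_curve gam.
Proof.
split.
  apply: continuous_in_subspaceT => s; rewrite inE => s01.
  apply: continuous_comp; first exact: cline.
  by apply: continuous_chart_inv => //; exact: line_cod.
move=> c' ac' J; split.
  by move=> s [s01 c's]; exact: (chart_segment_derivative ac' s01 c's).1.
have oV := open_overlap ac ac'.
apply: (within_continuous_eq (f := fun s => \row_k \sum_i v 0 i *
    partial i (fun z => transition c c' z 0 k) (line s))).
  move=> s [s01 c's]; rewrite (chart_segment_derivative ac' s01 c's).2.
  have oy : overlap c c' (line s) by apply/(overlapP _ _ ac); split=> //; exact: line_cod.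
  apply/rowP => k; rewrite [LHS]mxE [RHS]mxE; apply: eq_bigr => i _; congr (_ * _).
  by apply: esym; apply: jacobianE; exact: differentiable_transition.
apply: continuous_in_subspaceT => s; rewrite inE => -[s01 c's].
have oy : overlap c c' (line s) by apply/(overlapP _ _ ac); split=> //; exact: line_cod.
apply: (cvg_mxP (F := nbhs s)) => i0 k; rewrite ord1 [X in _ --> X]mxE.
under eq_cvg do rewrite mxE.
apply: (cvg_sum_seq (F := nbhs s)) => i; apply: (cvgM (F := nbhs s)); first exact: cvg_cst.
have ct := Ck_continuous oV (Ck_partial i (Ck_transition 1 k ac ac')) oy.
exact: (cvg_comp _ _ (@cline s) ct).
Qed.

(** [speed] is read in the charts [chart_at], which vary along the curve; covariance turns it into
    the quadratic form of the metric in the fixed chart c. *)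
Lemma chart_segment_speed s : `[0, 1]%classic s ->
  speed gam s = Num.sqrt ((v *m form_in_chart (@metric R n M) c (line s) *m v^T) 0 0).
Proof.
move=> s01; rewrite /speed.
rewrite (chart_segment_derivative (atlas_chart_at _) s01 (mem_chart_at _)).2.
by rewrite trmx_mul form_in_chartE !mulmxA.
Qed.

Lemma chart_segment_length (r : R) : 0 <= r ->
  (forall s, `[0, 1]%classic s ->
    (v *m form_in_chart (@metric R n M) c (line s) *m v^T) 0 0 <= r ^+ 2) ->
  (curve_length gam <= r%:E)%E.
Proof.
move=> r0 Hr.
have mI : measurable (`[0, 1]%classic : set R) by exact: measurable_itv.
have -> : r%:E = (\int[lebesgue_measure]_(s in `[0%R, 1%R]) (cst r%:E) (s : R))%E.
  rewrite integral_cst//= lebesgue_measure_itv/= lte01 -EFinB subr0.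
  by rewrite mule1.
apply: ge0_le_integral => //.
- by move=> s _; rewrite lee_fin; exact: sqrtr_ge0.
- apply/measurable_EFinP; apply: subspace_continuous_measurable_fun => //.
  apply: (within_continuous_eq (f := fun s : R =>
    Num.sqrt ((v *m form_in_chart (@metric R n M) c (line s) *m v^T) 0 0))).
    by move=> s s01; rewrite chart_segment_speed.
  apply: continuous_in_subspaceT => s; rewrite inE => s01.
  have cs := line_cod s01.
  apply: (@continuous_comp _ _ _
    (fun s => (v *m form_in_chart (@metric R n M) c (line s) *m v^T) 0 0) (@Num.sqrt R)); last first.
    exact: sqrt_continuous.
  rewrite /prop_for /continuous_at [X in _ --> X]mxE; under eq_cvg do rewrite mxE.
  apply: (cvg_sum_seq (F := nbhs s)) => j; apply: (cvgM (F := nbhs s)); last exact: cvg_cst.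
  rewrite [X in _ --> X]mxE; under eq_cvg do rewrite mxE.
  apply: (cvg_sum_seq (F := nbhs s)) => i; apply: (cvgM (F := nbhs s)); first exact: cvg_cst.
  have cG := Ck_continuous (open_chart_cod ac) (metric_smooth ac i j 0) cs.
  exact: (cvg_comp _ _ (@cline s) cG).
- move=> s s01; rewrite lee_fin chart_segment_speed//.
  by rewrite -(ger0_norm r0) -sqrtr_sqr ler_wsqrtr// Hr.
Qed.

End segment_curve.

Lemma norm_le_of_dist {R : realType} (a b e : R) : `|a - b| <= e -> `|b| <= `|a| + e.
Proof.
move=> H; rewrite -[b in leLHS](subKr a) (le_trans (ler_normB _ _))//.
by rewrite lerD2l.
Qed.

Section rdist_topology.
Context {R : realType} {n : nat} {M : riemannianManifold R n}.

(* Only this half of the equivalence between the metric and the manifold topology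
   is needed; it is enough to bound the length of segments in a chart. *)
Lemma rdist_nbhs (x0 : M) (r : R) : 0 < r -> \forall x \near x0, (rdist x x0 <= r%:E)%E.
Proof.
move=> r0; pose c : chart R n M := chart_at x0; pose y0 := chart_map c x0.
have ac : atlas c by exact: atlas_chart_at.
have cx0 : chart_dom c x0 by exact: mem_chart_at.
have cy0 : chart_cod c y0 := chart_cod_map cx0.
have oc := open_chart_cod ac.
pose G := form_in_chart (@metric R n M) c.
have [d d0 dP] : exists2 d : R, 0 < d & forall y, ball y0 d y -> chart_cod c y /\
    forall ij : 'I_n * 'I_n, `|G y0 ij.1 ij.2 - G y ij.1 ij.2| <= 1.
  have : \forall y \near y0, chart_cod c y /\
    forall ij : 'I_n * 'I_n, `|G y0 ij.1 ij.2 - G y ij.1 ij.2| <= 1.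
    have cG (ij : 'I_n * 'I_n) : \forall y \near y0, `|G y0 ij.1 ij.2 - G y ij.1 ij.2| <= 1.
      have cGij := Ck_continuous oc (metric_smooth ac ij.1 ij.2 0) cy0.
      exact: ((cvgrPdist_le _ _).1 cGij 1 ltr01).
    have N1 : \forall y \near y0, chart_cod c y by exact: open_nbhs_nbhs.
    have N2 : \forall y \near y0, forall ij : 'I_n * 'I_n,
        `|G y0 ij.1 ij.2 - G y ij.1 ij.2| <= 1.
      exact: (@filter_forall _ _ (fun (ij : 'I_n * 'I_n) y =>
        `|G y0 ij.1 ij.2 - G y ij.1 ij.2| <= 1) (nbhs y0) _ cG).
    by apply: filterS2 N1 N2.
  by move=> /nbhs_ballP[d /= d0 dP]; exists d.
(* B bounds the sum of the absolute values of the metric coefficients near y0, so v G v^T is at most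
   B |v|^2 for the sup norm. *)
pose B := \sum_i \sum_j (`|G y0 i j| + 1).
have B0 : 0 <= B by apply: sumr_ge0 => i _; apply: sumr_ge0 => j _; rewrite addr_ge0.
(* Since B <= (B + 1)^2, the bound |v| <= r / (B + 1) gives B |v|^2 <= r^2. *)
pose e := Num.min d (r / (B + 1)).
have B10 : 0 < B + 1 by rewrite ltr_wpDl.
have e0 : 0 < e by rewrite lt_min d0 divr_gt0.
have : \forall x \near x0, chart_dom c x /\ ball y0 e (chart_map c x).
  apply: filterI.
    by apply: open_nbhs_nbhs; split=> //; exact: open_chart_dom.
  by apply: (continuous_chart_map ac cx0); exact: nbhsx_ballx.
apply: filterS => x [cx]; rewrite -ball_normE/= => xe.
pose v := y0 - chart_map c x.
have line_ball (s : R) : `[0, 1]%classic s -> ball y0 d (chart_map c x + s *: v).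
  rewrite /= in_itv/= => /andP[s0 s1]; rewrite -ball_normE/=.
  have -> : y0 - (chart_map c x + s *: v) = (1 - s) *: v.
    by rewrite opprD addrA -/v scalerBl scale1r.
  rewrite normrZ ger0_norm ?subr_ge0//.
  apply: (@le_lt_trans _ _ `|v|).
    by rewrite ler_piMl// lerBlDr lerDl.
  by apply: lt_le_trans xe _; rewrite ge_min lexx.
have lc s s01 := (dP _ (line_ball s s01)).1.
apply: (@le_trans _ _ (curve_length (fun s : R => chart_inv c (chart_map c x + s *: v)))).
  apply: ereal_inf_lbound; exists (fun s : R => chart_inv c (chart_map c x + s *: v)) => //.
  split; first exact: chart_segment_C1 ac lc.
    by rewrite scale0r addr0 chart_mapK.
  by rewrite scale1r /v addrC subrK chart_mapK.
apply: (chart_segment_length ac lc (ltW r0)) => s s01.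
have vr : `|v| <= r / (B + 1).
  by apply: ltW; apply: lt_le_trans xe _; rewrite ge_min lexx orbT.
have GB i j : `|G (chart_map c x + s *: v) i j| <= `|G y0 i j| + 1.
  exact: norm_le_of_dist ((dP _ (line_ball s s01)).2 (i, j)).
apply: (@le_trans _ _ (B * `|v| ^+ 2)).
  rewrite mxE /B exchange_big/= mulr_suml; apply: ler_sum => j _.
  rewrite mxE !mulr_suml; apply: ler_sum => i _.
  apply: (le_trans (ler_norm _)); rewrite !normrM [v^T j 0]mxE mulrAC mulrC expr2.
  apply: ler_pM; rewrite ?mulr_ge0 ?normr_ge0//.
  by apply: ler_pM; rewrite ?normr_ge0//; exact: coord_le_norm.
have vB : `|v| * (B + 1) <= r by rewrite -ler_pdivlMr.
have : (`|v| * (B + 1)) ^+ 2 <= r ^+ 2 by rewrite lerXn2r ?nnegrE// ?mulr_ge0// ltW.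
apply: le_trans; rewrite exprMn mulrC ler_wpM2l ?sqr_ge0//.
have := sqr_ge0 B; nra.
Qed.

Lemma near_pts_nbhs (Q : set (R * M)) z (r : R) : 0 < r ->
  \forall w \near within Q (nbhs z), near_pts Q z r w.
Proof.
move=> r0; rewrite near_withinE.
have N : nbhs z ([set t | `|t - z.1| <= r] `*` [set x | (rdist x z.2 <= r%:E)%E]).
  rewrite [z]surjective_pairing; apply: nbhs_setX; last exact: rdist_nbhs.
  near=> t; rewrite /= distrC.
  near: t; exact: ((cvgrPdist_le _ _).1 (@cvg_id _ (nbhs z.1)) r r0).
by apply: filterS N => w [w1 w2] Qw.
Unshelve. all: by end_near. Qed.

(** The infima over [near_pts] increase as the radius shrinks, so the limit exists, and it exceeds a
    only if one of them does. The [near_pts] of that radius contain a topological neighbourhood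
    within Q. *)
Lemma lower_envelope_near (Q : set (R * M)) u z (a : R) :
  (a%:E < lower_envelope Q u z)%E -> \forall w \near within Q (nbhs z), a < u w.
Proof.
move=> az.
pose phi (r : R) := ereal_inf [set (u w)%:E | w in near_pts Q z r].
have [r r0 ar] : exists2 r : R, 0 < r & (a%:E < phi r)%E.
  apply: contrapT => H; move: az; apply/negP; rewrite -leNgt.
  apply: lime_le.
    apply: nonincreasing_at_right_is_cvge; near=> b => p q _ _ pq.
    apply: ereal_inf_le_tmp => _ [w [Qw w1 w2] <-]; exists w => //; split=> //.
      exact: le_trans w1 pq.
    by apply: le_trans w2 _; rewrite lee_fin.
  near=> r; rewrite leNgt; apply/negP => ar; apply: H; exists r => //.
apply: filterS (near_pts_nbhs Q z r0) => w Nw.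
rewrite -lte_fin; apply: lt_le_trans ar _.
by apply: ereal_inf_lbound; exists w.
Unshelve. all: by end_near. Qed.

Lemma upper_envelope_near (Q : set (R * M)) u z (a : R) :
  (upper_envelope Q u z < a%:E)%E -> \forall w \near within Q (nbhs z), u w < a.
Proof.
move=> az.
pose phi (r : R) := ereal_sup [set (u w)%:E | w in near_pts Q z r].
have [r r0 ar] : exists2 r : R, 0 < r & (phi r < a%:E)%E.
  apply: contrapT => H; move: az; apply/negP; rewrite -leNgt.
  apply: lime_ge.
    apply: nondecreasing_at_right_is_cvge; near=> b => p q _ _ pq.
    apply: ereal_sup_le => _ [w [Qw w1 w2] <-]; exists w => //; split=> //.
      exact: le_trans w1 pq.
    by apply: le_trans w2 _; rewrite lee_fin.
  near=> r; rewrite leNgt; apply/negP => ar; apply: H; exists r => //.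
apply: filterS (near_pts_nbhs Q z r0) => w Nw.
rewrite -lte_fin; apply: le_lt_trans _ ar.
by apply: ereal_sup_ubound; exists w.
Unshelve. all: by end_near. Qed.

End rdist_topology.

(** * Perron's method *)

Section semicontinuity.
Context {R : realType} {X : topologicalType}.
Implicit Types (K Q : set X) (u : X -> R).

(** Without a maximum, the strict superlevel sets of u in K are nonempty and nested, and generate a
    proper filter. At a cluster point p some q has u p < u q, while semicontinuity keeps u below u q
    near p: a contradiction. *)
Lemma usc_compact_max K u : compact K -> K !=set0 ->
  (forall z, K z -> forall a, u z < a -> \forall w \near within K (nbhs z), u w < a) ->
  exists2 p, K p & forall z, K z -> u z <= u p.
Proof.
move=> cK [k0 Kk0] usc; apply: contrapT => nomax.
have up z : K z -> exists2 w, K w & u z < u w.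
  move=> Kz; apply: contrapT => H; apply: nomax; exists z => // w Kw.
  by rewrite leNgt; apply/negP => zw; apply: H; exists w.
pose D z := [set w | K w /\ u z < u w].
pose F := filter_from K D.
have FF : ProperFilter F.
  apply: filter_from_proper; last by move=> z /up[w Kw zw]; exists w.
  apply: filter_from_filter; first by exists k0.
  move=> a b Ka Kb; have [ab|ba] := leP (u a) (u b).
    by exists b => // w [Kw bw]; split; split=> //; exact: le_lt_trans bw.
  by exists a => // w [Kw aw]; split; split=> //; exact: lt_trans aw.
have FK : F K by exists k0 => // w [].
have [p [Kp clp]] := cK F FF FK.
have [q Kq pq] := up p Kp.
have Fq : F (D q) by exists q.
have Np : nbhs p [set w | K w -> u w < u q] by have := usc p Kp _ pq; rewrite near_withinE.
have [w [[Kw qw] wq]] := clp _ _ Fq Np.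
by have := lt_trans qw (wq Kw); rewrite ltxx.
Qed.

(** Topological envelope as the infimum of the local upper bounds. As a real infimum it is
    meaningful at points of Q, where u z is a lower bound, provided the set is nonempty, which is
    the hypothesis [bounded_above]. *)
Definition usc_envelope Q u (z : X) : R := inf [set a | \forall w \near within Q (nbhs z), u w <= a].

Section envelope.
Variables (Q : set X) (u : X -> R).
Hypothesis bounded_above : forall z, Q z -> exists a, \forall w \near within Q (nbhs z), u w <= a.

Let near_self z (P : set X) : Q z -> (\forall w \near within Q (nbhs z), P w) -> P z.
Proof. by move=> Qz; rewrite near_withinE => /nbhs_singleton; apply. Qed.

Lemma usc_envelope_le z a : Q z -> (\forall w \near within Q (nbhs z), u w <= a) ->
  usc_envelope Q u z <= a.
Proof.
move=> Qz ua; apply: ge_inf => //; exists (u z) => b /=.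
exact: near_self.
Qed.

Lemma le_usc_envelope z : Q z -> u z <= usc_envelope Q u z.
Proof.
move=> Qz; apply: lb_le_inf; first exact: bounded_above.
by move=> b /=; exact: near_self.
Qed.

Lemma usc_envelope_gt z b (N : set X) : Q z -> b < usc_envelope Q u z -> nbhs z N ->
  exists w, [/\ N w, Q w & b < u w].
Proof.
move=> Qz bz zN; apply: contrapT => H; move: bz; apply/negP; rewrite -leNgt.
apply: usc_envelope_le => //; rewrite near_withinE; apply: filterS zN => w Nw Qw.
by rewrite leNgt; apply/negP => bw; apply: H; exists w.
Qed.

(** A local upper bound at z is also one at every nearby point. *)
Lemma usc_envelope_near z a : Q z -> usc_envelope Q u z < a ->
  \forall w \near within Q (nbhs z), usc_envelope Q u w < a.
Proof.
move=> Qz az.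
have [b /= ub ba] := inf_lt (bounded_above Qz) az.
move: ub; rewrite !near_withinE => /nbhs_interior; apply: filterS => w wi Qw.
apply: le_lt_trans ba; exact: usc_envelope_le.
Qed.

End envelope.
End semicontinuity.

(** * Comparison of test functions at a contact point *)

Section contact.
Context {R : realType} {n : nat} {M : riemannianManifold R n}.
Variables (T : R) (F : nonlinearity M).
Hypothesis T0 : 0 < T.
Implicit Types (phi psi theta : R * M -> R) (z : R * M).

Lemma oper_addc phi (a r : R) z : C12 T phi -> `[0, T]%classic z.1 ->
  C12 T (fun w => phi w + a) /\ oper T F (fun w => phi w + a) z r = oper T F phi z r.
Proof.
move=> Cphi zT.
have E : (fun w => phi w + a) = (fun w : R * M => phi w + 1 * (fun _ : R * M => a) w).
  by apply/funext => w; rewrite mul1r.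
have Ca : C12 T (fun _ : R * M => a) := C12_cst T0 a.
rewrite E; split; first exact: C12_lin.
rewrite /oper (time_derivative_lin T0 1 Cphi Ca zT).
rewrite (differential_lin 1 z.2 Cphi Ca zT) (hessian_lin 1 z.2 Cphi Ca zT).
have [_ ta] := C12_space T0 (fun c _ => Ck_cst 2 (chart_cod c) a) (M := M) (B := cst a).
by rewrite (ta z zT) differential_cst hessian_cst !scaler0 mulr0 !addr0.
Qed.

Lemma oper_add_flat phi theta (k r : R) z : C12 T phi -> C12 T theta -> `[0, T]%classic z.1 ->
  time_derivative T theta z = 0 -> differential (fun x => theta (z.1, x)) z.2 = 0 ->
  hessian (fun x => theta (z.1, x)) z.2 = 0 ->
  oper T F (fun w => phi w + k * theta w) z r = oper T F phi z r.
Proof.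
move=> Cphi Ct zT t0 d0 h0.
rewrite /oper (time_derivative_lin T0 k Cphi Ct zT).
rewrite (differential_lin k z.2 Cphi Ct zT) (hessian_lin k z.2 Cphi Ct zT).
by rewrite t0 d0 h0 !scaler0 mulr0 !addr0.
Qed.

Lemma hessian_sym phi z : C12 T phi -> `[0, T]%classic z.1 ->
  (hessian (fun x => phi (z.1, x)) z.2)^T = hessian (fun x => phi (z.1, x)) z.2.
Proof.
move=> Cphi zT; have ac := atlas_chart_at z.2.
exact: (chart_hess_sym ac (chart_cod_map (mem_chart_at z.2)) (C12_chart_Ck Cphi ac zT)).
Qed.

(** The difference phi - psi has a local maximum at the interior point z: its time derivative and
    gradient vanish, and its Hessian is nonpositive because the Christoffel terms drop out with the
    gradient. Ellipticity then orders the F-terms. *)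
Lemma oper_contact phi psi z (r : R) : degenerate_elliptic T F -> C12 T phi -> C12 T psi ->
  0 < z.1 < T -> phi z = psi z -> (\forall w \near z, phi w <= psi w) ->
  oper T F psi z r <= oper T F phi z r.
Proof.
move=> eF Cphi Cpsi z0T pz near_le.
have zT : `[0, T]%classic z.1 by apply: nbhs_singleton; exact: nbhs_itvcc.
pose g (w : R * M) := phi w + (-1) * psi w.
have Cg : C12 T g := C12_lin T0 (-1) Cphi Cpsi.
have g0 : g z = 0 by rewrite /g pz mulN1r subrr.
have gle : \forall w \near z, g w <= 0.
  by apply: filterS near_le => w; rewrite /g mulN1r subr_le0.
(* A product neighbourhood lets t and x vary separately. *)
have [[P1 P2] /= [zP1 zP2] PP] : filter_prod (nbhs z.1) (nbhs z.2) [set w | g w <= 0].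
  by move: gle; rewrite {1}[z]surjective_pairing.
have td0 : time_derivative T g z = 0.
  have N : \forall s \near z.1, P1 s /\ s \in `]0, T[%R.
    by apply: filterI => //; apply: near_in_itvoo; rewrite in_itv.
  have [e /= e0 eP] : exists2 e : R, 0 < e & forall s, `|z.1 - s| < e -> P1 s /\ s \in `]0, T[%R.
    by move: N => /nbhs_ballP[e /= e0 eP]; exists e => // s se; apply: eP; rewrite -ball_normE.
  have dg s : s \in `]0, T[%R -> is_derive s (1 : R) (fun s => g (s, z.2)) (time_derivative T g (s, z.2)).
    move=> s0T; have [_ d _ _] := Cg; apply: derive_within_interior.
      by move: s0T; rewrite in_itv.
    apply: (d (s, z.2)); split=> //=; move: s0T; rewrite !in_itv/= => /andP[s0 sT].
    by rewrite !ltW.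
  have near_z s : s \in `](z.1 - e), (z.1 + e)[%R -> `|z.1 - s| < e.
    by rewrite in_itv/= distrC ltr_distl.
  have [||||_ dmax] := @derive1_at_max R (fun s => g (s, z.2)) (z.1 - e) (z.1 + e) z.1.
  - by lra.
  - by move=> s /near_z/eP[_ /dg[]].
  - by rewrite in_itv/=; apply/andP; split; lra.
  - move=> s /near_z/eP[P1s _]; rewrite -surjective_pairing g0.
    by apply: (PP (s, z.2)); split=> //; exact: nbhs_singleton.
  have [_ dz] : is_derive z.1 (1 : R) (fun s => g (s, z.2)) (time_derivative T g z).
    rewrite {3}[z]surjective_pairing; apply: dg; rewrite in_itv; exact: z0T.
  by rewrite -dz.
have ac := atlas_chart_at z.2; have cx := mem_chart_at z.2.
set c := chart_at z.2 in ac cx; pose y := chart_map c z.2.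
have cy : chart_cod c y := chart_cod_map cx.
have oc := open_chart_cod ac.
pose gc := (fun x => g (z.1, x)) \o chart_inv c.
have Cgc : Ck 2 (chart_cod c) gc := C12_chart_Ck Cg ac zT.
have gcmax : \forall w \near y, gc w <= gc y.
  have gy : gc y = 0 by rewrite /gc /comp chart_mapK// -surjective_pairing.
  have zy : chart_inv c y = z.2 by rewrite chart_mapK.
  have zP2' : nbhs (chart_inv c y) P2 by rewrite zy.
  have N : \forall w \near y, P2 (chart_inv c w) by exact: (continuous_chart_inv ac cy zP2').
  apply: filterS N => w P2w.
  rewrite gy; apply: (PP (z.1, chart_inv c w)); split=> //; exact: nbhs_singleton.
have so v := second_order_max v oc Cgc cy gcmax.
have d0 i : partial i gc y = 0.
  have [+ _] := so (delta_mx 0 i).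
  rewrite (bigD1 i)//= mxE !eqxx mul1r big1 ?addr0// => j ji.
  by rewrite mxE eqxx/= (negbTE ji) mul0r.
have dg0 : differential (fun x => g (z.1, x)) z.2 = 0.
  by apply/rowP => i; rewrite [LHS]mxE [RHS]mxE; exact: d0.
have hg (v : 'rV[R]_n) : (v *m hessian (fun x => g (z.1, x)) z.2 *m v^T) 0 0 <= 0.
  have [_] := so v; apply: le_trans; rewrite le_eqVlt; apply/orP; left; apply/eqP.
  rewrite mxE; apply: eq_bigr => j _; rewrite [v^T j 0]mxE mulrC; congr (_ * _).
  rewrite mxE; apply: eq_bigr => i _; congr (_ * _); rewrite [LHS]mxE.
  rewrite big1 ?subr0// => k _.
  exact: (etrans (f_equal2 *%R erefl (d0 k)) (mulr0 _)).
have tE : time_derivative T phi z = time_derivative T psi z.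
  apply/eqP; rewrite -subr_eq0 -mulN1r; apply/eqP.
  by rewrite -(time_derivative_lin T0 (-1) Cphi Cpsi zT).
have dE : differential (fun x => phi (z.1, x)) z.2 = differential (fun x => psi (z.1, x)) z.2.
  apply/eqP; rewrite -subr_eq0 -scaleN1r; apply/eqP.
  by rewrite -(differential_lin (-1) z.2 Cphi Cpsi zT).
rewrite /oper tE dE lerD2l; apply: eF.
- exact: zT.
- exact: hessian_sym.
- exact: hessian_sym.
move=> v; rewrite -subr_le0.
have := hg v; rewrite (hessian_lin (-1) z.2 Cphi Cpsi zT) scaleN1r.
have sub00 (A B : 'M[R]_1) : (A - B) 0 0 = A 0 0 - B 0 0 by rewrite !mxE.
by rewrite mulmxDr mulmxDl mulmxN mulNmx sub00.
Qed.

End contact.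

Lemma continuous_near_lt {R : realType} {X : topologicalType} (f : X -> R) z a :
  {for z, continuous f} -> f z < a -> \forall w \near z, f w < a.
Proof. by move=> cf fa; exact: (cf _ (lt_nbhsl fa)). Qed.

Lemma continuous_near_gt {R : realType} {X : topologicalType} (f : X -> R) z a :
  {for z, continuous f} -> a < f z -> \forall w \near z, a < f w.
Proof. by move=> cf fa; exact: (cf _ (lt_nbhsr fa)). Qed.

(** * The Perron construction *)

Section perron_method.
Local Opaque differential hessian time_derivative.
Context {R : realType} {n : nat} {M : riemannianManifold R n}.
Variables (T : R) (Omega : set M) (F : nonlinearity M) (h : R * M -> R) (psi : M -> R).
Hypotheses (T0 : 0 < T) (oOmega : open Omega).
Implicit Types (u W phi : R * M -> R) (z : R * M).

Let Q := cylinder T Omega.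

Definition inner z : Prop := 0 < z.1 < T /\ Omega z.2.

Lemma inner_near z : inner z -> \forall w \near z, inner w.
Proof.
move=> [zT Oz]; rewrite {1}[z]surjective_pairing.
apply: (nbhs_setX (A := [set s | 0 < s < T]) (B := Omega)); last exact: open_nbhs_nbhs.
have : z.1 \in `]0, T[%R by rewrite in_itv.
by move=> /near_in_itvoo; apply: filterS => s; rewrite in_itv.
Qed.

Lemma inner_cylinder z : inner z -> Q z.
Proof.
move=> [/andP[z0 zT] Oz]; split; first by rewrite /= in_itv/= zT ltW.
exact: subset_closure.
Qed.

Lemma inner_itv z : inner z -> `[0, T]%classic z.1.
Proof. by move=> [zT _]; apply: nbhs_singleton; exact: nbhs_itvcc. Qed.

(** The cylinder is a neighbourhood of its inner points, so a local extremum relative to Q is an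
    unrestricted one. *)
Lemma near_inner z (P : set (R * M)) : inner z ->
  (\forall w \near within Q (nbhs z), P w) <-> (\forall w \near z, P w).
Proof.
move=> zi; rewrite near_withinE; split; last by apply: filterS.
by apply: filterS2 (inner_near zi) => w wi; apply; exact: inner_cylinder.
Qed.

(** The jet inequality phrased with the test function itself, so that the continuity of [oper] can
    be applied to it. *)
Definition sub_test u := forall z phi, inner z -> C12 T phi -> u z = phi z ->
  (\forall w \near z, u w <= phi w) -> oper T F phi z (u z) <= 0.

Definition super_test u := forall z phi, inner z -> C12 T phi -> u z = phi z ->
  (\forall w \near z, phi w <= u w) -> 0 <= oper T F phi z (u z).

Lemma viscosity_subsolutionP u : viscosity_subsolution T Omega F h psi u <->
  [/\ usc_on Q u, (forall z, lateral_boundary T Omega z -> u z <= h z),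
      (forall x, closure Omega x -> u (0, x) <= psi x) & sub_test u].
Proof.
split=> -[us ul ui ut]; split=> //.
  move=> [t x] phi zi Cphi uphi near_le.
  apply: (ut t x) (zi.1) (zi.2) _; exists phi => //; split=> //.
    by rewrite uphi subrr.
  by apply/(near_inner _ zi); apply: filterS near_le => w; rewrite subr_le0.
move=> t x p zeta A t0T Ox [phi [Cphi u0 near_le]] [<- <- <-].
have zi : inner (t, x) by split.
apply: (ut (t, x)) => //; first by apply/eqP; rewrite -subr_eq0 u0.
by move/(near_inner _ zi): near_le; apply: filterS => w; rewrite subr_le0.
Qed.

Lemma viscosity_supersolutionP u : viscosity_supersolution T Omega F h psi u <->
  [/\ lsc_on Q u, (forall z, lateral_boundary T Omega z -> h z <= u z),
      (forall x, closure Omega x -> psi x <= u (0, x)) & super_test u].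
Proof.
split=> -[us ul ui ut]; split=> //.
  move=> [t x] phi zi Cphi uphi near_le.
  apply: (ut t x) (zi.1) (zi.2) _; exists phi => //; split=> //.
    by rewrite uphi subrr.
  by apply/(near_inner _ zi); apply: filterS near_le => w; rewrite subr_ge0.
move=> t x p zeta A t0T Ox [phi [Cphi u0 near_le]] [<- <- <-].
have zi : inner (t, x) by split.
apply: (ut (t, x)) => //; first by apply/eqP; rewrite -subr_eq0 u0.
by move/(near_inner _ zi): near_le; apply: filterS => w; rewrite subr_ge0.
Qed.

Lemma lateral_cylinder z : lateral_boundary T Omega z -> Q z.
Proof. by move=> [zT [zO _]]; split. Qed.

Lemma initial_cylinder x : closure Omega x -> Q (0, x).
Proof. by move=> cx; split=> //; rewrite /= in_itv/= lexx. Qed.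

Lemma near_within_eq u (v : R * M -> R) (P : R -> R * M -> Prop) z : (forall z, Q z -> u z = v z) ->
  (\forall w \near within Q (nbhs z), P (u w) w) -> \forall w \near within Q (nbhs z), P (v w) w.
Proof. by move=> uv; rewrite !near_withinE; apply: filterS => w Pw Qw; rewrite -uv//; exact: Pw. Qed.

(** Values off Q are arbitrary: the supremum and its envelope will be identified on Q only. *)
Lemma eq_viscosity_subsolution u (v : R * M -> R) : (forall z, Q z -> u z = v z) ->
  viscosity_subsolution T Omega F h psi u -> viscosity_subsolution T Omega F h psi v.
Proof.
move=> uv /viscosity_subsolutionP[us ul ui ut]; apply/viscosity_subsolutionP; split.
- move=> z Qz a; rewrite -uv// => /(us z Qz).
  exact: (near_within_eq (P := fun r _ => r < a)).
- by move=> z lz; rewrite -uv; [exact: ul|exact: lateral_cylinder].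
- by move=> x cx; rewrite -uv; [exact: ui|exact: initial_cylinder].
move=> z phi zi Cphi; rewrite -uv; last exact: inner_cylinder.
move=> uphi near_le; apply: ut => //.
by apply: filterS2 (inner_near zi) near_le => w wi; rewrite uv//; exact: inner_cylinder.
Qed.

Lemma eq_viscosity_supersolution u (v : R * M -> R) : (forall z, Q z -> u z = v z) ->
  viscosity_supersolution T Omega F h psi u -> viscosity_supersolution T Omega F h psi v.
Proof.
move=> uv /viscosity_supersolutionP[us ul ui ut]; apply/viscosity_supersolutionP; split.
- move=> z Qz a; rewrite -uv// => /(us z Qz).
  exact: (near_within_eq (P := fun r _ => a < r)).
- by move=> z lz; rewrite -uv; [exact: ul|exact: lateral_cylinder].
- by move=> x cx; rewrite -uv; [exact: ui|exact: initial_cylinder].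
move=> z phi zi Cphi; rewrite -uv; last exact: inner_cylinder.
move=> uphi near_le; apply: ut => //.
by apply: filterS2 (inner_near zi) near_le => w wi; rewrite uv//; exact: inner_cylinder.
Qed.

Lemma C12_continuous phi z : C12 T phi -> inner z -> {for z, continuous phi}.
Proof.
move=> [cphi _ _ _] [zT _]; apply: within_continuous_at cphi _.
rewrite [z]surjective_pairing; apply: nbhs_setX; last exact: filterT.
exact: nbhs_itvcc.
Qed.

Hypothesis cF : continuous_on_chi T F.

(** P is an open condition, used as r > 0 for the subsolution part and as r < 0 for the
    supersolution part. *)
Lemma oper_sign_near phi z (r0 : R) (P : R -> Prop) : C12 T phi -> inner z ->
  (forall r, P r -> \forall s \near r, P s) -> P (oper T F phi z r0) ->
  exists2 eta, 0 < eta &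
    \forall w \near z, forall r, `|r - r0| < eta -> P (oper T F phi w r).
Proof.
move=> Cphi zi oP Pz.
have [[N1 N2] /= [zN1 rN2] N12] := continuous_oper (r := r0) cF Cphi zi.1 (oP _ Pz).
have [e /= e0 eN2] := (nbhs_ballP _ _).1 rN2.
exists e => //; apply: filterS zN1 => w Nw r re; apply: (N12 (w, r)); split=> //.
by apply: eN2; rewrite -ball_normE/= distrC.
Qed.

(** The competitor w is chosen after the neighbourhood, and its own semicontinuity supplies the
    maximiser p. The point is then that p lies strictly inside the sublevel set and that w p is
    within eta of the envelope at z. *)
Lemma sub_test_sup (S : set (R * M -> R)) W :
  (forall w, S w -> usc_on Q w /\ sub_test w) ->
  (forall w z, S w -> Q z -> w z <= W z) ->
  (forall z b, Q z -> b < W z -> exists2 w, S w & b < w z) ->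
  (forall z, Q z -> exists a, \forall w \near within Q (nbhs z), W w <= a) ->
  sub_test (usc_envelope Q W).
Proof.
move=> Ssub SW WS bdd; set Wu := usc_envelope Q W.
move=> z phi zi Cphi Wz near_le; rewrite leNgt; apply/negP => pos.
have Qz := inner_cylinder zi.
have [th [[Cth cth th0 th_ge0 [tt td thh]] th_sub]] := peak_function T0 (inner_itv zi).
pose phi1 v := phi v + 1 * th v.
have C1 : C12 T phi1 := C12_lin T0 1 Cphi Cth.
have phi1z : phi1 z = Wu z by rewrite /phi1 th0 mulr0 addr0 Wz.
have [|eta eta0 near_pos] := oper_sign_near (r0 := Wu z) (P := fun r => 0 < r) C1 zi
    (fun r r0 => lt_nbhsr r0).
  by rewrite (oper_add_flat F T0 1 _ Cphi Cth (inner_itv zi) tt td thh).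
have near_phi1 : \forall v \near z, `|phi1 z - phi1 v| < eta / 2.
  by apply: ((cvgrPdist_lt _ _).1 (C12_continuous C1 zi)); rewrite divr_gt0.
have [m m0 [mU cm]] := th_sub _ (filterI (filterI near_pos near_phi1)
  (filterI (inner_near zi) near_le)).
(* At z' the function w - phi1 exceeds -2 eps, and at p it is at most - th p. Hence th p < 2 eps <=
   m / 2, and w p differs from Wu z by less than eta / 2 + 2 eps <= eta. *)
pose eps := Num.min m eta / 4.
have mn0 : 0 < Num.min m eta by rewrite lt_min m0.
have mnm : Num.min m eta <= m by rewrite ge_min lexx.
have mne : Num.min m eta <= eta by rewrite ge_min lexx orbT.
have eps0 : 0 < eps by rewrite divr_gt0.
have near_th : \forall v \near z, th v < m.
  by apply: (continuous_near_lt (cth z)); rewrite th0.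
have near_phi1' : \forall v \near z, `|phi1 z - phi1 v| < eps.
  by apply: ((cvgrPdist_lt _ _).1 (C12_continuous C1 zi)).
have We : Wu z - eps < Wu z by rewrite gtrBl.
have [z' [[thz' phiz'] Qz' Wz']] := usc_envelope_gt Qz We (filterI near_th near_phi1').
have [w Sw wz'] := WS _ _ Qz' Wz'.
have [wusc wtest] := Ssub w Sw.
have Kin v : th v <= m -> inner v by move=> /mU[_ []].
have [||p /= thp pmax] := usc_compact_max (u := fun v => w v - phi1 v) cm.
- by exists z'; exact: ltW.
- move=> v /= thv a va.
  have vi := Kin v thv.
  pose d := (a - (w v - phi1 v)) / 2.
  have d0 : 0 < d by rewrite divr_gt0 ?subr_gt0.
  have N1 : \forall q \near v, Q q -> w q < w v + d.
    have wd : w v < w v + d by rewrite ltrDl.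
    by have := wusc v (inner_cylinder vi) _ wd; rewrite near_withinE.
  have N2 : \forall q \near v, `|phi1 v - phi1 q| < d.
    by apply: ((cvgrPdist_lt _ _).1 (C12_continuous C1 vi)).
  rewrite near_withinE; apply: filterS2 N1 N2 => q wq /ltr_normlP[_ pq] thq.
  have := wq (inner_cylinder (Kin q thq)).
  by move: pq; rewrite /d => *; lra.
pose c := w p - phi1 p.
have pi := Kin p thp; have Qp := inner_cylinder pi.
have [[op near_p] [_ Wphi]] := mU p thp.
have cge : - (2 * eps) < c.
  have := pmax z' (ltW thz'); rewrite -/c; move: phiz' => /ltr_normlP[+ _].
  by rewrite phi1z; lra.
have cth' : c <= - th p.
  have := SW w p Sw Qp; have := le_usc_envelope bdd Qp; rewrite -/Wu.
  by rewrite /c /phi1; move: Wphi; lra.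
have thp_m : th p < m by rewrite /eps in cge; have := th_ge0 p; lra.
(* Shifted by the maximal value c, phi1 touches w from above at p, and the shift leaves [oper]
   unchanged. *)
have := wtest p (fun v => phi1 v + c) pi.
have [Cc ->] := oper_addc F T0 c (w p) C1 (inner_itv pi).
move=> /(_ Cc); rewrite /c addrC subrK => /(_ erefl) H.
have : oper T F phi1 p (w p) <= 0.
  apply: H.
  have : \forall v \near p, th v < m by exact: (continuous_near_lt (cth p) thp_m).
  apply: filterS => v thv; rewrite addrC -lerBlDr; apply: pmax.
  exact: ltW.
apply/negP; rewrite -ltNge; apply: op.
have -> : w p - Wu z = (phi1 p - phi1 z) + c by rewrite /c phi1z; lra.
rewrite (le_lt_trans (ler_normD _ _))//.
have : `|c| < 2 * eps.
  by rewrite ltr_norml cge/=; have := th_ge0 p; lra.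
by rewrite (distrC (phi1 p)) /eps; move: near_p mne; lra.
Qed.

Hypothesis eF : degenerate_elliptic T F.

Definition lsc_envelope W z : R := - usc_envelope Q (fun w => - W w) z.

Lemma subsolution_bump W z phi : viscosity_subsolution T Omega F h psi W ->
  (forall z, Q z -> exists a, \forall w \near within Q (nbhs z), - W w <= a) ->
  inner z -> C12 T phi -> lsc_envelope W z = phi z ->
  (\forall w \near z, phi w <= lsc_envelope W w) -> oper T F phi z (phi z) < 0 ->
  exists V : R * M -> R, [/\ viscosity_subsolution T Omega F h psi V,
    forall w, Q w -> W w <= V w & exists2 w, Q w & W w < V w].
Proof.
move=> /viscosity_subsolutionP[Wusc Wl Wi Wtest] bdd zi Cphi Wz near_le neg.
have Qz := inner_cylinder zi.
have [th [[Cth cth th0 th_ge0 [tt td thh]] th_sub]] := peak_function T0 (inner_itv zi).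
pose phi1 v := phi v + (-1) * th v.
have C1 : C12 T phi1 := C12_lin T0 (-1) Cphi Cth.
have phi1z : phi1 z = phi z by rewrite /phi1 th0 mulr0 addr0.
have [|eta eta0 near_neg] := oper_sign_near (r0 := phi z) (P := fun r => r < 0) C1 zi
    (fun r r0 => lt_nbhsl r0).
  by rewrite (oper_add_flat F T0 (-1) _ Cphi Cth (inner_itv zi) tt td thh).
have near_phi1 : \forall v \near z, `|phi1 z - phi1 v| < eta / 2.
  by apply: ((cvgrPdist_lt _ _).1 (C12_continuous C1 zi)); rewrite divr_gt0.
have [m m0 [mU _]] := th_sub _ (filterI (filterI near_neg near_phi1)
  (filterI (inner_near zi) near_le)).
(* Since dlt < m, the modification is confined to th <= dlt, strictly inside the set where V is a
   maximum, so the two branches of V match. The bound dlt <= eta / 4 keeps phi2 within eta of phi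
   z. *)
pose dlt := Num.min m eta / 4.
have mn0 : 0 < Num.min m eta by rewrite lt_min m0.
have mnm : Num.min m eta <= m by rewrite ge_min lexx.
have mne : Num.min m eta <= eta by rewrite ge_min lexx orbT.
have dlt0 : 0 < dlt by rewrite divr_gt0.
have dlt_m : dlt < m by rewrite /dlt; lra.
pose phi2 v := phi1 v + dlt.
pose V v := if th v <= m then Num.max (W v) (phi2 v) else W v.
have Kin v : th v <= m -> inner v by move=> /mU[_ []].
(* Where th > dlt, phi2 lies below phi, hence below the lower envelope and below W. *)
have VW v : dlt < th v -> V v = W v.
  move=> thv; rewrite /V; case: ifP => // thm; apply: max_l.
  have vi := Kin v thm; have [_ [_ Wphi]] := mU v thm.
  have := le_usc_envelope bdd (inner_cylinder vi); rewrite lerNl -/(lsc_envelope W v).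
  by rewrite /phi2 /phi1; move: Wphi; lra.
have WV v : W v <= V v.
  by rewrite /V; case: ifP => // _; rewrite le_max lexx.
have phi2V v : th v <= m -> phi2 v <= V v.
  by move=> thm; rewrite /V thm le_max lexx orbT.
have Vnin v : ~ inner v -> V v = W v.
  by rewrite /V; case: ifP => // /Kin.
have cphi2 v : inner v -> {for v, continuous phi2}.
  move=> vi; apply: (cvgD (F := nbhs v)); last exact: cvg_cst.
  exact: (C12_continuous C1 vi).
exists V; split=> //.
- apply/viscosity_subsolutionP; split.
  + move=> v Qv a va; have [thv|thv] := ltP dlt (th v).
      move: va; rewrite (VW _ thv) => /(Wusc v Qv).
      rewrite !near_withinE; apply: filterS2 (continuous_near_gt (cth v) thv).
      by move=> q thq Wq Qq; rewrite (VW _ thq); exact: Wq.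
    have thm := le_lt_trans thv dlt_m.
    have Wa := Wusc v Qv a (le_lt_trans (WV v) va).
    have pa := continuous_near_lt (cphi2 v (Kin v (ltW thm))) (le_lt_trans (phi2V v (ltW thm)) va).
    move: Wa; rewrite !near_withinE; apply: filterS2 pa => q pq Wq Qq.
    by rewrite /V; case: ifP => _; rewrite ?gt_max ?Wq.
  + by move=> v lv; rewrite Vnin; [exact: Wl|case=> _ Ov; case: lv => _ [_]; apply].
  + by move=> x cx; rewrite Vnin; [exact: Wi|case; rewrite /= ltxx].
  move=> v chi vi Cchi Vchi near_chi.
  (* If V v = W v, a function touching V from above touches W, because W <= V. Otherwise V v = phi2
     v, the function touches phi2, and [oper_contact] transfers the inequality known for phi1. *)
  have [VWv|VWv] := eqVneq (V v) (W v).
    rewrite VWv; apply: Wtest => //; first by rewrite -VWv.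
    by apply: filterS near_chi => q; apply: le_trans.
  have thv : th v <= dlt by rewrite leNgt; apply/negP => /VW E; rewrite E eqxx in VWv.
  have thm := le_lt_trans thv dlt_m.
  have Vphi : V v = phi2 v.
    by move: VWv; rewrite /V (ltW thm); case: leP => //; rewrite eqxx.
  have [C2 opE] := oper_addc F T0 dlt (V v) C1 (inner_itv vi).
  have touch : \forall q \near v, phi2 q <= chi q.
    apply: filterS2 (continuous_near_lt (cth v) thm) near_chi => q thq.
    by apply: le_trans; apply: phi2V; exact: ltW.
  have eq2 : phi2 v = chi v by rewrite -Vphi.
  have := oper_contact T0 (V v) eF C2 Cchi vi.1 eq2 touch.
  rewrite opE => /le_trans; apply.
  have [[negv near_v] _] := mU v (ltW thm).
  apply: ltW; apply: negv; rewrite Vphi /phi2.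
  move: near_v; rewrite phi1z => near_v.
  rewrite addrAC (le_lt_trans (ler_normD _ _))// (gtr0_norm dlt0) (distrC (phi1 v)).
  by rewrite /dlt; move: near_v mne; lra.
(* Near z, phi2 exceeds phi z + dlt / 2, while W falls below this value at points arbitrarily close
   to z, where its lower envelope is phi z; at such a point V is larger than W. *)
have near_th := continuous_near_lt (cth z) (_ : th z < m).
have near_phi1' : \forall v \near z, phi z - dlt / 2 < phi1 v.
  apply: (continuous_near_gt (C12_continuous C1 zi)).
  by rewrite phi1z gtrBl divr_gt0.
have Wgt : - phi z - dlt / 2 < usc_envelope Q (fun w => - W w) z.
  by move: Wz; rewrite /lsc_envelope => <-; rewrite opprK gtrBl divr_gt0.
have [|q [[thq phiq] Qq Wq]] := usc_envelope_gt Qz Wgt (filterI (near_th _) near_phi1').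
  by rewrite th0.
exists q => //; apply: lt_le_trans (phi2V q (ltW thq)).
by rewrite /phi2; move: phiq Wq; lra.
Qed.

Variables (ulow uup : R * M -> R).
Hypothesis comparison : comparison_holds T Omega F h psi.
Hypothesis sub_low : viscosity_subsolution T Omega F h psi ulow.
Hypothesis super_up : viscosity_supersolution T Omega F h psi uup.
Hypothesis env_fin : forall z, Q z ->
  lower_envelope Q ulow z \is a fin_num /\ upper_envelope Q uup z \is a fin_num.
Hypothesis env_initial : forall x, closure Omega x ->
  lower_envelope Q ulow (0, x) = (psi x)%:E /\ upper_envelope Q uup (0, x) = (psi x)%:E.
Hypothesis env_lateral : forall z, lateral_boundary T Omega z ->
  lower_envelope Q ulow z = (h z)%:E /\ upper_envelope Q uup z = (h z)%:E.

Let S := [set w : R * M -> R | (forall z, Q z -> ulow z <= w z <= uup z) /\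
  viscosity_subsolution T Omega F h psi w].
Let W := perron T Omega F h psi ulow uup.

(** The upper constraint in S is automatic by comparison with [uup], so enlarging a competitor
    within the subsolutions stays in S. *)
Let S_above (w : R * M -> R) : viscosity_subsolution T Omega F h psi w ->
  (forall z, Q z -> ulow z <= w z) -> S w.
Proof. by move=> sw lw; split=> // z Qz; rewrite lw//=; exact: comparison. Qed.

Let S_low : S ulow. Proof. exact: S_above. Qed.

Let has_sup_S z : Q z -> has_sup [set w z | w in S].
Proof.
move=> Qz; split; first by exists (ulow z); exists ulow.
by exists (uup z) => _ [w [/(_ z Qz)/andP[_ wu] _] <-].
Qed.

Let le_W (w : R * M -> R) z : S w -> Q z -> w z <= W z.
Proof. by move=> Sw Qz; apply: ub_le_sup; [exact: (has_sup_S Qz).2|exists w]. Qed.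

Let W_gt z b : Q z -> b < W z -> exists2 w : R * M -> R, S w & b < w z.
Proof.
move=> Qz bW; have [_ [w Sw <-] bw] := sup_gt (has_sup_S Qz).1 bW.
by exists w.
Qed.

Let W_le_up z : Q z -> W z <= uup z.
Proof.
move=> Qz; apply: ge_sup; first exact: (has_sup_S Qz).1.
by move=> _ [w [/(_ z Qz)/andP[_ wu] _] <-].
Qed.

Let W_near_up z a : Q z -> (upper_envelope Q uup z < a%:E)%E ->
  \forall w \near within Q (nbhs z), W w <= a.
Proof.
move=> Qz /upper_envelope_near; rewrite !near_withinE; apply: filterS => w uw Qw.
by rewrite (le_trans (W_le_up Qw))// ltW// uw.
Qed.

Let W_near_low z a : Q z -> (a%:E < lower_envelope Q ulow z)%E ->
  \forall w \near within Q (nbhs z), - W w <= - a.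
Proof.
move=> Qz /lower_envelope_near; rewrite !near_withinE; apply: filterS => w uw Qw.
by rewrite lerN2 (le_trans (ltW (uw Qw)))// le_W.
Qed.

(** Finiteness of the envelopes of [ulow] and [uup] makes W locally bounded, so that its real-valued
    envelopes are meaningful. *)
Let W_bdd z : Q z -> exists a, \forall w \near within Q (nbhs z), W w <= a.
Proof.
move=> Qz; have [_ fz] := env_fin Qz; exists (fine (upper_envelope Q uup z) + 1).
by apply: W_near_up => //; rewrite EFinD fineK// lteDl.
Qed.

Let NW_bdd z : Q z -> exists a, \forall w \near within Q (nbhs z), - W w <= a.
Proof.
move=> Qz; have [fz _] := env_fin Qz; exists (- (fine (lower_envelope Q ulow z) - 1)).
by apply: W_near_low => //; rewrite EFinB fineK// lteBlDr// lteDl.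
Qed.

Let W_env_le z b : Q z -> upper_envelope Q uup z = b%:E -> usc_envelope Q W z <= b.
Proof.
move=> Qz E; apply/ler_addgt0Pr => e e0; apply: usc_envelope_le => //.
by apply: W_near_up => //; rewrite E lte_fin ltrDl.
Qed.

Let W_env_ge z b : Q z -> lower_envelope Q ulow z = b%:E -> b <= lsc_envelope W z.
Proof.
move=> Qz E; rewrite lerNr; apply/ler_addgt0Pr => e e0; apply: usc_envelope_le => //.
rewrite -[- b + e]opprK; apply: W_near_low => //.
by rewrite E lte_fin opprD opprK gtrBl.
Qed.

Let W_sub : viscosity_subsolution T Omega F h psi W.
Proof.
have Wu_sub : viscosity_subsolution T Omega F h psi (usc_envelope Q W).
  apply/viscosity_subsolutionP; split.
  - by move=> z Qz a; exact: usc_envelope_near.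
  - by move=> z lz; apply: W_env_le (env_lateral lz).2; exact: lateral_cylinder.
  - by move=> x cx; apply: W_env_le (env_initial cx).2; exact: initial_cylinder.
  apply: (sub_test_sup (S := S)) => //.
  by move=> w [_ /viscosity_subsolutionP[]].
apply: (eq_viscosity_subsolution _ Wu_sub) => z Qz; apply/eqP; rewrite eq_le.
rewrite le_usc_envelope// andbT; apply: le_W => //; apply: S_above => // w Qw.
by rewrite (le_trans (le_W S_low Qw))// le_usc_envelope.
Qed.

Lemma perron_solution : viscosity_solution T Omega F h psi W.
Proof.
split; first exact: W_sub.
have lsc_le z : Q z -> lsc_envelope W z <= W z.
  by move=> Qz; rewrite lerNl; exact: (le_usc_envelope NW_bdd Qz).
have Wl_super : viscosity_supersolution T Omega F h psi (lsc_envelope W).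
  apply/viscosity_supersolutionP; split.
  - move=> z Qz a; rewrite ltrNr => /(usc_envelope_near NW_bdd Qz).
    by apply: filterS => w; rewrite ltrNr.
  - by move=> z lz; apply: W_env_ge (env_lateral lz).1; exact: lateral_cylinder.
  - by move=> x cx; apply: W_env_ge (env_initial cx).1; exact: initial_cylinder.
  move=> z phi zi Cphi Wz near_le; rewrite leNgt Wz; apply/negP => neg.
  have [V [Vsub WV [w Qw wV]]] := subsolution_bump W_sub NW_bdd zi Cphi Wz near_le neg.
  have SV : S V by apply: S_above => // v Qv; rewrite (le_trans (le_W S_low Qv))// WV.
  by have := le_W SV Qw; rewrite leNgt wV.
apply: (eq_viscosity_supersolution _ Wl_super) => z Qz; apply/eqP; rewrite eq_le lsc_le//=.
exact: comparison W_sub Wl_super _ Qz.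
Qed.

End perron_method.

Theorem theorem4p1 (R : realType) (n : nat) (M : riemannianManifold R n)
    (Omega : set M) (T : R) (h : R * M -> R) (psi : M -> R) (F : nonlinearity M)
    (ulow uup : R * M -> R) :
  complete_riemannian M ->
  open Omega -> rbounded Omega ->
  0 < T ->
  {within cylinder T Omega, continuous h} ->
  {within closure Omega, continuous psi} ->
  continuous_on_chi T F ->
  degenerate_elliptic T F ->
  comparison_holds T Omega F h psi ->
  viscosity_subsolution T Omega F h psi ulow ->
  viscosity_supersolution T Omega F h psi uup ->
  (* the envelopes of ulow and uup are real-valued functions *)
  (forall z, cylinder T Omega z ->
     lower_envelope (cylinder T Omega) ulow z \is a fin_num /\
     upper_envelope (cylinder T Omega) uup z \is a fin_num) ->
  (forall x, closure Omega x ->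
     lower_envelope (cylinder T Omega) ulow (0, x) = (psi x)%:E /\
     upper_envelope (cylinder T Omega) uup (0, x) = (psi x)%:E) ->
  (forall z, lateral_boundary T Omega z ->
     lower_envelope (cylinder T Omega) ulow z = (h z)%:E /\
     upper_envelope (cylinder T Omega) uup z = (h z)%:E) ->
  viscosity_solution T Omega F h psi (perron T Omega F h psi ulow uup).
Proof.
move=> _ oOmega _ T0 _ _ cF eF comparison sub_low super_up env_fin env_init env_lat.
exact: perron_solution.
Qed.
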